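(* There is a polynomial-time algorithm that, given an instance $(M,d)$ of $d$-EDMC such that every row of $M$ has at most $\Delta$ unspecified entries, either correctly decides the instance, or outputs an equivalent instance $(M',d)$ such that $M'$ is a principal $n'\times n'$ submatrix of $M$ with $n'\le (d+1)(\Delta+1)^{2}$.
   Context: A partial matrix is an $n\times n$ symmetric matrix with zero diagonal in which some off-diagonal entries are specified (nonnegative reals) and the others are unspecified (symmetrically). The problem $d$-EDMC: given a partial matrix $M$ and $d\in\mathbb{N}$, decide whether the unspecified entries can be filled in so that the resulting matrix $D$ satisfies $D_{ij}=\|p_i-p_j\|_2^2$ for some points $p_1,\dots,p_n\in\mathbb{R}^d$ (not necessarily distinct). Two instances are equivalent if both are yes-instances or both are no-instances. A principal submatrix is obtained by deleting the same set of row and column indices. Computation is in the real RAM model. *)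

(* Defs.v *)
From HB Require Import structures.
From mathcomp Require Import all_boot all_order all_algebra.
From mathcomp Require Import reals.

Set Implicit Arguments.
Unset Strict Implicit.
Unset Printing Implicit Defensive.

Import Order.TTheory GRing.Theory Num.Theory.
Local Open Scope ring_scope.

(** * Partial matrices and Euclidean distance matrix completion *)

(* [Some x] is a specified entry with value x, [None] an unspecified one. *)
Definition partial_matrix (R : realType) (n : nat) (M : 'M[option R]_n) : Prop :=
  [/\ M^T = M,
      forall i, M i i = Some 0
    & forall i j x, M i j = Some x -> 0 <= x].

Definition unspecified_le (R : realType) (n : nat) (M : 'M[option R]_n)
    (Delta : nat) : Prop :=
  forall i, (#|[set j | M i j == None]| <= Delta)%N.

(* Written out because the library norm on 'rV[R]_d is the sup norm. *)
Definition sqdist (R : realType) (d : nat) (p q : 'rV[R]_d) : R :=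
  \sum_(k < d) (p 0 k - q 0 k) ^+ 2.

Definition completion (R : realType) (n : nat) (M : 'M[option R]_n)
    (D : 'M[R]_n) : Prop :=
  forall i j x, M i j = Some x -> D i j = x.

Definition EDM (R : realType) (n d : nat) (D : 'M[R]_n) : Prop :=
  exists p : 'I_n -> 'rV[R]_d, forall i j, D i j = sqdist (p i) (p j).

Definition EDMC (R : realType) (n : nat) (M : 'M[option R]_n) (d : nat) : Prop :=
  exists D : 'M[R]_n, completion M D /\ EDM d D.

(* The increasing map f enumerates the indices that are kept. *)
Definition principal_submatrix (T : Type) (m n : nat) (M' : 'M[T]_m)
    (M : 'M[T]_n) : Prop :=
  exists f : 'I_m -> 'I_n,
    (forall i j : 'I_m, (i < j)%N -> (f i < f j)%N) /\ M' = mxsub f f M.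

(** * Real RAM

   There are two unbounded memories: W holds natural numbers (used for
   addressing and control), Z holds real numbers.  Every instruction takes unit
   time.  Words are unbounded but only have addition and truncated subtraction,
   and reals can never be converted to words (there is no floor), so unit cost
   does not hide super-polynomial computation on bit strings. *)

Inductive verdict := Accept | Reject | Output.

Inductive arith := Add | Sub | Mul | Div.

Inductive instr :=
| WConst of nat & nat          (* W[a] <- c *)
| WCopy of nat & nat           (* W[a] <- W[b] *)
| WLoad of nat & nat           (* W[a] <- W[W[b]] *)
| WStore of nat & nat          (* W[W[a]] <- W[b] *)
| WAdd of nat & nat & nat      (* W[a] <- W[b] + W[c] *)
| WSub of nat & nat & nat      (* W[a] <- max(W[b] - W[c], 0) *)
| ZCast of nat & nat           (* Z[a] <- W[b] *)
| ZCopy of nat & nat           (* Z[a] <- Z[b] *)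
| ZLoad of nat & nat           (* Z[a] <- Z[W[b]] *)
| ZStore of nat & nat          (* Z[W[a]] <- Z[b] *)
| ZOp of arith & nat & nat & nat  (* Z[a] <- Z[b] op Z[c] *)
| Jump of nat                  (* goto l *)
| JumpWEq of nat & nat & nat   (* if W[a] = W[b] goto l *)
| JumpWLt of nat & nat & nat   (* if W[a] < W[b] goto l *)
| JumpZEq0 of nat & nat        (* if Z[a] = 0 goto l *)
| JumpZGt0 of nat & nat        (* if Z[a] > 0 goto l *)
| Halt of verdict.

Definition program := seq instr.

Record state (R : realType) :=
  State { pc : nat; word : nat -> nat; real : nat -> R }.

(* Division by zero yields 0, the convention of the library. *)
Definition arith_eval (R : realType) (o : arith) (x y : R) : R :=
  match o with
  | Add => x + y
  | Sub => x - y
  | Mul => x * y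
  | Div => x / y
  end.

Definition set_word (R : realType) (s : state R) (a v : nat) : state R :=
  State (pc s).+1 [eta word s with a |-> v] (real s).

Definition set_real (R : realType) (s : state R) (a : nat) (x : R) : state R :=
  State (pc s).+1 (word s) [eta real s with a |-> x].

Definition branch (R : realType) (s : state R) (b : bool) (l : nat) : state R :=
  State (if b then l else (pc s).+1) (word s) (real s).

Definition step (R : realType) (ins : instr) (s : state R) : state R :=
  let W := word s in
  let Z := real s in
  match ins with
  | WConst a c => set_word s a c
  | WCopy a b => set_word s a (W b)
  | WLoad a b => set_word s a (W (W b))
  | WStore a b => set_word s (W a) (W b)
  | WAdd a b c => set_word s a (W b + W c)%N
  | WSub a b c => set_word s a (W b - W c)%N
  | ZCast a b => set_real s a (W b)%:R
  | ZCopy a b => set_real s a (Z b)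
  | ZLoad a b => set_real s a (Z (W b))
  | ZStore a b => set_real s (W a) (Z b)
  | ZOp o a b c => set_real s a (arith_eval o (Z b) (Z c))
  | Jump l => branch s true l
  | JumpWEq a b l => branch s (W a == W b) l
  | JumpWLt a b l => branch s (W a < W b)%N l
  | JumpZEq0 a l => branch s (Z a == 0) l
  | JumpZGt0 a l => branch s (0 < Z a) l
  | Halt _ => s
  end.

(* [run P t s = Some (v, s')] iff P, started in s, executes [Halt v] in state s'
   as one of its first t instructions; a program counter that leaves P crashes
   the machine. *)
Fixpoint run (R : realType) (P : program) (t : nat) (s : state R) :
    option (verdict * state R) :=
  if t is t'.+1 then
    match onth P (pc s) with
    | Some (Halt v) => Some (v, s)
    | Some ins => run P t' (step ins s)
    | None => None
    end
  else None.

(* Machine data: the words and the reals stored from address 0 on. *)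
Definition data (R : realType) : Type := (seq nat * seq R)%type.

(* Number of memory cells. *)
Definition data_size (R : realType) (x : data R) : nat :=
  (size x.1 + size x.2)%N.

Definition start (R : realType) (x : data R) : state R :=
  State 0 (nth 0%N x.1) (nth 0 x.2).

Definition stores (R : realType) (s : state R) (x : data R) : Prop :=
  (forall a, (a < size x.1)%N -> word s a = nth 0%N x.1 a) /\
  (forall a, (a < size x.2)%N -> real s a = nth 0 x.2 a).

(* W = n, d, then n^2 flags (1 = specified); Z = n^2 values (0 where
   unspecified); both in row-major order. *)
Definition instance_data (R : realType) (n : nat) (M : 'M[option R]_n)
    (d : nat) : data R :=
  let entries := [seq M i j | i <- enum 'I_n, j <- enum 'I_n] in
  (n :: d :: [seq nat_of_bool (isSome e) | e <- entries],
   [seq odflt 0 e | e <- entries]).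

(* Main.v *)
Require Import Defs.
From HB Require Import structures.
From mathcomp Require Import all_boot all_order all_algebra.
From mathcomp Require Import reals.
From mathcomp Require Import ring lra zify.
From Stdlib Require Import FunctionalExtensionality.

Set Implicit Arguments.
Unset Strict Implicit.
Unset Printing Implicit Defensive.

Import Order.TTheory GRing.Theory Num.Theory.
Local Open Scope ring_scope.

(** Colour the indices greedily so that equal colours are mutually specified; at
    most [Delta + 1] colours are used.  Inside a colour class, distribute the
    indices over at most [Delta + 1] bins: an index [v] enters the first bin on
    which it is not affinely dependent, as detected by Gram-Schmidt elimination
    with functionals read off the specified distances.  If the matrix is
    realizable in dimension [d], the members of a bin are affinely independent,
    so a bin has at most [d + 1] members; hence more than
    [(d + 1) (Delta + 1) ^ 2] placed indices certify a no-instance.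

    An index [v] that enters no bin is dropped.  It comes with an affine
    dependence [w] on each of [Delta + 1] disjoint bins such that all entries of
    [M w] visible from [v] and the bin agree.  Given a realization of the placed
    indices, put [v] at the affine combination given by [w].  The agreeing entries
    force the right distance to every [u] that is specified on [v] and on the
    bin, the point does not depend on the bin, and every [u] is fully specified
    on one of the bins.  So dropping [v] preserves realizability.

    The program is written in a small structured language whose only loops run
    over the indices, so its running time is polynomial by construction. *)

(** * Affine dependences in partial matrices *)

(** For weights [w] of total 0 on the points [p j], the weighted sum of the squared distances from
    [x] is [a - 2 x . W], where [W] is the weighted sum of the points. It is affine in [x], and at
    the point of [u] it can be read off row [u]. So elimination runs without coordinates, and its
    pivot [w^T M w] equals [- 2 |W|^2], which vanishes only when [W] does. The obstacle is that
    realizability is unknown during the run and that gaps hide rows of [M w]. Two claims are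
    therefore kept apart. That a dropped index passes the test on all visible rows is checked on the
    matrix itself; together with a realization of the placed indices, this is all that putting it
    back needs. That residuals and functionals are unitriangular is claimed only for a realizable
    [M], and serves only the count. Several bins are needed because a row may have gaps on some of
    them: each gap spoils at most one of [Delta + 1] disjoint bins. The factor [d + 1] is the
    dimension of homogeneous coordinates. [Delta] is not an input; the program works with the
    largest number of gaps in a row. *)

Definition val0 (R : realType) (n : nat) (M : 'M[option R]_n) (i j : 'I_n) : R :=
  odflt 0 (M i j).

Definition realizes (R : realType) (n d : nat) (M : 'M[option R]_n)
    (p : 'I_n -> 'rV[R]_d) : Prop :=
  forall i j x, M i j = Some x -> sqdist (p i) (p j) = x.

Lemma EDMC_realizes (R : realType) (n d : nat) (M : 'M[option R]_n) :
  EDMC M d <-> exists p : 'I_n -> 'rV[R]_d, realizes M p.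
Proof.
split=> [[D [cD [p Dp]]]|[p rp]].
  by exists p => i j x /cD <-; rewrite Dp.
exists (\matrix_(i, j) sqdist (p i) (p j)); split.
  by move=> i j x /rp <-; rewrite mxE.
by exists p => i j; rewrite mxE.
Qed.

Lemma sqdistC (R : realType) d (x z : 'rV[R]_d) : sqdist x z = sqdist z x.
Proof. by apply: eq_bigr => k _; rewrite -sqrrN opprB. Qed.

Lemma sqdistxx (R : realType) d (x : 'rV[R]_d) : sqdist x x = 0.
Proof. by apply: big1 => k _; rewrite subrr expr0n. Qed.

Lemma sqdist_eq0 (R : realType) d (x z : 'rV[R]_d) : sqdist x z = 0 -> x = z.
Proof.
move=> /eqP; rewrite psumr_eq0; last by move=> k _; exact: sqr_ge0.
move=> /allP H; apply/rowP => k; apply/eqP; rewrite -subr_eq0 -sqrf_eq0.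
by apply: H; rewrite mem_index_enum.
Qed.

(** The squared norms of the [X j] cancel in the difference, so only the total weight and the
    weighted sum of the points survive. With [z] a placed point this drives the placement, with
    [z = 0] it yields the functionals. *)
Lemma weighted_sqdistB (R : realType) (I : finType) d (w : I -> R)
    (X : I -> 'rV[R]_d) (x z : 'rV[R]_d) :
  \sum_j w j * sqdist x (X j) - \sum_j w j * sqdist z (X j) =
  (\sum_j w j) * (\sum_k (x 0 k ^+ 2 - z 0 k ^+ 2))
  - 2 * \sum_k (x 0 k - z 0 k) * (\sum_j w j * X j 0 k).
Proof.
rewrite -sumrB mulr_suml.
have -> : \sum_k (x 0 k - z 0 k) * (\sum_j w j * X j 0 k) =
    \sum_j w j * \sum_k (x 0 k - z 0 k) * X j 0 k.
  under eq_bigr do rewrite mulr_sumr.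
  rewrite exchange_big /=; apply: eq_bigr => j _; rewrite mulr_sumr.
  by apply: eq_bigr => k _; ring.
rewrite mulr_sumr -sumrB; apply: eq_bigr => j _.
rewrite -mulrBr [2 * _]mulrCA -mulrBr; congr (_ * _).
rewrite /sqdist -sumrB mulr_sumr -sumrB; apply: eq_bigr => k _; ring.
Qed.

Lemma balanced_sqdist (R : realType) (I : finType) d (w : I -> R)
    (X : I -> 'rV[R]_d) (x z : 'rV[R]_d) :
  \sum_j w j = 0 -> \sum_j w j *: X j = 0 ->
  \sum_j w j * sqdist x (X j) = \sum_j w j * sqdist z (X j).
Proof.
move=> w0 wX0; apply/eqP; rewrite -subr_eq0 weighted_sqdistB w0 mul0r sub0r.
rewrite big1 ?mulr0 ?oppr0 // => k _.
have /rowP/(_ k) := wX0; rewrite summxE mxE.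
by under eq_bigr do rewrite mxE; move=> ->; rewrite mulr0.
Qed.

(** Each element of [U] blocks at most one of the [D + 1] labels. It provides a free colour in the
    greedy colouring, and a bin on which a given row has no gap. *)
Lemma pigeonhole_label (T : finType) (U : {set T}) (D : nat) (lab : T -> nat) :
  (#|U| <= D)%N -> exists2 i, (i <= D)%N & forall u, u \in U -> lab u != i.
Proof.
move=> leUD.
case: (pickP [pred i : 'I_D.+1 | [forall (u | u \in U), lab u != i]]) => [i|noi].
  by move=> /= /forallP H; exists i; [rewrite -ltnS | move=> u uU; have /implyP := H u; exact].
suff : (#|'I_D.+1| <= #|U|)%N by rewrite card_ord leqNgt ltnS leUD.
have : [set: 'I_D.+1] \subset [set inord (lab u) | u in U].
  apply/subsetP => i _; have /negbT := noi i.
  rewrite negb_forall => /existsP[u]; rewrite negb_imply negbK => /andP[uU /eqP lu].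
  by apply/imsetP; exists u => //; rewrite lu inord_val.
move=> /subset_leq_card; rewrite cardsT => /leq_trans; apply.
exact: leq_imset_card.
Qed.

(* For squared distances, [M w] is constant exactly when the points weighted by
   [w] sum to 0; only the rows specified on [v] and [B] are tested. *)
Definition dependence (R : realType) (n : nat) (M : 'M[option R]_n)
    (v : 'I_n) (B : pred 'I_n) (w : 'I_n -> R) : Prop :=
  [/\ w v = 1, forall j, j != v -> w j != 0 -> B j, \sum_j w j = 0 &
      forall u, isSome (M u v) -> (forall k, B k -> isSome (M u k)) ->
        \sum_j val0 M u j * w j = \sum_j val0 M v j * w j].

(** * Placing a dropped index relative to one bin *)

Section Placement.
Variables (R : realType) (n d : nat) (M : 'M[option R]_n).
Variables (v : 'I_n) (B : pred 'I_n) (w : 'I_n -> R).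
Hypothesis pM : partial_matrix M.
Hypothesis depw : dependence M v B w.
Hypothesis Bspec : forall k l, B k -> B l -> isSome (M k l).
Hypothesis vspec : forall k, B k -> isSome (M k v).
Variable p : 'I_n -> 'rV[R]_d.

(** As [w v = 1] and the total weight is 0, the other weights sum to -1; the minus sign makes this
    an affine combination of points of the bin. Put in place of [p v], it brings the weighted sum of
    all points to zero. *)
Definition place : 'rV[R]_d := - \sum_(j | j != v) w j *: p j.

Let X j := if j == v then place else p j.

Let wX0 : \sum_j w j *: X j = 0.
Proof.
case: depw => wv _ _ _.
rewrite (bigD1 v) //= /X eqxx wv scale1r /place.
rewrite [X in _ + X](eq_bigr (fun j => w j *: p j)) ?addNr // => j /negbTE -> //.
Qed.

Let X_sum x : \sum_j w j * sqdist x (X j) =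
  sqdist x place + \sum_(j | j != v) w j * sqdist x (p j).
Proof.
case: depw => wv _ _ _.
rewrite (bigD1 v) //= /X eqxx wv mul1r; congr (_ + _).
by apply: eq_bigr => j /negbTE ->.
Qed.

(** The point is separate from the index because the position of a dropped [u] is not [p u]. *)
Definition faithful (x : 'rV[R]_d) (u : 'I_n) :=
  forall k, B k -> sqdist x (p k) = val0 M u k.

Let faithful_sum x u : faithful x u ->
  \sum_(j | j != v) w j * sqdist x (p j) = \sum_(j | j != v) val0 M u j * w j.
Proof.
case: depw => _ sw _ _ fx; apply: eq_bigr => j jv.
have [->|wj] := eqVneq (w j) 0; first by rewrite mul0r mulr0.
by rewrite fx ?sw // mulrC.
Qed.

Let val_sum u : \sum_j val0 M u j * w j =
  val0 M u v + \sum_(j | j != v) val0 M u j * w j.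
Proof. by case: depw => wv _ _ _; rewrite (bigD1 v) //= wv mulr1. Qed.

Let val0vv : val0 M v v = 0.
Proof. by case: pM => _ dM _; rewrite /val0 dM. Qed.

Let gap := \sum_(j | j != v) w j * sqdist place (p j)
           - \sum_(j | j != v) val0 M v j * w j.

(** [balanced_sqdist] moves the weighted sum of distances from [x] to [place], and [dependence]
    moves row [u] of [M w] to row [v]. Off [v] the terms for [x] and for row [u] agree by
    faithfulness, so the discrepancy at [v] is a constant. *)
Let place_gap x u : isSome (M u v) -> (forall k, B k -> isSome (M u k)) ->
  faithful x u -> sqdist x place - val0 M u v = gap.
Proof.
move=> uv uB fx; case: depw => wv sw w0 /(_ u uv uB).
rewrite !val_sum val0vv add0r => E.
have := balanced_sqdist x place w0 wX0; rewrite !X_sum sqdistxx add0r (faithful_sum fx).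
by rewrite /gap => F; lra.
Qed.

Hypothesis pB : forall k, B k -> faithful (p k) k.

(* The error [gap] at [u] does not depend on [u]; averaging it over the bin with the
   weights [w], which add up to [-1] there, shows that it vanishes. *)
Lemma sqdist_place x u : isSome (M u v) -> (forall k, B k -> isSome (M u k)) ->
  faithful x u -> sqdist x place = val0 M u v.
Proof.
move=> uv uB fx; apply/eqP; rewrite -subr_eq0 place_gap //.
case: depw => wv sw w0 _.
have sw1 : \sum_(j | j != v) w j = -1.
  by move: w0; rewrite (bigD1 v) //= wv => /eqP; rewrite addrC addr_eq0 => /eqP.
have symM k l : M k l = M l k by case: pM => tM _ _; rewrite -{1}tM mxE.
have : \sum_(j | j != v) w j * (sqdist place (p j) - val0 M v j) =
       \sum_(j | j != v) w j * gap.
  apply: eq_bigr => j jv.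
  have [->|wj] := eqVneq (w j) 0; first by rewrite !mul0r.
  have Bj := sw _ jv wj.
  rewrite sqdistC -(place_gap (u := j) (x := p j)) ?vspec //; last 2 first.
  - by move=> k Bk; exact: Bspec.
  - exact: pB.
  by rewrite /val0 symM.
(* The left side unfolds to [gap] and the right side is now [- gap], so twice [gap] is 0. *)
rewrite -mulr_suml sw1 mulN1r.
under eq_bigr do rewrite mulrBr [X in _ - X]mulrC.
by rewrite sumrB -/gap => /eqP; rewrite -addr_eq0 -mulr2n mulrn_eq0.
Qed.

(** Two points with the same distances to the bin have equal weighted sums off [v]; the balance
    identity then leaves [sqdist z place = 0]. Applied to the placement given by another bin, this
    makes the placement independent of the bin. *)
Lemma place_unique (z : 'rV[R]_d) :
  (forall k, B k -> sqdist (p k) z = val0 M k v) -> z = place.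
Proof.
move=> zB; apply: sqdist_eq0; case: depw => wv sw w0 _.
have := balanced_sqdist z place w0 wX0; rewrite !X_sum sqdistxx add0r.
rewrite [X in _ + X = _](_ : _ = \sum_(j | j != v) w j * sqdist place (p j)).
  by move=> F; lra.
apply: eq_bigr => j jv; have [->|wj] := eqVneq (w j) 0; first by rewrite !mul0r.
have Bj := sw _ jv wj; congr (_ * _).
rewrite [LHS]sqdistC [RHS]sqdistC zB // (sqdist_place (u := j)) ?vspec //.
- by move=> k Bk; exact: Bspec.
- exact: pB.
Qed.

End Placement.

(** Here [bin v = 0] marks a dropped index and the bins are numbered from 1, so [i <= D] ranges over
    the [D + 1] bins of the colour of [v]. *)
Theorem realizes_extend (R : realType) (n d D : nat) (M : 'M[option R]_n)
    (col bin : 'I_n -> nat) (p : 'I_n -> 'rV[R]_d) :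
  partial_matrix M -> unspecified_le M D ->
  (forall u v, col u = col v -> isSome (M u v)) ->
  (forall v i, bin v = 0%N -> (i <= D)%N ->
     exists w, dependence M v [pred k | (bin k == i.+1) && (col k == col v)] w) ->
  (forall u v x, bin u != 0%N -> bin v != 0%N -> M u v = Some x ->
     sqdist (p u) (p v) = x) ->
  exists q : 'I_n -> 'rV[R]_d, realizes M q.
Proof.
move=> pM uM colM dep rp.
have [tM dM _] := pM.
have symM k l : M k l = M l k by rewrite -{1}tM mxE.
pose B v i := [pred k : 'I_n | (bin k == i.+1) && (col k == col v)].
(* The guards move below the existential, with 0 as a dummy family, so that finite choice yields one
   function [w]. *)
have {}dep v i : exists w, bin v = 0%N -> (i <= D)%N -> dependence M v (B v i) w.
  case: (eqVneq (bin v) 0%N) => [bv|bv]; last by exists (fun=> 0) => bv0; rewrite bv0 in bv.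
  case: (leqP i D) => iD; last by exists (fun=> 0).
  by have [w ?] := dep v i bv iD; exists w.
have [w {}dep] : exists w : 'I_n -> nat -> 'I_n -> R, forall v i,
    bin v = 0%N -> (i <= D)%N -> dependence M v (B v i) (w v i).
  have : forall v, exists wv : {ffun 'I_D.+1 -> 'I_n -> R}, forall i : 'I_D.+1,
      bin v = 0%N -> dependence M v (B v i) (wv i).
    move=> v; have /fin_all_exists[f Hf] := fun i : 'I_D.+1 => dep v i.
    exists [ffun i => f i] => i bv; rewrite ffunE; apply: Hf => //; rewrite -ltnS; exact: ltn_ord.
  move=> /fin_all_exists[f Hf].
  exists (fun v i => f v (inord i)) => v i bv iD.
  by have := Hf v (inord i) bv; rewrite inordK.
pose q v := if bin v == 0%N then place v (w v 0%N) p else p v.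
have isS u v : isSome (M u v) -> M u v = Some (val0 M u v).
  by rewrite /val0; case: (M u v).
have Bsp v i k l : B v i k -> B v i l -> isSome (M k l).
  by move=> /andP[_ /eqP ck] /andP[_ /eqP cl]; apply: colM; rewrite ck cl.
have vsp v i k : B v i k -> isSome (M k v).
  by move=> /andP[_ /eqP ck]; apply: colM.
have keptB v i k : B v i k -> bin k != 0%N by move=> /andP[/eqP ->].
have fB v i k u : B v i k -> bin u != 0%N -> (forall k, B v i k -> isSome (M u k)) ->
     faithful M (B v i) p (p u) u.
  move=> Bk bu uB l Bl; apply: rp (keptB _ _ _ Bl) (isS _ _ (uB _ Bl)) => //.
have pB v i k : B v i k -> faithful M (B v i) p (p k) k.
  by move=> Bk; apply: (fB _ _ _ _ Bk) => [|l Bl]; [exact: keptB Bk | exact: Bsp Bk Bl].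
(* The point built from the first bin has the right distances to bin [i]: the members of bin [i]
   share the colour of the first bin and so see all of it. Uniqueness then identifies the two
   placements. *)
have placed v i : bin v = 0%N -> (i <= D)%N -> place v (w v i) p = place v (w v 0%N) p.
  move=> bv iD; symmetry; apply: (place_unique pM (dep v i bv iD)) => //.
  - exact: Bsp.
  - exact: vsp.
  - exact: pB.
  move=> k Bk; apply: (sqdist_place pM (dep v 0%N bv (leq0n _))).
  - exact: Bsp.
  - exact: vsp.
  - exact: pB.
  - exact: vsp Bk.
  - move=> l /andP[_ /eqP cl]; case/andP: Bk => _ /eqP ck; apply: colM; congruence.
  - move=> l Bl; apply: rp (keptB _ _ _ Bk) (keptB _ _ _ Bl) (isS _ _ _).
    case/andP: Bk => _ /eqP ck; case/andP: Bl => _ /eqP cl; apply: colM; congruence.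
(* The label of [k] is its bin number counted from 0. Indices of other colours get the label
   [D + 1], which is out of range and blocks no bin. *)
have free_bin u c : exists2 i, (i <= D)%N & forall k,
    bin k = i.+1 -> col k = c -> isSome (M u k).
  have [|i iD Hi] := pigeonhole_label (D := D)
    (fun k => if col k == c then (bin k).-1 else D.+1) (U := [set j | M u j == None]).
    exact: uM.
  exists i => // k bk ck; have := Hi k; rewrite inE ck eqxx bk /= eqxx.
  by case: (M u k) => //= /(_ isT).
(* The bin is chosen after [u], as one on which row [u] has no gap; [placed] allows replacing the
   first bin by it. *)
have step u v : bin v = 0%N -> isSome (M u v) ->
    (forall i k, (i <= D)%N -> B v i k -> isSome (M u k) -> sqdist (q u) (p k) = val0 M u k) ->
    sqdist (q u) (q v) = val0 M u v.
  move=> bv uv fu; rewrite {2}/q bv eqxx.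
  have [i iD Hi] := free_bin u (col v).
  have uB k : B v i k -> isSome (M u k) by move=> /andP[/eqP bk /eqP ck]; exact: Hi.
  rewrite -(placed v i bv iD).
  apply: (sqdist_place pM (dep v i bv iD)) => //.
  - exact: Bsp.
  - exact: vsp.
  - exact: pB.
  - by move=> k Bk; apply: (fu i k) => //; exact: uB.
(* A placed [u] is treated first. Read backwards, this case gives the distances from a dropped index
   to the placed ones, which [step] requires when both indices are dropped. *)
have half u v : bin u != 0%N -> isSome (M u v) -> sqdist (q u) (q v) = val0 M u v.
  move=> bu uv; have [bv|bv] := eqVneq (bin v) 0%N; last first.
    by rewrite /q (negbTE bu) (negbTE bv); exact: rp (isS _ _ uv).
  apply: step => // i k iD Bk uk.
  by rewrite /q (negbTE bu); apply: rp (keptB _ _ _ Bk) (isS _ _ uk).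
exists q => u v x Mx.
have uv : isSome (M u v) by rewrite Mx.
suff -> : sqdist (q u) (q v) = val0 M u v by rewrite /val0 Mx.
have [bu|bu] := eqVneq (bin u) 0%N; last exact: half.
have valC a b : val0 M a b = val0 M b a by rewrite /val0 symM.
have [bv|bv] := eqVneq (bin v) 0%N; last first.
  by rewrite sqdistC valC; apply: half; rewrite // symM.
apply: step => // i k iD Bk uk.
have bk := keptB _ _ _ Bk.
have -> : p k = q k by rewrite /q (negbTE bk).
by rewrite sqdistC valC; apply: half; rewrite // symM.
Qed.

(** The vectors [\sum_j mu l j *: P j] for [l] in [A] pair with the functionals in a unitriangular
    way, hence are linearly independent in dimension [m]. In the application [C] is a colour class:
    outside it [beta] is computed from entries that may be unspecified, and does not represent a
    functional. *)
Lemma unitriangular_card (R : realType) (n m : nat) (A C : {pred 'I_n})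
    (mu beta : 'I_n -> 'I_n -> R) (P : 'I_n -> 'rV[R]_m) :
  (forall k, k \in A -> exists f : 'cV[R]_m, forall j, j \in C ->
     beta k j = (P j *m f) 0 0) ->
  (forall l j, l \in A -> mu l j != 0 -> j \in C) ->
  (forall k l, k \in A -> l \in A -> (k <= l)%N ->
     \sum_j beta k j * mu l j = (k == l)%:R) ->
  (#|A| <= m)%N.
Proof.
move=> fun_beta supp tri.
pose X := \matrix_(a < #|A|) \sum_j mu (enum_val a) j *: P j.
suff /eqP <- : row_free X by exact: rank_leq_col.
apply: inj_row_free => v vX; apply/rowP => a; rewrite mxE.
(* Coefficients vanish in increasing order of the index: the functional at [a] kills the later
   vectors, and the earlier ones have coefficient 0 by induction. *)
suff H N : forall a : 'I_#|A|, (enum_val a < N)%N -> v 0 a = 0.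
  exact: (H n a (ltn_ord _)).
elim: N => // N IH {}a; rewrite ltnS leq_eqVlt => /orP[/eqP aN|]; last exact: IH.
have [f Hf] := fun_beta _ (enum_valP a).
have Xf b : (X *m f) b 0 =
    \sum_j beta (enum_val a) j * mu (enum_val b) j.
  have -> : (X *m f) b 0 = (row b X *m f) 0 0 by rewrite -row_mul [RHS]mxE.
  rewrite rowK mulmx_suml summxE; apply: eq_bigr => j _.
  rewrite -scalemxAl mxE mulrC.
  have [->|mj] := eqVneq (mu (enum_val b) j) 0; first by rewrite !mulr0.
  by rewrite Hf // (supp _ _ (enum_valP b)).
have : (v *m X *m f) 0 0 = 0 by rewrite vX mul0mx mxE.
rewrite -mulmxA mxE (bigD1 a) //= big1 ?addr0 => [|b ba].
  by rewrite Xf tri ?enum_valP // eqxx mulr1.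
have [ab|ab] := leqP (enum_val a) (enum_val b).
  rewrite Xf tri ?enum_valP //.
  by rewrite (inj_eq enum_val_inj) eq_sym (negbTE ba) mulr0.
by rewrite IH ?mul0r // -aN.
Qed.

(** * Functionals and pivots read off [M w] *)

Section Pivot.
Variables (R : realType) (n d : nat) (M : 'M[option R]_n).
Variable p : 'I_n -> 'rV[R]_d.
Hypothesis rp : realizes M p.
Variable w : 'I_n -> R.
Hypothesis w0 : \sum_j w j = 0.

(** The leading 1 turns affine functions of a point into linear ones. *)
Definition homog (j : 'I_n) : 'rV[R]_(1 + d) := row_mx 1 (p j).

Let W k := \sum_j w j * p j 0 k.
Let a := \sum_j w j * sqdist 0 (p j).

Let row_value u : (forall j, w j != 0 -> isSome (M u j)) ->
  \sum_j val0 M u j * w j = a - 2 * \sum_k p u 0 k * W k.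
Proof.
move=> uw; rewrite (eq_bigr (fun j => w j * sqdist (p u) (p j))); last first.
  move=> j _; have [->|wj] := eqVneq (w j) 0; first by rewrite mulr0 mul0r.
  have := uw j wj; rewrite /val0 mulrC; case E: (M u j) => [x|] //= _.
  by rewrite (rp E).
apply/eqP; rewrite addrC -subr_eq; apply/eqP.
rewrite weighted_sqdistB w0 mul0r sub0r; congr (- (_ * _)).
by apply: eq_bigr => k _; rewrite mxE subr0.
Qed.

(** By [row_value], row [u] of [M w] is the constant [a] minus twice the inner product of [p u] with
    [W], hence linear in homogeneous coordinates. One [f] serves all rows that are specified on the
    support of [w]. *)
Lemma row_functional : exists f : 'cV[R]_(1 + d), forall u,
  (forall j, w j != 0 -> isSome (M u j)) ->
  \sum_j val0 M u j * w j = (homog u *m f) 0 0.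
Proof.
exists (col_mx a%:M (\col_k (- 2 * W k))) => u uw.
rewrite row_value // mul_row_col mul1mx !mxE eqxx mulr1n mulr_sumr -sumrN.
by congr (_ + _); apply: eq_bigr => k _; rewrite !mxE; ring.
Qed.

(** The quadratic form [w^T M w] equals [- 2 |W|^2]. If it is 0, then [W = 0] and [M w] has the same
    value [a] in every row that sees the support of [w]. *)
Lemma pivot_neq0 u v :
  (forall i j, w i != 0 -> w j != 0 -> isSome (M i j)) ->
  (forall j, w j != 0 -> isSome (M u j)) ->
  (forall j, w j != 0 -> isSome (M v j)) ->
  \sum_j val0 M u j * w j != \sum_j val0 M v j * w j ->
  \sum_i w i * (\sum_j val0 M i j * w j) != 0.
Proof.
move=> ww uw vw; apply: contra => /eqP E.
have W0 k : W k = 0.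
  have : \sum_i w i * (a - 2 * \sum_k p i 0 k * W k) = 0.
    rewrite -[RHS]E; apply: eq_bigr => i _.
    have [->|wi] := eqVneq (w i) 0; first by rewrite !mul0r.
    by rewrite row_value // => j; exact: ww.
  under eq_bigr do rewrite mulrBr.
  rewrite sumrB -mulr_suml w0 mul0r sub0r => /eqP; rewrite oppr_eq0.
  have -> : \sum_i w i * (2 * \sum_k p i 0 k * W k) = 2 * \sum_k W k ^+ 2.
    rewrite mulr_sumr; under eq_bigr do rewrite mulrCA mulr_sumr mulr_sumr.
    rewrite exchange_big /=; apply: eq_bigr => l _.
    rewrite expr2 {2}/W mulr_suml mulr_sumr.
    by apply: eq_bigr => i _; ring.
  rewrite mulf_eq0 pnatr_eq0 /= psumr_eq0; last by move=> l _; exact: sqr_ge0.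
  by move=> /allP/(_ k (mem_index_enum _)); rewrite sqrf_eq0 => /eqP.
by rewrite !row_value // !big1 // => k _; rewrite W0 mulr0.
Qed.

End Pivot.

(** * Runs of the machine *)

(** Quantifying over the remaining fuel lets runs compose by adding their times. The case [t' = 0]
    says that no halt occurs within [t] instructions. *)
Definition reaches (R : realType) (P : program) (t : nat) (s s' : state R) : Prop :=
  forall t', run P (t + t') s = run P t' s'.

Lemma reaches_trans (R : realType) P t1 t2 (s1 s2 s3 : state R) :
  reaches P t1 s1 s2 -> reaches P t2 s2 s3 -> reaches P (t1 + t2) s1 s3.
Proof. by move=> H1 H2 t'; rewrite -addnA H1 H2. Qed.

Definition halting (i : instr) : bool := if i is Halt _ then true else false.

Lemma reaches1 (R : realType) P (s : state R) i :
  onth P (pc s) = Some i -> ~~ halting i -> reaches P 1 s (step i s).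
Proof. by move=> Pi ni t'; rewrite add1n /= Pi; case: i ni {Pi}. Qed.

Lemma run_halt (R : realType) P (s : state R) v t :
  onth P (pc s) = Some (Halt v) -> run P t.+1 s = Some (v, s).
Proof. by move=> /= ->. Qed.

Lemma run_more (R : realType) P t t' (s : state R) r :
  run P t s = Some r -> (t <= t')%N -> run P t' s = Some r.
Proof.
elim: t t' s => // t IH [|t'] s //=; rewrite ltnS => + tt'.
by case: (onth P (pc s)) => // -[] > // H; apply: IH H tt'.
Qed.

Definition code_at (P : program) (l : nat) (c : seq instr) : Prop :=
  forall k, (k < size c)%N -> onth P (l + k) = onth c k.

Lemma code_at_cat P l c1 c2 : code_at P l (c1 ++ c2) ->
  code_at P l c1 /\ code_at P (l + size c1) c2.
Proof.
move=> H; split=> k kc.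
  by rewrite H ?size_cat ?ltn_addr // onth_cat kc.
by rewrite -addnA H ?size_cat ?ltn_add2l // onth_cat ltnNge leq_addr /= addKn.
Qed.

Lemma code_at_head P l i c : code_at P l (i :: c) ->
  onth P l = Some i /\ code_at P l.+1 c.
Proof.
move=> H; split; first by have := H 0%N isT; rewrite addn0.
by move=> k kc; rewrite addSnnS H.
Qed.

Lemma code_at_program A c B : code_at (A ++ c ++ B) (size A) c.
Proof.
move=> k kc; rewrite onth_cat ltnNge leq_addr /= addKn onth_cat kc //.
Qed.

Definition steps (R : realType) (c : seq instr) (s : state R) : state R :=
  foldl (fun s i => step i s) s c.

Definition basic (i : instr) : bool :=
  match i with
  | Jump _ | JumpWEq _ _ _ | JumpWLt _ _ _ | JumpZEq0 _ _ | JumpZGt0 _ _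
  | Halt _ => false
  | _ => true
  end.

Lemma steps_cat (R : realType) c1 c2 (s : state R) :
  steps (c1 ++ c2) s = steps c2 (steps c1 s).
Proof. exact: foldl_cat. Qed.

Lemma pc_step_basic (R : realType) i (s : state R) : basic i -> pc (step i s) = (pc s).+1.
Proof. by case: i. Qed.

Lemma pc_steps (R : realType) c (s : state R) : all basic c ->
  pc (steps c s) = (pc s + size c)%N.
Proof.
elim: c s => [|i c IH] s; first by rewrite addn0.
by move=> /= /andP[bi bc]; rewrite IH // pc_step_basic // addSnnS.
Qed.

Lemma reaches_steps (R : realType) P c (s : state R) : all basic c ->
  code_at P (pc s) c -> reaches P (size c) s (steps c s).
Proof.
elim: c s => [|i c IH] s //= /andP[bi bc] /code_at_head[Pi Pc].
apply: (@reaches_trans _ _ 1 (size c) _ (step i s)).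
  by apply: reaches1 => //; case: i bi {Pi}.
by apply: IH => //; rewrite pc_step_basic.
Qed.

(** The word [one] is set again in every round, so the body may use it as a temporary. Jump targets
    are absolute, hence the argument [l]. *)
Definition loop_code (l x b one : nat) (body : seq instr) : seq instr :=
  [:: JumpWLt x b (l + 2); Jump (l + 5 + size body)] ++ body ++
  [:: WConst one 1; WAdd x x one; Jump l].

(** A round costs 4 instructions besides the body, one for the test and three to increment and jump
    back; leaving costs 2. The invariant must survive changes of [x] and [one], which the loop
    itself writes. [maxn k0 N] covers a counter that starts above its bound, as may happen when the
    output is copied. *)
Lemma loop_reaches (R : realType) P l x b one body (I : nat -> state R -> Prop)
    (N T : nat) :
  code_at P l (loop_code l x b one body) -> x != one -> b != one -> x != b ->
  (forall k s s', (forall y, y != x -> y != one -> word s' y = word s y) ->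
     real s' =1 real s -> I k s -> I k s') ->
  (forall k s, (k < N)%N -> I k s -> word s x = k -> word s b = N ->
     pc s = (l + 2)%N ->
     exists t s', [/\ (t <= T)%N, reaches P t s s', I k.+1 s' &
       [/\ pc s' = (l + 2 + size body)%N, word s' x = k & word s' b = N]]) ->
  forall k0 s, I k0 s -> pc s = l -> word s x = k0 -> word s b = N ->
  exists t s', [/\ (t <= (N - k0) * (T + 4) + 2)%N, reaches P t s s',
    I (maxn k0 N) s' &
    [/\ pc s' = (l + 5 + size body)%N, word s' x = maxn k0 N & word s' b = N]].
Proof.
move=> Pc xo bo xb Iext body_ok k0 s.
move: Pc; rewrite /loop_code => /code_at_cat[/code_at_head[P0 /code_at_head[P1 _]]].
move=> /code_at_cat[_ /=] /code_at_head[P2 /code_at_head[P3 /code_at_head[P4 _]]].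
have [m] := ubnP (N - k0)%N; elim: m k0 s => // m IH k0 s.
rewrite ltnS => km Is ps sx sb.
case: (ltnP k0 N) => kN; last first.
  exists 2%N, (step (Jump (l + 5 + size body)) (step (JumpWLt x b (l + 2)) s)).
  split.
  - by rewrite leq_addl.
  - apply: (@reaches_trans _ _ 1 1); apply: reaches1; rewrite ?ps //.
    by rewrite /= sx sb ltnNge kN /= ps.
  - by apply: (Iext k0 s).
  - by [].
pose s1 := step (JumpWLt x b (l + 2)) s.
have ps1 : pc s1 = (l + 2)%N by rewrite /= sx sb kN.
have Is1 : I k0 s1 by apply: (Iext k0 s).
have [t [s2 [tT R2 I2 [ps2 s2x s2b]]]] := body_ok k0 s1 kN Is1 sx sb ps1.
pose s3 := step (Jump l) (steps [:: WConst one 1; WAdd x x one] s2).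
have R3 : reaches P 3 s2 s3.
  apply: (@reaches_trans _ _ 2 1); last by apply: reaches1; rewrite //= ps2.
  apply: (@reaches_steps _ P [:: WConst one 1; WAdd x x one]) => // -[|[|k]] //= _.
    by rewrite ps2 addn0.
  by rewrite ps2 addn1.
have s3x : word s3 x = k0.+1 by rewrite /= !eqxx (negbTE xo) s2x addn1.
have s3b : word s3 b = N by rewrite /= eq_sym (negbTE xb) (negbTE bo).
have I3 : I k0.+1 s3.
  apply: (Iext _ s2) => // y yx yo.
  by rewrite /= (negbTE yx) (negbTE yo).
have [|t' [s4 [tT' R4 I4 [ps4 s4x s4b]]]] := IH k0.+1 s3 _ I3 erefl s3x s3b.
  by lia.
have E : maxn k0.+1 N = N by lia.
rewrite E in I4 s4x; exists (1 + t + 3 + t')%N, s4; split=> //; first by nia.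
apply: reaches_trans R4; apply: reaches_trans R3; apply: reaches_trans R2.
by apply: (reaches1 (i := JumpWLt x b (l + 2))); rewrite ?ps.
Qed.

(** * A structured language and its compiler *)

Inductive wexp :=
| WVar of nat
| WNum of nat
| WPlus of wexp & wexp
| WMinus of wexp & wexp
| WArr of nat & wexp.

Inductive zexp :=
| ZVar of nat
| ZNat of wexp
| ZBin of arith & zexp & zexp
| ZArr of nat & wexp.

Inductive test :=
| TEq of wexp & wexp
| TLt of wexp & wexp
| TZero of zexp.

(* [For x c] runs [c] for x = 0, ..., n - 1, where n is the matrix size. *)
Inductive cmd :=
| Skip
| WLet of nat & wexp
| ZLet of nat & zexp
| WPut of nat & wexp & wexp
| ZPut of nat & wexp & zexp
| Seq of cmd & cmd
| If of test & cmd & cmd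
| For of nat & cmd.

Record store (R : realType) := Store {
  wv : nat -> nat;
  zv : nat -> R;
  wa : nat -> nat -> nat;
  za : nat -> nat -> R }.

Section Semantics.
Variables (R : realType) (N : nat).
Implicit Type m : store R.

Fixpoint wev m (e : wexp) : nat :=
  match e with
  | WVar x => wv m x
  | WNum c => c
  | WPlus e1 e2 => wev m e1 + wev m e2
  | WMinus e1 e2 => wev m e1 - wev m e2
  | WArr a e => wa m a (wev m e)
  end.

Fixpoint zev m (e : zexp) : R :=
  match e with
  | ZVar x => zv m x
  | ZNat e => (wev m e)%:R
  | ZBin o e1 e2 => arith_eval o (zev m e1) (zev m e2)
  | ZArr a e => za m a (wev m e)
  end.

Definition tev m (t : test) : bool :=
  match t with
  | TEq e1 e2 => wev m e1 == wev m e2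
  | TLt e1 e2 => (wev m e1 < wev m e2)%N
  | TZero e => zev m e == 0
  end.

Definition upd T (f : nat -> T) (x : nat) (v : T) (y : nat) : T :=
  if y == x then v else f y.

Definition wlet m x v := Store (upd (wv m) x v) (zv m) (wa m) (za m).
Definition zlet m x v := Store (wv m) (upd (zv m) x v) (wa m) (za m).
Definition wput m a i v := Store (wv m) (zv m) (upd (wa m) a (upd (wa m a) i v)) (za m).
Definition zput m a i v := Store (wv m) (zv m) (wa m) (upd (za m) a (upd (za m a) i v)).

(** After a loop its variable holds [N], because the compiled counter stops there. *)
Fixpoint exec (c : cmd) m : store R :=
  match c with
  | Skip => m
  | WLet x e => wlet m x (wev m e)
  | ZLet x e => zlet m x (zev m e)
  | WPut a i e => wput m a (wev m i) (wev m e)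
  | ZPut a i e => zput m a (wev m i) (zev m e)
  | Seq c1 c2 => exec c2 (exec c1 m)
  | If t c1 c2 => if tev m t then exec c1 m else exec c2 m
  | For x c => wlet (foldl (fun m k => exec c (wlet m x k)) m (iota 0 N)) x N
  end.

End Semantics.

Fixpoint wvars (c : cmd) : seq nat :=
  match c with
  | WLet x _ => [:: x]
  | Seq c1 c2 | If _ c1 c2 => wvars c1 ++ wvars c2
  | For x c => x :: wvars c
  | _ => [::]
  end.

Fixpoint zvars (c : cmd) : seq nat :=
  match c with
  | ZLet x _ => [:: x]
  | Seq c1 c2 | If _ c1 c2 => zvars c1 ++ zvars c2
  | For x c => zvars c
  | _ => [::]
  end.

Fixpoint warrs (c : cmd) : seq nat :=
  match c with
  | WPut a _ _ => [:: a]
  | Seq c1 c2 | If _ c1 c2 => warrs c1 ++ warrs c2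
  | For x c => warrs c
  | _ => [::]
  end.

Fixpoint zarrs (c : cmd) : seq nat :=
  match c with
  | ZPut a _ _ => [:: a]
  | Seq c1 c2 | If _ c1 c2 => zarrs c1 ++ zarrs c2
  | For x c => zarrs c
  | _ => [::]
  end.

(** * Frame rules: what a command leaves unchanged *)

Section Frame.
Variables (R : realType) (N : nat).
Implicit Type m : store R.

Lemma foldl_inv (T S : Type) (f : T -> S -> T) (Q : T -> Prop) s z :
  (forall z k, Q z -> Q (f z k)) -> Q z -> Q (foldl f z s).
Proof. by move=> H; elim: s z => //= k s IH z /(H _ k)/IH. Qed.

Lemma exec_wv c m x : x \notin wvars c -> wv (exec N c m) x = wv m x.
Proof.
elim: c m => //= [y e|c1 IH1 c2 IH2|t c1 IH1 c2 IH2|y c IH] m.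
- by rewrite inE /upd => /negbTE ->.
- by rewrite mem_cat negb_or => /andP[? ?]; rewrite IH2 // IH1.
- by rewrite mem_cat negb_or => /andP[? ?]; case: ifP; rewrite ?IH2 // IH1.
- rewrite inE negb_or => /andP[/negbTE xy xc]; rewrite /upd xy.
  by apply: (foldl_inv (Q := fun m' => wv m' x = wv m x)) => // m' k Q; rewrite IH //= /upd xy.
Qed.

Lemma exec_zv c m x : x \notin zvars c -> zv (exec N c m) x = zv m x.
Proof.
elim: c m => //= [y e|c1 IH1 c2 IH2|t c1 IH1 c2 IH2|y c IH] m.
- by rewrite inE /upd => /negbTE ->.
- by rewrite mem_cat negb_or => /andP[? ?]; rewrite IH2 // IH1.
- by rewrite mem_cat negb_or => /andP[? ?]; case: ifP; rewrite ?IH2 // IH1.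
- move=> xc.
  by apply: (foldl_inv (Q := fun m' => zv m' x = zv m x)) => // m' k Q; rewrite IH.
Qed.

Lemma exec_wa c m x : x \notin warrs c -> wa (exec N c m) x = wa m x.
Proof.
elim: c m => //= [y i e|c1 IH1 c2 IH2|t c1 IH1 c2 IH2|y c IH] m.
- by rewrite inE /upd => /negbTE ->.
- by rewrite mem_cat negb_or => /andP[? ?]; rewrite IH2 // IH1.
- by rewrite mem_cat negb_or => /andP[? ?]; case: ifP; rewrite ?IH2 // IH1.
- move=> xc.
  by apply: (foldl_inv (Q := fun m' => wa m' x = wa m x)) => // m' k Q; rewrite IH.
Qed.

Lemma exec_za c m x : x \notin zarrs c -> za (exec N c m) x = za m x.
Proof.
elim: c m => //= [y i e|c1 IH1 c2 IH2|t c1 IH1 c2 IH2|y c IH] m.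
- by rewrite inE /upd => /negbTE ->.
- by rewrite mem_cat negb_or => /andP[? ?]; rewrite IH2 // IH1.
- by rewrite mem_cat negb_or => /andP[? ?]; case: ifP; rewrite ?IH2 // IH1.
- move=> xc.
  by apply: (foldl_inv (Q := fun m' => za m' x = za m x)) => // m' k Q; rewrite IH.
Qed.

Lemma exec_for (I : nat -> store R -> Prop) x c m :
  (forall k m', (k < N)%N -> I k m' -> I k.+1 (exec N c (wlet m' x k))) ->
  I 0%N m -> exists2 m', I N m' & exec N (For x c) m = wlet m' x N.
Proof.
move=> step I0 /=; eexists; last by [].
suff H k : (k <= N)%N ->
    I k (foldl (fun m k => exec N c (wlet m x k)) m (iota 0 k)) by exact: H.
elim: k => // k IH kN; rewrite -addn1 iotaD foldl_cat /= add0n addn1.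
by apply: step => //; apply: IH; exact: ltnW.
Qed.

End Frame.

(* Word variables live at addresses below 32 (0: matrix size, 1: dimension,
   2: base of the arrays), temporaries between 32 and 63; cell i of array a is at
   address W[2] + 8 i + a, and likewise for the reals. *)
Definition address (t a : nat) : seq instr :=
  [:: WAdd t t t; WAdd t t t; WAdd t t t; WAdd t t 2; WConst t.+1 a; WAdd t t t.+1].

Fixpoint wcode (t : nat) (e : wexp) : seq instr :=
  match e with
  | WVar x => [:: WCopy t x]
  | WNum c => [:: WConst t c]
  | WPlus e1 e2 => wcode t e1 ++ wcode t.+1 e2 ++ [:: WAdd t t t.+1]
  | WMinus e1 e2 => wcode t e1 ++ wcode t.+1 e2 ++ [:: WSub t t t.+1]
  | WArr a e => wcode t e ++ address t a ++ [:: WLoad t t]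
  end.

Fixpoint zcode (t : nat) (e : zexp) : seq instr :=
  match e with
  | ZVar x => [:: ZCopy t x]
  | ZNat e => wcode 32 e ++ [:: ZCast t 32]
  | ZBin o e1 e2 => zcode t e1 ++ zcode t.+1 e2 ++ [:: ZOp o t t t.+1]
  | ZArr a e => wcode 32 e ++ address 32 a ++ [:: ZLoad t 32]
  end.

Definition tcode (t : test) (l : nat) : seq instr * instr :=
  match t with
  | TEq e1 e2 => (wcode 32 e1 ++ wcode 33 e2, JumpWEq 32 33 l)
  | TLt e1 e2 => (wcode 32 e1 ++ wcode 33 e2, JumpWLt 32 33 l)
  | TZero e => (zcode 32 e, JumpZEq0 32 l)
  end.

(** The length of a test does not depend on its jump target, so the dummy target 0 suffices to
    compute the positions of the branches. The else branch comes first, since the test jumps when it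
    holds. *)
Fixpoint code (l : nat) (c : cmd) : seq instr :=
  match c with
  | Skip => [::]
  | WLet x e => wcode 32 e ++ [:: WCopy x 32]
  | ZLet x e => zcode 32 e ++ [:: ZCopy x 32]
  | WPut a i e =>
      wcode 32 i ++ address 32 a ++ wcode 33 e ++ [:: WStore 32 33]
  | ZPut a i e =>
      zcode 32 e ++ wcode 32 i ++ address 32 a ++ [:: ZStore 32 32]
  | Seq c1 c2 => let k1 := code l c1 in k1 ++ code (l + size k1) c2
  | If t c1 c2 =>
      let l0 := (l + size (tcode t 0).1)%N in
      let k2 := code l0.+1 c2 in
      let l1 := (l0.+2 + size k2)%N in
      let k1 := code l1 c1 in
      (tcode t l1).1 ++ (tcode t l1).2 :: k2 ++ Jump (l1 + size k1) :: k1
  | For x c => WConst x 0 :: loop_code l.+1 x 0 32 (code l.+3 c)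
  end.

(** [t] is the height of the evaluation stack, which has to stay below address 64, where the arrays
    may begin. *)
Fixpoint wexp_ok (t : nat) (e : wexp) : bool :=
  match e with
  | WVar x => (x < 32) && (t < 64)
  | WNum _ => t < 64
  | WPlus e1 e2 | WMinus e1 e2 => wexp_ok t e1 && wexp_ok t.+1 e2
  | WArr a e => [&& a < 8, wexp_ok t e & t.+1 < 64]
  end%N.

Fixpoint zexp_ok (t : nat) (e : zexp) : bool :=
  match e with
  | ZVar x => (x < 32) && (t < 64)
  | ZNat e => wexp_ok 32 e && (t < 64)
  | ZBin o e1 e2 => zexp_ok t e1 && zexp_ok t.+1 e2
  | ZArr a e => [&& a < 8, wexp_ok 32 e & t < 64]
  end%N.

Definition test_ok (t : test) : bool :=
  match t with
  | TEq e1 e2 | TLt e1 e2 => wexp_ok 32 e1 && wexp_ok 33 e2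
  | TZero e => zexp_ok 32 e
  end.

Fixpoint cmd_ok (c : cmd) : bool :=
  match c with
  | Skip => true
  | WLet x e => [&& x < 32, x \notin [:: 0; 2] & wexp_ok 32 e]
  | ZLet x e => (x < 32) && zexp_ok 32 e
  | WPut a i e => [&& a < 8, wexp_ok 32 i & wexp_ok 33 e]
  | ZPut a i e => [&& a < 8, zexp_ok 32 e & wexp_ok 32 i]
  | Seq c1 c2 => cmd_ok c1 && cmd_ok c2
  | If t c1 c2 => [&& test_ok t, cmd_ok c1 & cmd_ok c2]
  | For x c => [&& x < 32, x \notin [:: 0; 2], cmd_ok c & x \notin wvars c]
  end%N.

(** A conditional is charged for both branches, which makes this upper bound a function of [N]
    alone. In a loop the 3 is the initialization of the counter and the 2 instructions of the
    exit. *)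
Fixpoint time (N : nat) (c : cmd) : nat :=
  match c with
  | Seq c1 c2 => time N c1 + time N c2
  | If t c1 c2 => size (tcode t 0).1 + 2 + time N c1 + time N c2
  | For x c => N * (time N c + 4) + 3
  | c => size (code 0 c)
  end.

(** * Correctness of the compiler *)

Section Compiler.
Variables (R : realType) (B : nat).
Hypothesis B64 : (64 <= B)%N.
Implicit Types (m : store R) (s : state R).

Record rep m s : Prop := Rep {
  rep_base : wv m 2 = B;
  rep_wv : forall x, (x < 32)%N -> word s x = wv m x;
  rep_zv : forall x, (x < 32)%N -> real s x = zv m x;
  rep_wa : forall a i, (a < 8)%N -> word s (B + 8 * i + a) = wa m a i;
  rep_za : forall a i, (a < 8)%N -> real s (B + 8 * i + a) = za m a i }.

Lemma rep_same m s s' :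
  (forall x, (x < 32)%N || (64 <= x)%N -> word s' x = word s x) ->
  (forall x, (x < 32)%N || (64 <= x)%N -> real s' x = real s x) ->
  rep m s -> rep m s'.
Proof.
move=> Hw Hr [H0 H1 H2 H3 H4]; split=> //.
- by move=> x xl; rewrite Hw ?xl // H1.
- by move=> x xl; rewrite Hr ?xl // H2.
- by move=> a i al; rewrite Hw ?H3 //; lia.
- by move=> a i al; rewrite Hr ?H4 //; lia.
Qed.

Lemma word_set_word s a v x : word (set_word s a v) x = if x == a then v else word s x.
Proof. by []. Qed.

Lemma address_ok t a s : word s 2 = B -> (2 < t)%N ->
  let s' := steps (address t a) s in
  [/\ word s' t = (B + 8 * word s t + a)%N, real s' = real s &
      forall x, x != t -> x != t.+1 -> word s' x = word s x].
Proof.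
move=> sB t2; have E : (2 == t) = false by lia.
have E' : (2 == t.+1) = false by lia.
have E1 : (t == t.+1) = false by lia.
have E2 : (t.+1 == t) = false by lia.
split=> //; rewrite /= ?eqxx ?E ?E' ?E1 ?E2 ?eqxx ?sB; first by lia.
by move=> x /negbTE xt /negbTE xt1; rewrite xt xt1.
Qed.

Lemma basic_address t a : all basic (address t a). Proof. by []. Qed.

Opaque address.

Lemma basic_wcode t e : all basic (wcode t e).
Proof.
elim: e t => //= [e1 IH1 e2 IH2|e1 IH1 e2 IH2|a e IH] t.
- by rewrite !all_cat IH1 IH2.
- by rewrite !all_cat IH1 IH2.
- by rewrite !all_cat IH basic_address.
Qed.

Lemma basic_zcode t e : all basic (zcode t e).
Proof.
elim: e t => //= [e|o e1 IH1 e2 IH2|a e] t.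
- by rewrite !all_cat basic_wcode ?basic_address.
- by rewrite !all_cat IH1 IH2.
- by rewrite !all_cat basic_wcode ?basic_address.
Qed.

Lemma wexp_ok_lt t e : wexp_ok t e -> (t < 64)%N.
Proof.
by elim: e t => /= [x t /andP[]|c t|e1 IH1 e2 _ t /andP[/IH1]|e1 IH1 e2 _ t /andP[/IH1]|
  a e _ t /and3P[_ _ /ltnW]].
Qed.

(** Code at height [t] leaves all words below [t] alone, so evaluating the second operand at [t.+1]
    preserves the first one. *)
Lemma wcode_ok m e t s : wexp_ok t e -> (32 <= t)%N -> rep m s ->
  let s' := steps (wcode t e) s in
  [/\ word s' t = wev m e, real s' = real s &
      forall x, (x < t)%N || (64 <= x)%N -> word s' x = word s x].
Proof.
have binary f (op : nat -> nat -> nat) e1 e2 :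
   (forall t s, step (f t) s = set_word s t (op (word s t) (word s t.+1))) ->
   (forall t s, wexp_ok t e1 -> (32 <= t)%N -> rep m s ->
     let s' := steps (wcode t e1) s in
     [/\ word s' t = wev m e1, real s' = real s &
       forall x, (x < t)%N || (64 <= x)%N -> word s' x = word s x]) ->
   (forall t s, wexp_ok t e2 -> (32 <= t)%N -> rep m s ->
     let s' := steps (wcode t e2) s in
     [/\ word s' t = wev m e2, real s' = real s &
       forall x, (x < t)%N || (64 <= x)%N -> word s' x = word s x]) ->
   forall t s, wexp_ok t e1 && wexp_ok t.+1 e2 -> (32 <= t)%N -> rep m s ->
     let s' := steps (wcode t e1 ++ wcode t.+1 e2 ++ [:: f t]) s in
     [/\ word s' t = op (wev m e1) (wev m e2), real s' = real s &
       forall x, (x < t)%N || (64 <= x)%N -> word s' x = word s x].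
  move=> Hf H1 H2 {}t {}s /andP[ok1 ok2] t32 ms.
  have [E1 R1 W1] := H1 t s ok1 t32 ms.
  have m1 : rep m (steps (wcode t e1) s).
    apply: rep_same ms => x /orP xl; rewrite ?R1 // W1 //; lia.
  have t32' : (32 <= t.+1)%N by lia.
  have [E2 R2 W2] := H2 t.+1 _ ok2 t32' m1.
  have tl : (t < 64)%N by exact: ltnW (wexp_ok_lt ok2).
  rewrite !steps_cat; cbn [steps foldl]; rewrite Hf /=; split.
  - by rewrite eqxx E2 W2 ?ltnS ?leqnn // E1.
  - by rewrite R2.
  - move=> x xl; rewrite (_ : (x == t) = false); last by lia.
    by rewrite W2 ?W1 //; lia.
elim: e t s => [x|c|e1 IH1 e2 IH2|e1 IH1 e2 IH2|a e IH] t s.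
- move=> /= /andP[xl tl] t32 ms; rewrite eqxx; split=> //.
    exact: rep_wv.
  by move=> y yl; rewrite (_ : (y == t) = false) //; lia.
- move=> /= tl t32 ms; rewrite eqxx; split=> //.
  by move=> y yl; rewrite (_ : (y == t) = false) //; lia.
- exact: (binary (fun t => WAdd t t t.+1) addn).
- exact: (binary (fun t => WSub t t t.+1) subn).
move=> /= /and3P[al eok tl] t32 ms.
have [E R1 W1] := IH t s eok t32 ms.
rewrite !steps_cat; set s1 := steps (wcode t e) s in E R1 W1 *; clearbody s1.
have s1B : word s1 2 = B by rewrite W1 ?(rep_wv ms) ?(rep_base ms) //; lia.
have t2 : (2 < t)%N by lia.
have [E2 R2 W2] := address_ok a s1B t2.
set s2 := steps (address t a) s1 in E2 R2 W2 *; clearbody s2; cbn [steps foldl]; split.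
- by rewrite [step _ _]/= word_set_word eqxx E2 E W2 ?W1 ?(rep_wa ms) //; lia.
- by rewrite /= R2.
- move=> x xl; rewrite [step _ _]/= word_set_word (_ : (x == t) = false); last by lia.
  by rewrite W2 ?W1 //; lia.
Qed.

Lemma zexp_ok_lt t e : zexp_ok t e -> (t < 64)%N.
Proof.
elim: e t => /= [x t /andP[]|e t /andP[]|o e1 IH1 e2 _ t /andP[/IH1]|a e t /and3P[]] //.
Qed.

Lemma zcode_ok m e t s : zexp_ok t e -> (32 <= t)%N -> rep m s ->
  let s' := steps (zcode t e) s in
  [/\ real s' t = zev m e,
      forall x, (x < 32)%N || (64 <= x)%N -> word s' x = word s x &
      forall x, (x < t)%N || (64 <= x)%N -> real s' x = real s x].
Proof.
elim: e t s => [x|e|o e1 IH1 e2 IH2|a e] t s.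
- move=> /= /andP[xl tl] t32 ms; rewrite eqxx; split=> //.
    exact: rep_zv.
  by move=> y yl; rewrite (_ : (y == t) = false) //; lia.
- move=> /= /andP[eok tl] t32 ms; have [E R1 W1] := wcode_ok eok (leqnn _) ms.
  rewrite steps_cat; cbn [steps foldl]; rewrite -/(steps _ _) /=; split.
  + by rewrite eqxx E.
  + exact: W1.
  + move=> x xl; rewrite (_ : (x == t) = false) ?R1 //; lia.
- move=> /= /andP[ok1 ok2] t32 ms.
  have tl := zexp_ok_lt ok1.
  have [E1 W1 R1] := IH1 t s ok1 t32 ms.
  have m1 : rep m (steps (zcode t e1) s).
    by apply: rep_same ms => x /orP xl; rewrite ?W1 ?R1 //; lia.
  have t32' : (32 <= t.+1)%N by lia.
  have [E2 W2 R2] := IH2 t.+1 _ ok2 t32' m1.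
  rewrite !steps_cat; cbn [steps foldl]; rewrite -/(steps _ _) -/(steps _ _) /=; split.
  + by rewrite eqxx E2 R2 ?ltnS ?leqnn // E1.
  + by move=> x xl; rewrite W2 // W1.
  + move=> x xl; rewrite (_ : (x == t) = false); last by lia.
    by rewrite R2 ?R1 //; lia.
move=> /= /and3P[al eok tl] t32 ms; have [E R1 W1] := wcode_ok eok (leqnn _) ms.
rewrite !steps_cat; set s1 := steps (wcode 32 e) s in E R1 W1 *; clearbody s1.
have s1B : word s1 2 = B by rewrite W1 // (rep_wv ms) // (rep_base ms).
have [E2 R2 W2] := address_ok a s1B (isT : (2 < 32)%N).
set s2 := steps (address 32 a) s1 in E2 R2 W2 *; clearbody s2; cbn [steps foldl]; split.
- by rewrite /= eqxx E2 E R2 R1 (rep_za ms).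
- move=> x xl; rewrite [step _ _]/= [word _ _]/= W2 ?W1 //; lia.
- by move=> x xl; rewrite /= (_ : (x == t) = false) ?R2 ?R1 //; lia.
Qed.

Lemma tcode_ok m t l s : test_ok t -> rep m s ->
  let s' := steps (tcode t l).1 s in
  [/\ rep m s', all basic (tcode t l).1, (tcode t l).1 = (tcode t 0).1,
      ~~ halting (tcode t l).2 &
      step (tcode t l).2 s' = branch s' (tev m t) l].
Proof.
have W2 e1 e2 : wexp_ok 32 e1 && wexp_ok 33 e2 -> rep m s ->
   let s' := steps (wcode 32 e1 ++ wcode 33 e2) s in
   [/\ rep m s', word s' 32 = wev m e1 & word s' 33 = wev m e2].
  move=> /andP[ok1 ok2] ms.
  have [E1 R1 W1] := wcode_ok ok1 (leqnn _) ms.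
  have m1 : rep m (steps (wcode 32 e1) s).
    by apply: rep_same ms => x xl; rewrite ?R1 // W1.
  have [E2 R2 W2] := wcode_ok ok2 (leqnSn _) m1.
  rewrite steps_cat; split=> //; last by rewrite W2.
  by apply: rep_same m1 => x xl; rewrite ?R2 // W2 //; lia.
case: t => [e1 e2|e1 e2|e] /= ok ms.
- have [m1 E1 E2] := W2 _ _ ok ms; split=> //; first by rewrite all_cat !basic_wcode.
  by rewrite E1 E2.
- have [m1 E1 E2] := W2 _ _ ok ms; split=> //; first by rewrite all_cat !basic_wcode.
  by rewrite E1 E2.
have [E W Z] := zcode_ok ok (leqnn _) ms; split=> //; last by rewrite E.
- by apply: rep_same ms.
- exact: basic_zcode.
Qed.

Lemma cmd_ok_wvars c x : cmd_ok c -> x \in [:: 0; 2]%N -> x \notin wvars c.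
Proof.
move=> + x02; elim: c => //=.
- by move=> y e /and3P[_ + _]; rewrite [x \in _]inE; apply: contra => /eqP <-.
- by move=> c1 I1 c3 I3 /andP[/I1 ? /I3 ?]; rewrite mem_cat negb_or; apply/andP.
- by move=> t c1 I1 c3 I3 /and3P[_ /I1 ? /I3 ?]; rewrite mem_cat negb_or; apply/andP.
- move=> y c I1 /and4P[_ y02 /I1 J _]; rewrite in_cons negb_or.
  by apply/andP; split=> //; apply: contra y02 => /eqP <-.
Qed.

Lemma code_ok N c : cmd_ok c -> forall P l m s,
  code_at P l (code l c) -> pc s = l -> rep m s -> wv m 0 = N ->
  exists t s', [/\ (t <= time N c)%N, reaches P t s s',
    pc s' = (l + size (code l c))%N & rep (exec N c m) s'].
Proof.
elim: c => [|x e|x e|a i e|a i e|c1 IH1 c2 IH2|t c1 IH1 c2 IH2|x c IH]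
    cok P l m s Pc pl ms m0.
- by exists 0%N, s; rewrite addn0.
- move: cok => /= /and3P[xl x02 eok].
  have [E R1 W1] := wcode_ok eok (leqnn _) ms.
  have bc : all basic (code l (WLet x e)) by rewrite all_cat basic_wcode.
  exists (size (code l (WLet x e))), (steps (code l (WLet x e)) s); split=> //.
  + by apply: reaches_steps; rewrite ?pl.
  + by rewrite pc_steps ?pl.
  case: ms R1 W1 => H0 H1 H2 H3 H4 R1 W1.
  rewrite /= steps_cat; cbn [steps foldl]; rewrite -/(steps _ _); split.
  + by move: x02; rewrite /= /upd !inE negb_or [2%N == x]eq_sym => /andP[_ /negbTE ->].
  + by move=> y yl; rewrite /= /upd; case: eqP => // _; rewrite W1 ?H1 ?yl.
  + by move=> y yl; rewrite /= R1 H2.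
  + move=> a i al; rewrite /= (_ : (_ + a == x)%N = false); last by lia.
    by rewrite W1 ?H3 //; lia.
  + by move=> a i al; rewrite /= R1 H4.
- move: cok => /= /andP[xl eok].
  have [E W1 R1] := zcode_ok eok (leqnn _) ms.
  have bc : all basic (code l (ZLet x e)) by rewrite all_cat basic_zcode.
  exists (size (code l (ZLet x e))), (steps (code l (ZLet x e)) s); split=> //.
  + by apply: reaches_steps; rewrite ?pl.
  + by rewrite pc_steps ?pl.
  case: ms R1 W1 => H0 H1 H2 H3 H4 R1 W1.
  rewrite /= steps_cat; cbn [steps foldl]; rewrite -/(steps _ _); split=> //.
  + by move=> y yl; rewrite /= W1 ?H1 ?yl.
  + by move=> y yl; rewrite /= /upd; case: eqP => // _; rewrite R1 ?H2 ?yl.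
  + by move=> a i al; rewrite /= W1 ?H3 //; lia.
  + move=> a i al; rewrite /= (_ : (_ + a == x)%N = false); last by lia.
    by rewrite R1 ?H4 //; lia.
- move: cok => /= /and3P[al iok eok].
  set cc := code l (WPut a i e).
  have bc : all basic cc by rewrite /cc /= !all_cat !basic_wcode basic_address.
  exists (size cc), (steps cc s); split=> //.
  + by apply: reaches_steps; rewrite ?pl.
  + by rewrite pc_steps ?pl.
  rewrite /cc /= !steps_cat.
  have [E1 R1 W1] := wcode_ok iok (leqnn _) ms.
  set s1 := steps (wcode 32 i) s in E1 R1 W1 *; clearbody s1.
  have s1B : word s1 2 = B by rewrite W1 // (rep_wv ms) // (rep_base ms).
  have [E2 R2 W2] := address_ok a s1B (isT : (2 < 32)%N).
  set s2 := steps (address 32 a) s1 in E2 R2 W2 *; clearbody s2.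
  have m2 : rep m s2.
    by apply: rep_same ms => x xl; rewrite ?R2 ?R1 // W2 ?W1 //; lia.
  have [E3 R3 W3] := wcode_ok eok (leqnSn _) m2.
  set s3 := steps (wcode 33 e) s2 in E3 R3 W3 *; clearbody s3.
  have m3 : rep m s3.
    by apply: rep_same m2 => x xl; rewrite ?R3 // W3 //; lia.
  have A : word s3 32 = (B + 8 * wev m i + a)%N by rewrite W3 // E2 E1.
  case: m3 => H0 H1 H2 H3 H4; cbn [steps foldl]; split=> //.
  + by move=> y yl; rewrite /= A (_ : (y == _) = false) ?H1 //; lia.
  + move=> b j bl; rewrite /= A E3 /upd.
    have [->|ab] := eqVneq b a; last first.
      by rewrite (_ : (_ == _) = false) ?H3 //; lia.
    have [->|ij] := eqVneq j (wev m i); first by rewrite eqxx.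
    by rewrite (_ : (_ == _) = false) ?H3 //; lia.
- move: cok => /= /and3P[al eok iok].
  set cc := code l (ZPut a i e).
  have bc : all basic cc by rewrite /cc /= !all_cat basic_zcode basic_wcode basic_address.
  exists (size cc), (steps cc s); split=> //.
  + by apply: reaches_steps; rewrite ?pl.
  + by rewrite pc_steps ?pl.
  rewrite /cc /= !steps_cat.
  have [E0 W0 R0] := zcode_ok eok (leqnn _) ms.
  set s0 := steps (zcode 32 e) s in E0 R0 W0 *; clearbody s0.
  have m0' : rep m s0 by apply: rep_same ms.
  have [E1 R1 W1] := wcode_ok iok (leqnn _) m0'.
  set s1 := steps (wcode 32 i) s0 in E1 R1 W1 *; clearbody s1.
  have s1B : word s1 2 = B by rewrite W1 ?(rep_wv m0') ?(rep_base ms) //; lia.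
  have [E2 R2 W2] := address_ok a s1B (isT : (2 < 32)%N).
  set s2 := steps (address 32 a) s1 in E2 R2 W2 *; clearbody s2.
  have m2 : rep m s2.
    by apply: rep_same m0' => x xl; rewrite ?R2 ?R1 // W2 ?W1 //; lia.
  have A : word s2 32 = (B + 8 * wev m i + a)%N by rewrite E2 E1.
  case: m2 => H0 H1 H2 H3 H4; cbn [steps foldl]; split=> //.
  + by move=> y yl; rewrite /= A (_ : (y == _) = false) ?H2 //; lia.
  + move=> b j bl; rewrite /= A R2 R1 E0 /upd.
    have [->|ab] := eqVneq b a; last first.
      by rewrite (_ : (_ == _) = false) -?R1 -?R2 ?H4 //; lia.
    have [->|ij] := eqVneq j (wev m i); first by rewrite eqxx.
    by rewrite (_ : (_ == _) = false) -?R1 -?R2 ?H4 //; lia.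
- move: cok => /= /andP[ok1 ok2].
  have [P1 P2] := code_at_cat Pc.
  have [t1 [s1 [T1 r1 p1 m1]]] := IH1 ok1 P l m s P1 pl ms m0.
  have x0 : wv (exec N c1 m) 0 = N.
    by rewrite exec_wv // (cmd_ok_wvars ok1).
  have [t2 [s2 [T2 r2 p2 m2]]] := IH2 ok2 P _ _ s1 P2 p1 m1 x0.
  exists (t1 + t2)%N, s2; split=> //; first by rewrite leq_add.
    exact: reaches_trans r1 r2.
  by rewrite p2 size_cat addnA.
- move: cok => /= /and3P[okt ok1 ok2].
  move: Pc; rewrite /=; set l0 := (l + _)%N; set k2 := code l0.+1 c2.
  set l1 := (l0.+2 + size k2)%N; set k1 := code l1 c1.
  have [mt bt Et ht st] := tcode_ok l1 okt ms; rewrite Et in mt bt st *.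
  move=> /code_at_cat[Pt /code_at_head[Pj /code_at_cat[P2 /code_at_head[Pe P1]]]].
  set s1 := steps _ s in mt st.
  have r1 : reaches P (size (tcode t 0).1) s s1 by apply: reaches_steps; rewrite ?pl.
  have p1 : pc s1 = l0 by rewrite pc_steps // pl.
  have r2 : reaches P (size (tcode t 0).1 + 1) s (branch s1 (tev m t) l1).
    by apply: reaches_trans r1 _; rewrite -st; apply: reaches1 => //; rewrite p1.
  have mb : rep m (branch s1 (tev m t) l1) by apply: rep_same mt.
  have -> : (l + size ((tcode t 0).1 ++ (tcode t l1).2 :: k2 ++
      Jump (l1 + size k1) :: k1) = l1 + size k1)%N.
    by rewrite !size_cat /= !size_cat /= /l1 /l0; lia.
  case: ifP => tt.
  + rewrite tt in mb r2.
    have [t1 [s2 [T1 r3 p3 m3]]] := IH1 ok1 P l1 m (branch s1 true l1) P1 erefl mb m0.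
    exists (size (tcode t 0).1 + 1 + t1)%N, s2; split=> //; first by lia.
      exact: reaches_trans r2 r3.
  + rewrite tt in mb r2.
    have pb : pc (branch s1 false l1) = l0.+1 by rewrite /= p1.
    have [t1 [s2 [T1 r3 p3 m3]]] := IH2 ok2 P _ _ _ P2 pb mb m0.
    exists (size (tcode t 0).1 + 1 + t1 + 1)%N, (step (Jump (l1 + size k1)) s2).
    split; first by lia.
    * apply: reaches_trans (reaches_trans r2 r3) _.
      by apply: (reaches1 (i := Jump (l1 + size k1))); rewrite ?p3.
    * by [].
    * by apply: rep_same m3.
move: cok => /= /and4P[xl + cok xc]; rewrite !inE negb_or => /andP[x0 x2].
move: Pc => /= /code_at_head[P0 Pl].
(* The store after [k] rounds, before the final assignment to [x]. *)
pose mk k := foldl (fun m k => exec N c (wlet m x k)) m (iota 0 k).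
have mkS k : mk k.+1 = exec N c (wlet (mk k) x k).
  by rewrite /mk -addn1 iotaD foldl_cat /= add0n.
have mk0 k : wv (mk k) 0 = N.
  elim: k => // k IHk; rewrite mkS exec_wv ?cmd_ok_wvars //= /upd.
  by rewrite eq_sym (negbTE x0).
(* The value of [x] is taken from the machine, since the increment happens outside the body and has
   no counterpart in [mk]. *)
pose I k s := rep (wlet (mk k) x (word s x)) s.
have Iext k s1 s2 : (forall y, y != x -> y != 32 -> word s2 y = word s1 y) ->
    real s2 =1 real s1 -> I k s1 -> I k s2.
  move=> Hw Hr [H0 H1 H2 H3 H4]; split.
  - by move: H0; rewrite /= /upd eq_sym (negbTE x2).
  - move=> y yl; have := H1 y yl; rewrite /= /upd; case: (eqVneq y x) => [-> //|yx <-].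
    by rewrite Hw //; lia.
  - by move=> y yl; rewrite Hr H2.
  - by move=> a i al; rewrite Hw ?H3 //; lia.
  - by move=> a i al; rewrite Hr H4.
have body k s1 : (k < N)%N -> I k s1 -> word s1 x = k -> word s1 0 = N ->
    pc s1 = (l.+1 + 2)%N ->
    exists t s', [/\ (t <= time N c)%N, reaches P t s1 s', I k.+1 s' &
      [/\ pc s' = (l.+1 + 2 + size (code l.+3 c))%N, word s' x = k & word s' 0 = N]].
  move=> kN I1 s1x s10 p1; rewrite /I s1x in I1.
  have Pb : code_at P (l.+3) (code l.+3 c).
    move: Pl; rewrite /loop_code => /code_at_cat[_ /code_at_cat[+ _]].
    by rewrite /= addn2.
  rewrite addn2 in p1.
  have mk0' : wv (wlet (mk k) x k) 0 = N by rewrite /= /upd eq_sym (negbTE x0).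
  have [t [s2 [T2 r2 p2 m2]]] := IH cok P l.+3 _ _ Pb p1 I1 mk0'.
  have s2x : word s2 x = k.
    by rewrite (rep_wv m2) // exec_wv //= /upd eqxx.
  exists t, s2; split=> //; last first.
    rewrite addn2; split=> //; rewrite (rep_wv m2) // exec_wv ?cmd_ok_wvars //.
  case: m2 => H0 H1 H2 H3 H4; rewrite /I mkS; split=> //.
  - by rewrite /= /upd eq_sym (negbTE x2).
  - by move=> y yl; rewrite /= /upd; case: eqP => [-> //|_]; exact: H1.
pose s1 := step (WConst x 0) s.
have I1 : I 0%N s1.
  case: ms => H0 H1 H2 H3 H4; split=> //.
  - by rewrite /= /upd eq_sym (negbTE x2).
  - by move=> y yl; rewrite /= /upd eqxx; case: eqP => // _; exact: H1.
  - move=> a i al; rewrite /= (_ : (_ + a == x)%N = false) ?H3 //; lia.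
have s1x : word s1 x = 0%N by rewrite /= eqxx.
have s10 : word s1 0 = N by rewrite /= eq_sym (negbTE x0) (rep_wv ms).
have xne : x != 32 by lia.
have p1 : pc s1 = l.+1 by rewrite /= pl.
have [t [s2 [T2 r2 I2 [p2 s2x s20]]]] :=
  loop_reaches Pl xne isT x0 Iext body I1 p1 s1x s10.
exists (1 + t)%N, s2; split.
- by move: T2; rewrite subn0; lia.
- by apply: reaches_trans r2; apply: (reaches1 (i := WConst x 0)); rewrite ?pl.
- by rewrite p2 /= !size_cat /=; lia.
- by rewrite max0n in I2 s2x; rewrite /I s2x in I2.
Qed.

End Compiler.

(** * Greedy placement *)

Section Placing.
Variables (R : realType) (n d D : nat) (M : 'M[option R]_n).
Variable col : 'I_n -> nat.
Hypothesis colM : forall u v, col u = col v -> isSome (M u v).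

Definition bin_of (bin : 'I_n -> nat) (v : 'I_n) (i : nat) : pred 'I_n :=
  [pred k | (bin k == i.+1) && (col k == col v)].

(* State of the greedy placement after the bins below [i] were tried for [v].
   [bin k = 0] means that [k] is in no bin; otherwise [mu k] is the residual of
   [k] modulo the earlier members of its bin, and [be k] a functional that is 1 on
   this residual and vanishes on the later ones. *)
Record placing (v i : nat) (bin : 'I_n -> nat) (mu be : 'I_n -> 'I_n -> R) : Prop :=
  Placing {
  placing_lt : forall k, bin k != 0%N -> (k <= v)%N;
  placing_le : forall k, (bin k <= D.+1)%N;
  placing_supp : forall k j, bin k != 0%N -> mu k j != 0 ->
    bin j = bin k /\ col j = col k;
  placing_dep : forall u i', bin u = 0%N -> (i' <= D)%N ->
    (u < v)%N \/ (u : nat) = v /\ (i' < i)%N ->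
    exists w, dependence M u (bin_of bin u i') w;
  placing_tri : EDMC M d -> forall k l, bin k != 0%N -> bin l = bin k ->
    col l = col k -> (k <= l)%N -> \sum_j be k j * mu l j = (k == l)%:R;
  placing_fun : forall p : 'I_n -> 'rV[R]_d, realizes M p ->
    forall k, bin k != 0%N ->
    exists f : 'cV[R]_(1 + d), forall j, col j = col k -> be k j = (homog p j *m f) 0 0 }.

Lemma placing_skip (v i : nat) bin mu be : placing v i bin mu be ->
  (forall u : 'I_n, (u : nat) = v -> bin u = 0%N -> (i <= D)%N ->
     exists w, dependence M u (bin_of bin u i) w) ->
  placing v i.+1 bin mu be.
Proof.
move=> [H1 H2 H3 H4 H5 H6] Hi; split=> // u i' bu iD.
case=> [uv|[uv]]; first by apply: H4 => //; left.
rewrite ltnS leq_eqVlt => /orP[/eqP Ei|ii]; first by rewrite Ei in iD *; apply: Hi.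
by apply: H4 => //; right.
Qed.

Variables (v : 'I_n) (i : nat) (bin : 'I_n -> nat) (mu be : 'I_n -> 'I_n -> R).
Variable w : 'I_n -> R.
Hypothesis iD : (i <= D)%N.
Hypothesis pl : placing v i bin mu be.
Hypothesis bv : bin v = 0%N.
Hypothesis wv : w v = 1.
Hypothesis wB : forall j, j != v -> w j != 0 -> bin_of bin v i j.
Hypothesis wbe : EDMC M d -> forall k, bin_of bin v i k -> \sum_j be k j * w j = 0.

Lemma placing_dependent : \sum_j w j = 0 ->
  (forall u, isSome (M u v) -> (forall k, bin_of bin v i k -> isSome (M u k)) ->
     \sum_j val0 M u j * w j = \sum_j val0 M v j * w j) ->
  placing v i.+1 bin mu be.
Proof.
move=> w0 wy; apply: (placing_skip pl) => u uv _ _.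
have -> : u = v by exact: val_inj.
by exists w; split.
Qed.

Variable y : 'I_n -> R.
Hypothesis insertable :
  (\sum_j w j != 0 /\ forall u, y u = 1) \/
  [/\ \sum_j w j = 0, forall u, y u = \sum_j val0 M u j * w j &
      exists2 u, isSome (M u v) /\ (forall k, bin_of bin v i k -> isSome (M u k)) &
      y u != y v].

(** The pivot: dividing [y] by it gives a functional with value 1 on the residual [w]. In the first
    alternative it is the total weight, in the second [w^T M w], which [pivot_neq0] handles. *)
Let q := \sum_j w j * y j.

Definition ins (T : Type) (f : 'I_n -> T) (x : T) (k : 'I_n) : T :=
  if k == v then x else f k.

Let w_col j : w j != 0 -> col j = col v.
Proof.
by have [-> //|jv wj] := eqVneq j v; have /andP[_ /eqP] := wB jv wj.
Qed.

Let q_neq0 (p : 'I_n -> 'rV[R]_d) : realizes M p -> q != 0.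
Proof.
move=> rp; case: insertable => [[s0 y1]|[s0 yE [u [uv uB] yu]]].
  by rewrite /q; under eq_bigr do rewrite y1 mulr1.
rewrite /q; under eq_bigr do rewrite yE.
rewrite !yE in yu; apply: (pivot_neq0 rp s0 _ _ _ yu) => [i1 i2 w1 w2|j wj|j wj].
- by apply: colM; rewrite !w_col.
- have [-> //|jv] := eqVneq j v; exact: uB (wB jv wj).
- by apply: colM; rewrite !w_col.
Qed.

Lemma placing_insert :
  placing v i.+1 (ins bin i.+1) (ins mu w) (ins be (fun j => y j / q)).
Proof.
case: pl => H1 H2 H3 H4 H5 H6.
have wB' j : w j != 0 -> ins bin i.+1 j = i.+1 /\ col j = col v.
  move=> wj; rewrite /ins; have [->//|jv] := eqVneq j v.
  by have /andP[/eqP ? /eqP ?] := wB jv wj.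
split.
- by move=> k; rewrite /ins; have [->|_] := eqVneq k v; last exact: H1.
- by move=> k; rewrite /ins; have [_|_] := eqVneq k v; last exact: H2.
- move=> k j; rewrite /ins [k == v]eq_sym; have [<-|kv] := eqVneq v k.
    by move=> _ /wB'[]; rewrite /ins.
  move=> bk /(H3 _ _ bk)[bj cj]; split=> //; have [jv|//] := eqVneq j v.
  by move: bk; rewrite -bj jv bv.
(* Recorded dependences survive because bins only grow: a larger bin allows a larger support and
   leaves fewer rows to be tested. *)
- move=> u i' bu i'D uvi.
  have uv : u != v by apply/eqP => uv; move: bu; rewrite uv /ins eqxx.
  have [|//|w' [w1 w2 w3 w4]] := H4 u i' _ i'D.
  + by move: bu; rewrite /ins (negbTE uv).
  + case: uvi => [?|[/val_inj uv' _]]; first by left.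
    by rewrite uv' eqxx in uv.
  have sub k : bin_of bin u i' k -> bin_of (ins bin i.+1) u i' k.
    move=> /andP[/eqP bk /eqP ck]; rewrite /bin_of /= ck eqxx andbT /ins.
    by have [kv|_] := eqVneq k v; rewrite ?bk //; move: bk; rewrite kv bv.
  exists w'; split=> // [j ju wj|u' u'u u'B]; first by apply: sub; exact: w2.
  by apply: w4 => // k /sub; exact: u'B.
- move=> eM; have [p rp] := (EDMC_realizes d M).1 eM.
  have qn0 := q_neq0 rp.
  (* For [k = l = v] the division by [q] gives 1. The case [k = v] with another [l] cannot occur, as
     no placed index exceeds [v]. For [l = v] alone, the old functionals vanish on [w] by [wbe]. *)
  move=> k l; rewrite /ins; have [->|kv] := eqVneq k v.
    move=> _; have [->|lv] := eqVneq l v.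
      move=> _ _ _; rewrite -[RHS](mulVf qn0) /q mulr_sumr.
      by apply: eq_bigr => j _; ring.
    move=> bl _ vl; have := H1 l; rewrite bl => /(_ isT) lv'.
    by case/negP: lv; apply/eqP/val_inj/eqP; rewrite eqn_leq lv' vl.
  move=> bk; have [->|lv] := eqVneq l v; last exact: H5.
  move=> Ei cl kl; rewrite (negbTE kv) /=; apply: (wbe eM).
  by rewrite /bin_of /= -Ei cl !eqxx.
(* The row functional is valid on rows that see the support of [w]; this support lies in the colour
   class of [v], whose entries are all specified. *)
- move=> p rp k; rewrite /ins; have [->|kv] := eqVneq k v; last exact: H6.
  move=> _; case: insertable => [[s0 y1]|[s0 yE _]].
    exists (col_mx (q^-1)%:M 0) => j _.
    by rewrite y1 mul1r mul_row_col mul1mx mulmx0 addr0 !mxE eqxx mulr1n.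
  have [f Hf] := row_functional rp s0.
  exists (q^-1 *: f) => j cj; rewrite yE Hf; last first.
    by move=> j' wj'; apply: colM; rewrite cj (w_col wj').
  by rewrite -scalemxAr [RHS]mxE mulrC.
Qed.

End Placing.

Lemma placing_full (R : realType) (n d D : nat) (M : 'M[option R]_n)
    (col bin : 'I_n -> nat) (mu be : 'I_n -> 'I_n -> R) :
  (forall v, (col v <= D)%N) -> placing d D M col n 0 bin mu be -> EDMC M d ->
  (#|[set k | bin k != 0%N]| <= (d + 1) * (D + 1) ^ 2)%N.
Proof.
move=> colD pl eM; have [p rp] := (EDMC_realizes d M).1 eM.
case: pl => H1 H2 H3 _ H5 H6.
(* One set for each pair of a colour and a bin; the successor skips the value 0 of dropped
   indices. *)
pose A (ci : 'I_D.+1 * 'I_D.+1) :=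
  [set k | (bin k == (val ci.2).+1) && (col k == ci.1)].
have cA ci : (#|A ci| <= 1 + d)%N.
  apply: (@unitriangular_card R n (1 + d) (mem (A ci))
    [pred j | col j == ci.1] mu be (homog p)).
  - move=> k; rewrite inE => /andP[/eqP bk /eqP ck].
    have [|f Hf] := H6 p rp k; first by rewrite bk.
    by exists f => j; rewrite inE => /eqP cj; apply: Hf; rewrite cj ck.
  - move=> l j; rewrite !inE => /andP[/eqP bl /eqP cl] /H3.
    by rewrite bl => /(_ isT)[_ ->]; rewrite cl.
  - move=> k l; rewrite !inE => /andP[/eqP bk /eqP ck] /andP[/eqP bl /eqP cl] kl.
    by apply: H5 => //; rewrite ?bk ?bl ?ck ?cl.
have sub : [set k | bin k != 0%N] \subset \bigcup_ci A ci.
  apply/subsetP => k; rewrite inE => bk; apply/bigcupP.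
  have bk1 : ((bin k).-1 < D.+1)%N by rewrite prednK ?lt0n.
  have ck1 : (col k < D.+1)%N by rewrite ltnS.
  by exists (Ordinal ck1, Ordinal bk1) => //; rewrite inE /= prednK ?lt0n ?eqxx.
apply: leq_trans (subset_leq_card sub) _.
have : (#|\bigcup_ci A ci| <= \sum_ci #|A ci|)%N.
  elim/big_rec2: _ => [|ci a B _ IH]; first by rewrite cards0.
  by apply: leq_trans (leq_card_setU _ _) _; rewrite leq_add2l.
move=> /leq_trans; apply.
apply: (@leq_trans (\sum_(ci : 'I_D.+1 * 'I_D.+1) (1 + d))).
  exact: leq_sum.
by rewrite sum_nat_const card_prod !card_ord !addn1 add1n mulnC.
Qed.

Lemma placing_sound (R : realType) (n d D : nat) (M : 'M[option R]_n)
    (col bin : 'I_n -> nat) (mu be : 'I_n -> 'I_n -> R) m (f : 'I_m -> 'I_n) :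
  partial_matrix M -> unspecified_le M D ->
  (forall u v, col u = col v -> isSome (M u v)) ->
  placing d D M col n 0 bin mu be ->
  (forall k, bin k != 0%N -> exists a, f a = k) ->
  EDMC (mxsub f f M) d <-> EDMC M d.
Proof.
move=> pM uM colM pl surjf; split=> /EDMC_realizes[p rp]; apply/EDMC_realizes; last first.
  by exists (p \o f) => i j x; rewrite mxE => /rp.
(* With [m = 0] there is no default for [g], but then no index is placed and any [p] serves. *)
case: m f surjf p rp => [|m] f surjf p rp.
  apply: (realizes_extend (p := fun=> 0) (bin := bin) pM uM colM).
    by move=> v i bv iD; apply: (placing_dep pl) => //; left.
  by move=> u v x /surjf[[]].
pose g k := if [pick a | f a == k] is Some a then a else ord0.
have fg k : bin k != 0%N -> f (g k) = k.
  move=> /surjf[a fa]; rewrite /g; case: pickP => [b /eqP //|/(_ a)].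
  by rewrite fa eqxx.
apply: (realizes_extend (p := p \o g) (bin := bin) pM uM colM).
  by move=> v i bv iD; apply: (placing_dep pl) => //; left.
by move=> u v x bu bv Mx; apply: rp; rewrite mxE !fg.
Qed.

(** * Proof rules for loops, sums and array updates *)

Section Loops.
Variables (R : realType) (N : nat).
Implicit Types (m : store R) (c : cmd).

Record frame c m m' : Prop := Frame {
  fr_wv : forall x, x \notin wvars c -> wv m' x = wv m x;
  fr_zv : forall x, x \notin zvars c -> zv m' x = zv m x;
  fr_wa : forall a, a \notin warrs c -> wa m' a = wa m a;
  fr_za : forall a, a \notin zarrs c -> za m' a = za m a }.

Lemma exec_frame c m : frame c m (exec N c m).
Proof. by split=> x H; [exact: exec_wv|exact: exec_zv|exact: exec_wa|exact: exec_za]. Qed.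

Lemma frame_trans c m1 m2 m3 : frame c m1 m2 -> frame c m2 m3 -> frame c m1 m3.
Proof.
by case=> A1 A2 A3 A4 [B1 B2 B3 B4]; split=> x H; rewrite ?B1 ?B2 ?B3 ?B4 ?A1 ?A2 ?A3 ?A4.
Qed.

(** The frame of the whole loop is carried along with [I], so an invariant has to mention only what
    the body changes. *)
Lemma for_ind (I : nat -> store R -> Prop) x c m :
  (forall k m', (k < N)%N -> frame (For x c) m m' -> I k m' ->
     I k.+1 (exec N c (wlet m' x k))) ->
  I 0%N m ->
  exists m', [/\ I N m', frame (For x c) m m' & exec N (For x c) m = wlet m' x N].
Proof.
move=> H I0.
have [||m' [IN Fm'] E] := @exec_for R N (fun k m' => I k m' /\ frame (For x c) m m') x c m.
- move=> k m' kN [Ik Fm']; split; first exact: H.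
  apply: frame_trans Fm' _; split=> y Hy /=.
  + rewrite exec_wv; last by move: Hy; rewrite inE negb_or => /andP[].
    by move: Hy; rewrite /= inE negb_or /upd => /andP[/negbTE ->].
  + by rewrite exec_zv.
  + by rewrite exec_wa.
  + by rewrite exec_za.
- by [].
by exists m'.
Qed.

Definition sum (x j : nat) (e : zexp) : cmd :=
  Seq (ZLet x (ZNat (WNum 0))) (For j (ZLet x (ZBin Add (ZVar x) e))).

Lemma exec_sum x j e (f : nat -> R) m :
  (forall k m', (k < N)%N -> wv m' =1 upd (wv m) j k -> wa m' = wa m -> za m' = za m ->
     (forall y, y != x -> zv m' y = zv m y) -> zev m' e = f k) ->
  zv (exec N (sum x j e) m) x = \sum_(k < N) f k.
Proof.
move=> H.
have [||m' [I' _ E]] := @for_ind (fun k m' => [/\ zv m' x = \sum_(i < k) f i,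
  (forall y, y != j -> wv m' y = wv m y), (forall y, y != x -> zv m' y = zv m y),
  wa m' = wa m & za m' = za m]) j (ZLet x (ZBin Add (ZVar x) e)) (zlet m x 0%:R).
- move=> k m' kN _ [Ex Ew Ez Ewa Eza]; split=> //=.
  + rewrite /upd eqxx big_ord_recr /= Ex (H k) // => y /=.
    by rewrite /upd; case: eqVneq => // /Ew.
  + by move=> y yj; rewrite /upd (negbTE yj) Ew.
  + by move=> y yx; rewrite /upd (negbTE yx) Ez.
- split=> //=; first by rewrite /upd eqxx big_ord0.
  by move=> y yx; rewrite /upd (negbTE yx).
have -> : exec N (sum x j e) m =
  exec N (For j (ZLet x (ZBin Add (ZVar x) e))) (zlet m x 0%:R) by [].
by rewrite E; case: I'.
Qed.

(** Injectivity of [g] keeps the cell written in round [k] at its initial value until then, so [e]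
    may read it. This permits updating an array in place. *)
Lemma exec_map a j idx e (g : nat -> nat) (f : nat -> R) m :
  (forall k l, (k < N)%N -> (l < N)%N -> g k = g l -> k = l) ->
  (forall k m', (k < N)%N -> wv m' =1 upd (wv m) j k -> zv m' = zv m -> wa m' = wa m ->
     (forall b, b != a -> za m' b = za m b) -> za m' a (g k) = za m a (g k) ->
     wev m' idx = g k /\ zev m' e = f k) ->
  let m2 := exec N (For j (ZPut a idx e)) m in
  (forall k, (k < N)%N -> za m2 a (g k) = f k) /\
  (forall i, (forall k, (k < N)%N -> i != g k) -> za m2 a i = za m a i).
Proof.
move=> gI H.
have [||m' [[I1 I2 _ _] _ E]] := @for_ind (fun k m' => [/\
    forall l, (l < k)%N -> za m' a (g l) = f l,
    forall i, (forall l, (l < k)%N -> i != g l) -> za m' a i = za m a i,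
    forall y, y != j -> wv m' y = wv m y &
    [/\ zv m' = zv m, wa m' = wa m & forall b, b != a -> za m' b = za m b]])
  j (ZPut a idx e) m.
- move=> k m' kN _ [J1 J2 J3 [J4 J5 J6]].
  have [||||||Ei Ee] := H k (wlet m' j k) => //.
  + by move=> y /=; rewrite /upd; case: eqVneq => // /J3.
  + apply: J2 => l lk; apply/eqP => /(gI _ _ kN (ltn_trans lk kN)) kl.
    by rewrite kl ltnn in lk.
  split=> /=; rewrite ?Ei ?Ee.
  + move=> l; rewrite ltnS leq_eqVlt => /orP[/eqP ->|lk]; first by rewrite /upd !eqxx.
    rewrite /upd eqxx; case: eqVneq => [|_]; last exact: J1.
    by move=> /(gI _ _ (ltn_trans lk kN) kN) kl; rewrite kl ltnn in lk.
  + move=> i Hi; rewrite /upd eqxx (negbTE (Hi k _)) //; apply: J2 => l lk; apply: Hi.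
    exact: ltnW.
  + by move=> y yj; rewrite /upd (negbTE yj) J3.
  + by split=> // b ba; rewrite /upd (negbTE ba) J6.
- by split.
by rewrite E.
Qed.

End Loops.

(** * The kernelization program *)

Local Notation vN := 0%N.
Local Notation vDIM := 1%N.
Local Notation vV := 3%N.
Local Notation vI := 4%N.
Local Notation vJ := 5%N.
Local Notation vK := 6%N.
Local Notation vU := 7%N.
Local Notation vCNT := 8%N.
Local Notation vDEG := 9%N.
Local Notation vOK := 10%N.
Local Notation vINS := 11%N.
Local Notation vOUT := 12%N.
Local Notation vREJ := 13%N.
Local Notation vT := 14%N.
Local Notation vKEPT := 15%N.

Local Notation aFLAG := 0%N.
Local Notation aROW := 1%N.
Local Notation aCOL := 2%N.
Local Notation aBIN := 3%N.
Local Notation aOFLAG := 4%N.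

Local Notation zX := 0%N.
Local Notation zQ := 1%N.
Local Notation zS := 2%N.

Local Notation aVAL := 0%N.
Local Notation aW := 1%N.
Local Notation aY := 2%N.
Local Notation aMU := 3%N.
Local Notation aBE := 4%N.
Local Notation aOVAL := 5%N.

Local Notation "c1 ;; c2" := (Seq c1 c2) (at level 60, right associativity).

Definition cell (x y : nat) : wexp := WPlus (WArr aROW (WVar x)) (WVar y).

(** Words have no multiplication, so the row offsets are tabulated by repeated addition. *)
Definition rows : cmd :=
  WLet vT (WNum 0) ;;
  For vI (WPut aROW (WVar vI) (WVar vT) ;; WLet vT (WPlus (WVar vT) (WVar vN))).

(** The largest number of gaps in a row is the least admissible [Delta], so a kernel bound in terms
    of it implies the one for every [Delta]. *)
Definition degree : cmd :=
  WLet vDEG (WNum 0) ;;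
  For vI (
    WLet vCNT (WNum 0) ;;
    For vJ (If (TEq (WArr aFLAG (cell vI vJ)) (WNum 0))
               (WLet vCNT (WPlus (WVar vCNT) (WNum 1))) Skip) ;;
    If (TLt (WVar vDEG) (WVar vCNT)) (WLet vDEG (WVar vCNT)) Skip).

Definition conflict : cmd :=
  WLet vOK (WNum 1) ;;
  For vU (If (TLt (WVar vU) (WVar vV))
    (If (TEq (WArr aCOL (WVar vU)) (WVar vI))
      (If (TEq (WArr aFLAG (cell vU vV)) (WNum 0)) (WLet vOK (WNum 0)) Skip) Skip) Skip).

(** Loops cannot be left early, so the last free colour up to [vDEG] is taken rather than the first;
    only the range of colours matters. *)
Definition colour : cmd :=
  For vV (For vI (If (TLt (WVar vDEG) (WVar vI)) Skip
    (conflict ;; If (TEq (WVar vOK) (WNum 0)) Skip (WPut aCOL (WVar vV) (WVar vI))))).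

Definition unit_row : cmd :=
  For vJ (ZPut aW (WVar vJ) (ZNat (WNum 0))) ;;
  ZPut aW (WVar vV) (ZNat (WNum 1)).

Definition in_bin (c : cmd) : cmd :=
  If (TEq (WArr aBIN (WVar vK)) (WPlus (WVar vI) (WNum 1)))
    (If (TEq (WArr aCOL (WVar vK)) (WArr aCOL (WVar vV))) c Skip) Skip.

(** One elimination step, removing from [w] the multiple of the residual of [k] that is measured by
    the functional of [k]. For a realizable matrix this functional vanishes on later residuals, so
    running through the bin in increasing order never undoes an earlier step. *)
Definition project1 : cmd :=
  sum zX vJ (ZBin Mul (ZArr aW (WVar vJ)) (ZArr aBE (cell vK vJ))) ;;
  For vJ (ZPut aW (WVar vJ)
    (ZBin Defs.Sub (ZArr aW (WVar vJ)) (ZBin Mul (ZVar zX) (ZArr aMU (cell vK vJ))))).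

Definition project : cmd := For vK (in_bin project1).

(** Gaps enter as 0, so the result is meaningful only in rows specified on the support of [w].
    [compare] skips rows with a gap at [v] or on the bin, and functionals are paired only with
    residuals supported in their own colour class. *)
Definition image_row : cmd :=
  For vU (
    sum zX vJ (ZBin Mul (ZArr aVAL (cell vU vJ)) (ZArr aW (WVar vJ))) ;;
    ZPut aY (WVar vU) (ZVar zX)).

Definition comparable : cmd :=
  WLet vOK (WArr aFLAG (cell vU vV)) ;;
  For vK (in_bin (If (TEq (WArr aFLAG (cell vU vK)) (WNum 0)) (WLet vOK (WNum 0)) Skip)).

Definition compare : cmd :=
  WLet vINS (WNum 0) ;;
  For vU (
    comparable ;;
    If (TEq (WVar vOK) (WNum 0)) Skip
      (If (TZero (ZBin Defs.Sub (ZArr aY (WVar vU)) (ZArr aY (WVar vV)))) Skip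
          (WLet vINS (WNum 1)))).

(* For a realizable matrix the residual [w] has a nonzero sum exactly as long as
   its bin is empty; then [y = 1] yields the constant functional. *)
Definition decide_bin : cmd :=
  sum zS vJ (ZArr aW (WVar vJ)) ;;
  If (TZero (ZVar zS)) compare
    (WLet vINS (WNum 1) ;; For vU (ZPut aY (WVar vU) (ZNat (WNum 1)))).

Definition insert : cmd :=
  sum zQ vJ (ZBin Mul (ZArr aW (WVar vJ)) (ZArr aY (WVar vJ))) ;;
  For vJ (ZPut aMU (cell vV vJ) (ZArr aW (WVar vJ))) ;;
  For vJ (ZPut aBE (cell vV vJ) (ZBin Div (ZArr aY (WVar vJ)) (ZVar zQ))) ;;
  WPut aBIN (WVar vV) (WPlus (WVar vI) (WNum 1)).

Definition try_bin : cmd :=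
  If (TLt (WVar vDEG) (WVar vI)) Skip
    (If (TEq (WArr aBIN (WVar vV)) (WNum 0))
       (unit_row ;; project ;; image_row ;; decide_bin ;;
        If (TEq (WVar vINS) (WNum 0)) Skip insert)
       Skip).

Definition distribute : cmd :=
  For vV (WPut aBIN (WVar vV) (WNum 0)) ;; For vV (For vI try_bin).

(** The threshold is accumulated by adding [d + 1], again for want of multiplication. The loops only
    run up to [n], but [vDEG] is smaller than a positive [n] because the diagonal is specified. *)
Definition count_kept : cmd :=
  WLet vT (WNum 0) ;;
  For vI (If (TLt (WVar vDEG) (WVar vI)) Skip
    (For vJ (If (TLt (WVar vDEG) (WVar vJ)) Skip
      (WLet vT (WPlus (WVar vT) (WPlus (WVar vDIM) (WNum 1))))))) ;;
  WLet vKEPT (WNum 0) ;;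
  For vV (If (TEq (WArr aBIN (WVar vV)) (WNum 0)) Skip
    (WLet vKEPT (WPlus (WVar vKEPT) (WNum 1)))) ;;
  WLet vREJ (WNum 0) ;;
  If (TLt (WVar vT) (WVar vKEPT)) (WLet vREJ (WNum 1)) Skip.

Definition emit : cmd :=
  WLet vOUT (WNum 0) ;;
  For vI (If (TEq (WArr aBIN (WVar vI)) (WNum 0)) Skip
    (For vJ (If (TEq (WArr aBIN (WVar vJ)) (WNum 0)) Skip
      (WPut aOFLAG (WVar vOUT) (WArr aFLAG (cell vI vJ)) ;;
       ZPut aOVAL (WVar vOUT) (ZArr aVAL (cell vI vJ)) ;;
       WLet vOUT (WPlus (WVar vOUT) (WNum 1)))))).

Definition kernelize : cmd :=
  rows ;; degree ;; colour ;; distribute ;; count_kept ;; emit.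

Lemma kernelize_ok : cmd_ok kernelize.
Proof. by []. Qed.

(** * Semantics of the elimination blocks *)

Section Blocks.
Variables (R : realType) (n d : nat) (M : 'M[option R]_n).
Implicit Types (m : store R) (u v k j : 'I_n).

(** What the blocks after [rows] rely on and none of them writes; [ready_frame] confirms the latter
    by computing their write sets. *)
Record ready m : Prop := Ready {
  ready_n : wv m vN = n;
  ready_dim : wv m vDIM = d;
  ready_flag : forall i j : 'I_n, wa m aFLAG (i * n + j) = isSome (M i j);
  ready_val : forall i j : 'I_n, za m aVAL (i * n + j) = val0 M i j;
  ready_row : forall i, (i < n)%N -> wa m aROW i = (i * n)%N }.

Lemma ready_frame c m m' : frame c m m' ->
  (vN \notin wvars c) && (vDIM \notin wvars c) && (aFLAG \notin warrs c) &&
  (aROW \notin warrs c) && (aVAL \notin zarrs c) -> ready m -> ready m'.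
Proof.
case=> F1 F2 F3 F4 /andP[/andP[/andP[/andP[n1 n2] n3] n4] n5] [H1 H2 H3 H4 H5].
by split; rewrite ?F1 ?F3 ?F4.
Qed.

Lemma ready_wlet m x z : x \notin [:: vN; vDIM] -> ready m -> ready (wlet m x z).
Proof.
rewrite !inE negb_or => /andP[/negbTE x0 /negbTE x1] [H1 H2 H3 H4 H5].
by split=> //=; rewrite /upd eq_sym ?x0 ?x1.
Qed.

Definition binf m k : nat := wa m aBIN k.
Definition colf m k : nat := wa m aCOL k.
Definition muf m k j : R := za m aMU (k * n + j).
Definition bef m k j : R := za m aBE (k * n + j).
Definition rowf m j : R := za m aW j.

Lemma exec_seq c1 c2 m : exec n (c1 ;; c2) m = exec n c2 (exec n c1 m).
Proof. by []. Qed.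

Lemma exec_if t c1 c2 m :
  exec n (If t c1 c2) m = if tev m t then exec n c1 m else exec n c2 m.
Proof. by []. Qed.

Lemma unit_row_ok m v : wv m vV = v ->
  forall j, rowf (exec n unit_row m) j = (j == v)%:R.
Proof.
move=> mv j.
have [] := @exec_map R n aW vJ (WVar vJ) (ZNat (WNum 0)) id (fun=> 0) m.
- by [].
- by move=> k m' kn E _ _ _ _ /=; rewrite E /upd eqxx.
set m1 := exec _ _ _ => Z _.
have E : wv m1 vV = v by rewrite exec_wv.
have -> : exec n unit_row m = zput m1 aW (wv m1 vV) 1%:R by [].
clearbody m1; rewrite /rowf /= /upd eqxx E; case: (eqVneq j v) => [->|jv]; first by rewrite eqxx.
by rewrite (_ : (_ == _) = false) ?Z //; apply: negbTE.
Qed.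

Lemma exec_in_bin c m k v i : wv m vK = k -> wv m vI = i -> wv m vV = v ->
  exec n (in_bin c) m =
  if bin_of (colf m) (binf m) v i k then exec n c m else m.
Proof.
by move=> mk mi mv; rewrite /= mk mi mv addn1 /bin_of /binf /colf /=; case: (_ == _).
Qed.

Lemma project1_ok m k j : ready m -> wv m vK = k ->
  rowf (exec n project1 m) j = rowf m j - (\sum_l rowf m l * bef m k l) * muf m k j.
Proof.
move=> mr mk; rewrite /project1 exec_seq.
set e := ZBin Mul (ZArr aW _) _; have F1 := exec_frame n (sum zX vJ e) m.
have X : zv (exec n (sum zX vJ e) m) zX = \sum_(l < n) rowf m l * bef m k l.
  apply: (exec_sum (f := fun l => za m aW l * za m aBE (k * n + l))) => l m' ln Ew Ea Ez _.
  by rewrite /= !Ew Ez Ea /upd /= mk (ready_row mr (ltn_ord _)).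
have m1r := ready_frame F1 isT mr.
move: (exec n (sum zX vJ e) m) F1 X m1r => m1 F1 X m1r.
have m1k : wv m1 vK = k by rewrite (fr_wv F1).
have [] := @exec_map R n aW vJ (WVar vJ) (ZBin Defs.Sub (ZArr aW (WVar vJ))
    (ZBin Mul (ZVar zX) (ZArr aMU (cell vK vJ)))) id
    (fun l => za m1 aW l - zv m1 zX * za m1 aMU (k * n + l)) m1.
- by [].
- move=> l m' ln Ew Ez Ea Eza EW; rewrite /= !Ew /upd /=; split=> //.
  by rewrite Ez EW Eza // Ea m1k (ready_row m1r (ltn_ord _)).
by move=> H _; rewrite /rowf H // X /muf !(fr_za F1).
Qed.

Lemma project_ok m v i :
  ready m -> wv m vV = v -> wv m vI = i -> binf m v = 0%N ->
  (forall j, rowf m j = (j == v)%:R) ->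
  (forall k j, binf m k != 0%N -> muf m k j != 0 ->
     binf m j = binf m k /\ colf m j = colf m k) ->
  let m' := exec n project m in
  [/\ rowf m' v = 1,
      forall j, j != v -> rowf m' j != 0 -> bin_of (colf m) (binf m) v i j &
      (forall k l, binf m k != 0%N -> binf m l = binf m k ->
         colf m l = colf m k -> (k <= l)%N ->
         \sum_j bef m k j * muf m l j = (k == l)%:R) ->
      forall k, bin_of (colf m) (binf m) v i k -> \sum_j bef m k j * rowf m' j = 0].
Proof.
move=> mr mv mi bv row0 supp m'.
pose tri := forall k l, binf m k != 0%N -> binf m l = binf m k ->
         colf m l = colf m k -> (k <= l)%N ->
         \sum_j bef m k j * muf m l j = (k == l)%:R.
have binK k : bin_of (colf m) (binf m) v i k -> binf m k = i.+1 /\ colf m k = colf m v.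
  by move=> /andP[/eqP ? /eqP ?].
have [||m1 [[I1 I2 I3] _ E]] := @for_ind R n (fun l m1 => [/\ rowf m1 v = 1,
    forall j, j != v -> rowf m1 j != 0 -> bin_of (colf m) (binf m) v i j &
    tri -> forall k, (k < l)%N -> bin_of (colf m) (binf m) v i k ->
      \sum_j bef m k j * rowf m1 j = 0]) vK (in_bin project1) m.
- move=> l m1 ln F [J1 J2 J3]; pose k := Ordinal ln.
  have m1r : ready (wlet m1 vK l) by apply: ready_wlet => //; exact: ready_frame F isT mr.
  have Eb : binf (wlet m1 vK l) = binf m by rewrite /binf /= (fr_wa F).
  have Ec : colf (wlet m1 vK l) = colf m by rewrite /colf /= (fr_wa F).
  rewrite (exec_in_bin _ (k := k) (v := v) (i := i)) ?Eb ?Ec; last 3 first.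
  + by [].
  + by rewrite /= /upd /= (fr_wv F).
  + by rewrite /= /upd /= (fr_wv F).
  case: ifP => Bk; last first.
    split=> // t k'; rewrite ltnS leq_eqVlt => /orP[/eqP kl|]; last exact: J3.
    by rewrite (_ : k' = k) ?Bk //; exact: val_inj.
  have [bk ck] := binK _ Bk.
  have Emu k' j : muf (wlet m1 vK l) k' j = muf m k' j by rewrite /muf /= (fr_za F).
  have Ebe k' j : bef (wlet m1 vK l) k' j = bef m k' j by rewrite /bef /= (fr_za F).
  have muB j : muf m k j != 0 -> bin_of (colf m) (binf m) v i j.
    move=> mj; have [|bj cj] := supp k j _ mj; first by rewrite bk.
    by rewrite /bin_of /= bj bk cj ck !eqxx.
  have P j := project1_ok j m1r (erefl : wv (wlet m1 vK l) vK = k).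
  set m2 := exec n project1 _ in P *.
  set s := \sum_(b < n) rowf (wlet m1 vK l) b * bef (wlet m1 vK l) k b in P.
  clearbody m2.
  have {}P j : rowf m2 j = rowf m1 j - s * muf m k j by rewrite P Emu.
  split.
  (* The residual of [k] is supported in its bin, and [v] is in no bin, so the coefficient 1 at [v]
     is never touched. *)
  + rewrite P J1 (_ : muf m k v = 0) ?mulr0 ?subr0 //.
    apply/eqP; apply: contraT => mv'; have [+ _] := binK _ (muB _ mv').
    by rewrite bv.
  + move=> j jv; rewrite P; have [w0|w0 _] := eqVneq (rowf m1 j) 0; last exact: J2.
    have [mu0|mu0 _] := eqVneq (muf m k j) 0; last exact: muB.
    by rewrite w0 mu0 mulr0 subr0 eqxx.
  (* For [k' = k] the value drops from [s] to [s - s]; for an earlier [k'] the functional vanishes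
     on the subtracted residual. *)
  + move=> t k' lk' Bk'; have [bk' ck'] := binK _ Bk'.
    rewrite (eq_bigr (fun j => bef m k' j * rowf m1 j - s * (bef m k' j * muf m k j))).
      rewrite sumrB -mulr_sumr t ?bk ?bk' ?ck ?ck' //.
      move: lk'; rewrite ltnS leq_eqVlt => /orP[/eqP kl|k'l]; last first.
        rewrite J3 // sub0r (_ : (k' == k) = false) ?mulr0 ?oppr0 //.
        by apply/negbTE/eqP => kk; rewrite kk ltnn in k'l.
      have -> : k' = k by exact: val_inj.
      rewrite eqxx mulr1 /s; apply/eqP; rewrite subr_eq0; apply/eqP.
      by apply: eq_bigr => j _; rewrite Ebe mulrC.
    by move=> j _; rewrite P; ring.
- split=> [|j jv|//]; first by rewrite row0 eqxx.
  by rewrite row0 (negbTE jv) eqxx.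
have -> : m' = wlet m1 vK n by [].
split=> // t k Bk; exact: I3.
Qed.

Lemma image_row_ok m u : ready m ->
  za (exec n image_row m) aY u = \sum_j val0 M u j * rowf m j.
Proof.
move=> mr.
set e := ZBin Mul (ZArr aVAL (cell vU vJ)) (ZArr aW (WVar vJ)).
have [||m1 [I1 _ ->]] := @for_ind R n (fun l m1 =>
    forall u, (u < l)%N -> za m1 aY u = \sum_j val0 M u j * rowf m j)
  vU (sum zX vJ e ;; ZPut aY (WVar vU) (ZVar zX)) m.
- move=> l m1 ln F J {}u ul; rewrite exec_seq.
  have m1r : ready (wlet m1 vU l) by apply: ready_wlet => //; exact: ready_frame F isT mr.
  have F2 := exec_frame n (sum zX vJ e) (wlet m1 vU l).
  have X : zv (exec n (sum zX vJ e) (wlet m1 vU l)) zX =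
      \sum_(j < n) za m1 aVAL (l * n + j) * za m aW j.
    apply: (exec_sum (f := fun b => za m1 aVAL (l * n + b) * za m aW b)).
    move=> b m2 bn Ew Ea Ez _.
    rewrite /= !Ew Ez Ea /upd /= -(fr_za F) // (fr_wa F) // (ready_row mr) //.
  move: (exec n (sum zX vJ e) (wlet m1 vU l)) F2 X => m2 F2 X.
  rewrite /= /upd eqxx (fr_wv F2) //= /upd /=; case: eqVneq => [E|ne]; last first.
    by rewrite (fr_za F2) //= J //; move: ul; rewrite ltnS leq_eqVlt (negbTE ne).
  rewrite X; apply: eq_bigr => j _.
  by rewrite -E (ready_val m1r).
- by [].
exact: I1.
Qed.

Lemma comparable_ok m u v i : ready m -> wv m vV = v -> wv m vI = i -> wv m vU = u ->
  (wv (exec n comparable m) vOK == 0%N) =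
  ~~ (isSome (M u v) && [forall k, bin_of (colf m) (binf m) v i k ==> isSome (M u k)]).
Proof.
move=> mr mv mi mu; rewrite /comparable exec_seq.
set m0 := exec n (WLet _ _) m.
have Em0 : m0 = wlet m vOK (isSome (M u v)).
  by rewrite /m0 [LHS]/= mu mv (ready_row mr (ltn_ord _)) (ready_flag mr).
have m0r : ready m0 by rewrite Em0; exact: ready_wlet.
have m0w x : x != vOK -> wv m0 x = wv m x by rewrite Em0 /= /upd => /negbTE ->.
have m0a : wa m0 = wa m by rewrite Em0.
have m0ok : wv m0 vOK = isSome (M u v) by rewrite Em0 /= /upd eqxx.
clearbody m0.
set c := If _ _ _.
have [||m1 [I1 _ ->]] := @for_ind R n (fun l m1 => (wv m1 vOK == 0%N) =
  ~~ (isSome (M u v) && [forall k : 'I_n, (k < l)%N ==>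
        (bin_of (colf m) (binf m) v i k ==> isSome (M u k))])) vK (in_bin c) m0.
- move=> l m1 ln F J; pose k := Ordinal ln.
  have m1r : ready (wlet m1 vK l) by apply: ready_wlet => //; exact: ready_frame F isT m0r.
  have E : [forall k : 'I_n, (k < l.+1)%N ==>
        (bin_of (colf m) (binf m) v i k ==> isSome (M u k))] =
      [forall k : 'I_n, (k < l)%N ==>
        (bin_of (colf m) (binf m) v i k ==> isSome (M u k))] &&
      (bin_of (colf m) (binf m) v i k ==> isSome (M u k)).
    apply/forallP/andP => [H|[/forallP H Hk] k'].
      split; last by have := H k; rewrite ltnSn.
      by apply/forallP => k'; apply/implyP => kl; have := H k'; rewrite ltnS (ltnW kl).
    apply/implyP; rewrite ltnS leq_eqVlt => /orP[/eqP kl|kl]; last by have := H k'; rewrite kl.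
    by rewrite (_ : k' = k) //; exact: val_inj.
  have Eb : binf (wlet m1 vK l) = binf m by rewrite /binf /= (fr_wa F) // m0a.
  have Ec : colf (wlet m1 vK l) = colf m by rewrite /colf /= (fr_wa F) // m0a.
  rewrite E (exec_in_bin _ (k := k) (v := v) (i := i)) ?Eb ?Ec; last 3 first.
  + by [].
  + by rewrite /= /upd /= (fr_wv F) // m0w.
  + by rewrite /= /upd /= (fr_wv F) // m0w.
  case: ifP => Bk /=; last by rewrite andbT /upd.
  have -> : wa m1 aROW (upd (wv m1) vK l vU) = (u * n)%N.
    by rewrite /upd /= (fr_wv F) // m0w // mu -(ready_row m1r (ltn_ord _)).
  have -> : wa m1 aFLAG (u * n + upd (wv m1) vK l vK) = isSome (M u k).
    by rewrite -(ready_flag m1r).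
  case: (isSome (M u k)) => /=; first by rewrite andbT.
  by rewrite /upd /= !andbF.
- rewrite m0ok (_ : [forall k, _]) ?andbT; first by case: (isSome _).
  by apply/forallP.
rewrite /= /upd /= I1; congr (~~ (_ && _)).
by apply: eq_forallb => k; rewrite ltn_ord.
Qed.

Definition visible m u v i : bool :=
  isSome (M u v) && [forall k, bin_of (colf m) (binf m) v i k ==> isSome (M u k)].

Lemma compare_ok m v i : ready m -> wv m vV = v -> wv m vI = i ->
  let flag := wv (exec n compare m) vINS in
  (flag = 0%N -> forall u, visible m u v i -> za m aY u = za m aY v) /\
  (flag != 0%N -> exists2 u, visible m u v i & za m aY u != za m aY v).
Proof.
move=> mr mv mi; rewrite /compare exec_seq.
set m0 := exec n (WLet _ _) m.
have Em0 : m0 = wlet m vINS 0 by [].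
have m0r : ready m0 by rewrite Em0; exact: ready_wlet.
have m0w x : x != vINS -> wv m0 x = wv m x by rewrite Em0 /= /upd => /negbTE ->.
have m0i : wv m0 vINS = 0%N by [].
have m0a : wa m0 = wa m by rewrite Em0.
have m0z : za m0 = za m by rewrite Em0.
clearbody m0.
set c := Seq _ _.
have [||m1 [[I1 I2] _ ->]] := @for_ind R n (fun l m1 =>
  (wv m1 vINS = 0%N -> forall u, (u < l)%N -> visible m u v i -> za m aY u = za m aY v) /\
  (wv m1 vINS != 0%N -> exists2 u, visible m u v i & za m aY u != za m aY v)) vU c m0.
- move=> l m1 ln F [J1 J2]; pose u := Ordinal ln.
  have m1r : ready (wlet m1 vU l) by apply: ready_wlet => //; exact: ready_frame F isT m0r.
  have C := comparable_ok (u := u) (v := v) (i := i) m1r.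
  have Eb : binf (wlet m1 vU l) = binf m by rewrite /binf /= (fr_wa F) // m0a.
  have Ec : colf (wlet m1 vU l) = colf m by rewrite /colf /= (fr_wa F) // m0a.
  rewrite Eb Ec -/(visible m u v i) in C.
  have {}C : (wv (exec n comparable (wlet m1 vU l)) vOK == 0%N) = ~~ visible m u v i.
    by apply: C => //; rewrite /= /upd /= (fr_wv F) // m0w.
  rewrite /c exec_seq; have F2 := exec_frame n comparable (wlet m1 vU l).
  move: (exec n comparable (wlet m1 vU l)) F2 C => m2 F2 C.
  have m2i : wv m2 vINS = wv m1 vINS by rewrite (fr_wv F2).
  have m2v : wv m2 vV = v by rewrite (fr_wv F2) //= /upd /= (fr_wv F) // m0w.
  have m2u : wv m2 vU = u by rewrite (fr_wv F2).
  have m2y : za m2 aY = za m aY by rewrite (fr_za F2) //= (fr_za F) // m0z.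
  rewrite [exec _ _ _]/= C m2v m2u m2y subr_eq0.
  have skip : (visible m u v i -> za m aY u = za m aY v) ->
    (wv m2 vINS = 0%N -> forall u, (u < l.+1)%N -> visible m u v i -> za m aY u = za m aY v) /\
    (wv m2 vINS != 0%N -> exists2 u, visible m u v i & za m aY u != za m aY v).
    move=> Hu; rewrite m2i; split=> // i0 u'; rewrite ltnS leq_eqVlt.
    case/orP=> [/eqP ul|]; last exact: J1.
    by rewrite (_ : u' = u) //; exact: val_inj.
  case: ifP => [/negP Vu|/negbFE Vu]; first by apply: skip.
  case: eqVneq => [E|ne]; first by apply: skip.
  by split=> // _; exists u.
- by rewrite m0i.
by split=> /= [H u|]; [exact: I1|exact: I2].
Qed.

End Blocks.

Lemma cell_inj n a b i j : (i < n)%N -> (j < n)%N ->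
  (a * n + i = b * n + j)%N -> a = b /\ i = j.
Proof.
move=> iN jN E; have n0 : (0 < n)%N by case: n iN {jN E}.
have ab : a = b.
  by have := congr1 (divn^~ n) E; rewrite !divnMDl // !divn_small // !addn0.
by split=> //; move: E; rewrite ab => /addnI.
Qed.

Section Placement.
Variables (R : realType) (n d : nat) (M : 'M[option R]_n).
Implicit Types (m : store R) (u v k j : 'I_n).
Local Notation ready := (ready d M).

Lemma decide_bin_ok m v i : ready m -> wv m vV = v -> wv m vI = i ->
  let m' := exec n decide_bin m in
  (wv m' vINS = 0%N -> \sum_(j < n) rowf m j = 0 /\
     forall u, visible M m u v i -> za m aY u = za m aY v) /\
  (wv m' vINS != 0%N ->
     (\sum_(j < n) rowf m j != 0 /\ forall u, za m' aY u = 1) \/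
     [/\ \sum_(j < n) rowf m j = 0, za m' aY = za m aY &
         exists2 u, visible M m u v i & za m aY u != za m aY v]).
Proof.
move=> mr mv mi; rewrite /decide_bin exec_seq.
set c := sum _ _ _.
have S : zv (exec n c m) zS = \sum_(j < n) rowf m j.
  apply: (exec_sum (f := fun l => za m aW l)) => l m' ln Ew Ea Ez _.
  by rewrite /= Ez Ew /upd eqxx.
have F := exec_frame n c m; have m1r := ready_frame F isT mr.
move: (exec n c m) F m1r S => m1 F m1r S.
have m1v : wv m1 vV = v by rewrite (fr_wv F).
have m1i : wv m1 vI = i by rewrite (fr_wv F).
have vis u : visible M m1 u v i = visible M m u v i by rewrite /visible /binf /colf !(fr_wa F).
have [C1 C2] := compare_ok m1r m1v m1i.
rewrite exec_if exec_seq [tev _ _]/= [exec n (WLet _ _) _]/= S; case: eqVneq => s0.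
  split=> [/C1 H|/C2[u]]; first by split=> // u; rewrite -vis => /H; rewrite (fr_za F).
  rewrite vis (fr_za F) // => Vu yu; right; split=> //; last by exists u.
  by rewrite exec_za // (fr_za F).
split=> [|_]; first by rewrite exec_wv.
left; split=> // u.
have [||H _] := @exec_map R n aY vU (WVar vU) (ZNat (WNum 1)) id (fun=> 1) (wlet m1 vINS 1%N).
- by [].
- by move=> l m' ln Ew _ _ _ _; rewrite /= Ew /upd eqxx.
exact: H.
Qed.

Lemma insert_ok m v i : ready m -> wv m vV = v -> wv m vI = i ->
  let m' := exec n insert m in
  let q := \sum_(l < n) rowf m l * za m aY l in
  [/\ forall k, binf m' k = ins v (binf m) i.+1 k,
      forall k j, muf m' k j = ins v (muf m) (rowf m) k j &
      forall k j, bef m' k j = ins v (bef m) (fun j => za m aY j / q) k j].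
Proof.
move=> mr mv mi; cbv zeta; rewrite /insert exec_seq.
set c := sum _ _ _.
have Q : zv (exec n c m) zQ = \sum_(j < n) rowf m j * za m aY j.
  apply: (exec_sum (f := fun l => za m aW l * za m aY l)) => l m' ln Ew Ea Ez _.
  by rewrite /= Ez Ew /upd eqxx.
set q := \sum_l _ in Q *; clearbody q.
have F := exec_frame n c m; have m1r := ready_frame F isT mr.
move: (exec n c m) F m1r Q => m1 F m1r Q.
have m1v : wv m1 vV = v by rewrite (fr_wv F).
rewrite exec_seq.
have [||] := @exec_map R n aMU vJ (cell vV vJ) (ZArr aW (WVar vJ))
  (fun l => v * n + l)%N (fun l => za m1 aW l) m1.
- by move=> k l kn ln /(cell_inj kn ln)[].
- move=> l m' ln Ew Ez Ea Eza _; rewrite /= !Ew /upd /= Ea Eza // m1v.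
  by rewrite (ready_row m1r (ltn_ord _)).
set c2 := For _ _ => A1 A2.
have F2 := exec_frame n c2 m1; have m2r := ready_frame F2 isT m1r.
move: (exec n c2 m1) F2 m2r A1 A2 => m2 F2 m2r A1 A2.
have m2v : wv m2 vV = v by rewrite (fr_wv F2).
rewrite exec_seq.
have [||] := @exec_map R n aBE vJ (cell vV vJ) (ZBin Div (ZArr aY (WVar vJ)) (ZVar zQ))
  (fun l => v * n + l)%N (fun l => za m2 aY l / q) m2.
- by move=> k l kn ln /(cell_inj kn ln)[].
- move=> l m' ln Ew Ez Ea Eza _; rewrite /= !Ew /upd /= Ea Eza // m2v Ez (fr_zv F2) // Q.
  by rewrite (ready_row m2r (ltn_ord _)).
set c3 := For _ _ => B1 B2.
have F3 := exec_frame n c3 m2; have m3r := ready_frame F3 isT m2r.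
move: (exec n c3 m2) F3 m3r B1 B2 => m3 F3 m3r B1 B2.
have m3v : wv m3 vV = v by rewrite (fr_wv F3).
have m3i : wv m3 vI = i by rewrite (fr_wv F3) // (fr_wv F2) // (fr_wv F).
have m3b : wa m3 aBIN = wa m aBIN by rewrite (fr_wa F3) // (fr_wa F2) // (fr_wa F).
have m1w : za m1 aW = za m aW by rewrite (fr_za F).
have m2y : za m2 aY = za m aY by rewrite (fr_za F2) // (fr_za F).
have cell_neq k j : k != v -> forall l, (l < n)%N -> (k * n + j)%N != (v * n + l)%N.
  move=> kv l ln; apply: contraNneq kv => /(cell_inj (ltn_ord j) ln)[kv _].
  by apply/eqP/val_inj.
rewrite [exec n (WPut _ _ _) m3]/= m3v m3i addn1.
split=> [k|k j|k j]; rewrite /ins.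
- by rewrite /binf /= /upd eqxx m3b -(inj_eq val_inj).
- rewrite /muf /= (fr_za F3) //; have [->|kv] := eqVneq k v; first by rewrite A1 // m1w.
  by rewrite A2 ?(fr_za F) //; exact: cell_neq.
- rewrite /bef /=; have [->|kv] := eqVneq k v; first by rewrite B1 // m2y.
  by rewrite B2 ?(fr_za F2) ?(fr_za F) //; exact: cell_neq.
Qed.

Definition placed m (l i : nat) : Prop :=
  placing d (wv m vDEG) M (colf m) l i (binf m) (muf m) (bef m).

Lemma try_bin_ok m v i :
  (forall u u', colf m u = colf m u' -> isSome (M u u')) ->
  ready m -> wv m vV = v -> wv m vI = i -> placed m v i ->
  placed (exec n try_bin m) v i.+1.
Proof.
move=> colM mr mv mi pl; rewrite /try_bin.
set c := _ ;; _.
rewrite !exec_if [tev _ _]/= [tev _ (TEq _ _)]/= mi mv.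
case: ltnP => [Di|iD].
  by apply: (placing_skip pl) => u _ _; rewrite leqNgt Di.
case: eqVneq => bv; last first.
  apply: (placing_skip pl) => u uv; have -> : u = v by exact: val_inj.
  by move=> bv0 _; rewrite /binf in bv0; rewrite bv0 in bv.
rewrite /c exec_seq.
have U := unit_row_ok (v := v) mv.
have F1 := exec_frame n unit_row m; have m1r := ready_frame F1 isT mr.
move: (exec n unit_row m) F1 m1r U => m1 F1 m1r U; rewrite exec_seq.
have m1v : wv m1 vV = v by rewrite (fr_wv F1).
have m1i : wv m1 vI = i by rewrite (fr_wv F1).
have Eb1 : binf m1 = binf m :> ('I_n -> nat) by rewrite /binf (fr_wa F1).
have Ec1 : colf m1 = colf m :> ('I_n -> nat) by rewrite /colf (fr_wa F1).
have Emu1 : muf m1 = muf m :> ('I_n -> 'I_n -> R) by rewrite /muf (fr_za F1).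
have Ebe1 : bef m1 = bef m :> ('I_n -> 'I_n -> R) by rewrite /bef (fr_za F1).
have [] := project_ok m1r m1v m1i _ U _; rewrite ?Eb1 ?Ec1 ?Emu1 ?Ebe1 //.
  exact: (placing_supp pl).
move=> wv1 wB worth.
have F2 := exec_frame n project m1; have m2r := ready_frame F2 isT m1r.
move: (exec n project m1) F2 m2r wv1 wB worth => m2 F2 m2r wv1 wB worth.
rewrite exec_seq.
have Y u := image_row_ok u m2r.
have F3 := exec_frame n image_row m2; have m3r := ready_frame F3 isT m2r.
move: (exec n image_row m2) F3 m3r Y => m3 F3 m3r Y.
have m3v : wv m3 vV = v by rewrite (fr_wv F3) // (fr_wv F2).
have m3i : wv m3 vI = i by rewrite (fr_wv F3) // (fr_wv F2).
have Ew3 : rowf m3 = rowf m2 :> ('I_n -> R) by rewrite /rowf (fr_za F3).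
have vis u : visible M m3 u v i =
    isSome (M u v) && [forall k, bin_of (colf m) (binf m) v i k ==> isSome (M u k)].
  by rewrite /visible -Eb1 -Ec1 /binf /colf !(fr_wa F3) // !(fr_wa F2).
have [D1 D2] := decide_bin_ok m3r m3v m3i; rewrite Ew3 in D1 D2.
rewrite exec_seq.
have F4 := exec_frame n decide_bin m3; have m4r := ready_frame F4 isT m3r.
move: (exec n decide_bin m3) F4 m4r D1 D2 => m4 F4 m4r D1 D2.
have m4v : wv m4 vV = v by rewrite (fr_wv F4).
have m4i : wv m4 vI = i by rewrite (fr_wv F4).
have m4d : wv m4 vDEG = wv m vDEG.
  by rewrite (fr_wv F4) // (fr_wv F3) // (fr_wv F2) // (fr_wv F1).
have Eb4 : binf m4 = binf m :> ('I_n -> nat).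
  by rewrite -Eb1 /binf (fr_wa F4) // (fr_wa F3) // (fr_wa F2).
have Ec4 : colf m4 = colf m :> ('I_n -> nat).
  by rewrite -Ec1 /colf (fr_wa F4) // (fr_wa F3) // (fr_wa F2).
have Emu4 : muf m4 = muf m :> ('I_n -> 'I_n -> R).
  by rewrite -Emu1 /muf (fr_za F4) // (fr_za F3) // (fr_za F2).
have Ebe4 : bef m4 = bef m :> ('I_n -> 'I_n -> R).
  by rewrite -Ebe1 /bef (fr_za F4) // (fr_za F3) // (fr_za F2).
have Ew4 : rowf m4 = rowf m2 :> ('I_n -> R) by rewrite /rowf (fr_za F4) // (fr_za F3).
rewrite exec_if [tev _ _]/= [exec n Skip _]/=.
have wbe : EDMC M d -> forall k, bin_of (colf m) (binf m) v i k ->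
    \sum_j bef m k j * rowf m2 j = 0.
  by move=> eM; apply: worth; exact: (placing_tri pl).
(* With flag 0 the placement stays as it is and the residual is recorded as the dependence of [v] on
   this bin; otherwise [v] is inserted, with [y] either 1 or [M w]. *)
case: eqVneq => flag.
  have [w0 wy] := D1 flag; rewrite /placed m4d Eb4 Ec4 Emu4 Ebe4.
  apply: (placing_dependent pl wv1 wB w0) => u uv uB.
  rewrite -!Y; apply: wy; rewrite vis uv /=; apply/forallP => k.
  by apply/implyP; exact: uB.
have [In1 In2 In3] := insert_ok m4r m4v m4i.
have FI := exec_frame n insert m4.
move: (exec n insert m4) FI In1 In2 In3 => m5 FI In1 In2 In3.
have E1 : binf m5 = ins v (binf m) i.+1 by apply: functional_extensionality => k; rewrite In1 Eb4.
have E2 : muf m5 = ins v (muf m) (rowf m2).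
  apply: functional_extensionality => k; apply: functional_extensionality => j.
  by rewrite In2 Emu4 Ew4.
have E3 : bef m5 = ins v (bef m)
    (fun j => za m4 aY j / \sum_(l < n) rowf m2 l * za m4 aY l).
  apply: functional_extensionality => k; apply: functional_extensionality => j.
  by rewrite In3 Ebe4 Ew4.
have E4 : colf m5 = colf m :> ('I_n -> nat) by rewrite -Ec4 /colf (fr_wa FI).
rewrite /placed (fr_wv FI) // m4d E1 E2 E3 E4.
apply: (placing_insert colM iD pl bv wB wbe (y := fun j => za m4 aY j)).
case: (D2 flag) => [|[w0 y4 [u Vu yu]]]; [by left|right; split=> //].
  by move=> u'; rewrite y4 Y.
exists u; last by rewrite y4.
by move: Vu; rewrite vis => /andP[uv /forallP uB]; split=> // k; apply/implyP.
Qed.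

End Placement.

(** * Correctness of the colouring and of the distribution *)

Section Kernelize.
Variables (R : realType) (n d : nat) (M : 'M[option R]_n).
Implicit Types (m : store R) (u v k j : 'I_n).
Local Notation ready := (ready d M).
Hypothesis pM : partial_matrix M.

Let symM k j : M k j = M j k.
Proof. by case: pM => tM _ _; rewrite -{1}tM mxE. Qed.

Let diagM k : isSome (M k k).
Proof. by case: pM => _ dM _; rewrite dM. Qed.

Lemma rows_ok m : wv m vN = n ->
  forall i, (i < n)%N -> wa (exec n rows m) aROW i = (i * n)%N.
Proof.
move=> mn; rewrite /rows exec_seq.
set m0 := exec n (WLet _ _) m; set c := Seq _ _.
have [||m1 [[_ _ I3] _ ->]] := @for_ind R n (fun l m1 => [/\ wv m1 vT = (l * n)%N,
   wv m1 vN = n & forall i, (i < l)%N -> wa m1 aROW i = (i * n)%N]) vI c m0.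
- move=> l m1 ln _ [J1 J2 J3]; split.
  + by rewrite /= /upd /= J1 J2 mulSn addnC.
  + by rewrite /= /upd /= J2.
  + move=> i; rewrite ltnS leq_eqVlt /= /upd /= => /orP[/eqP ->|il].
      by rewrite eqxx J1.
    by rewrite (ltn_eqF il) J3.
- by split.
exact: I3.
Qed.

Lemma degree_ok m : ready m ->
  let m' := exec n degree m in
  unspecified_le M (wv m' vDEG) /\
  forall Delta, unspecified_le M Delta -> (wv m' vDEG <= Delta)%N.
Proof.
move=> mr; rewrite /degree exec_seq.
have m0r : ready (exec n (WLet vDEG (WNum 0)) m) by exact: ready_wlet.
have m0d : wv (exec n (WLet vDEG (WNum 0)) m) vDEG = 0%N by [].
move: (exec n (WLet vDEG (WNum 0)) m) m0r m0d => m0 m0r m0d.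
pose deg k := #|[set j | M k j == None]|.
set c := Seq _ _.
have [||m1 [[I1 I2] _ ->]] := @for_ind R n (fun l m1 =>
    (forall k, (k < l)%N -> (deg k <= wv m1 vDEG)%N) /\
    (forall Delta, unspecified_le M Delta -> (wv m1 vDEG <= Delta)%N)) vI c m0.
- move=> l m1 ln F [J1 J2]; pose k := Ordinal ln.
  have m1r : ready (wlet m1 vI l) by apply: ready_wlet => //; exact: ready_frame F isT m0r.
  rewrite /c exec_seq.
  have F2 := exec_frame n (WLet vCNT (WNum 0)) (wlet m1 vI l).
  have m2r := ready_frame F2 isT m1r.
  have m2c : wv (exec n (WLet vCNT (WNum 0)) (wlet m1 vI l)) vCNT = 0%N by [].
  move: (exec n (WLet vCNT (WNum 0)) (wlet m1 vI l)) F2 m2r m2c => m2 F2 m2r m2c.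
  have m2i : wv m2 vI = k by rewrite (fr_wv F2).
  have m2d : wv m2 vDEG = wv m1 vDEG by rewrite (fr_wv F2).
  rewrite exec_seq; set c2 := For _ _.
  have C : wv (exec n c2 m2) vCNT = deg k.
    rewrite /c2; set c3 := If _ _ _.
    have [||m3 [I3 _ ->]] := @for_ind R n (fun b m3 =>
      wv m3 vCNT = \sum_(a < b) (wa m2 aFLAG (k * n + a) == 0)%N)%N vJ c3 m2.
    + move=> b m3 bn F3 J; rewrite big_ord_recr /= -J /upd /=.
      rewrite (fr_wv F3) // m2i !(fr_wa F3) // (ready_row m2r (ltn_ord k)).
      by case: ifP => _ /=; rewrite /upd /= ?addn1 ?addn0.
    + by rewrite big_ord0.
    rewrite /= /upd /= I3 /deg -sum1_card [RHS]big_mkcond /=; apply: eq_bigr => j _.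
    by rewrite inE (ready_flag m2r k j); case: (M k j).
  have F3 := exec_frame n c2 m2.
  move: (exec n c2 m2) F3 C => m3 F3 C.
  have m3d : wv m3 vDEG = wv m1 vDEG by rewrite (fr_wv F3).
  have Dk u : (u < l.+1)%N -> (u < l)%N \/ u = k.
    rewrite ltnS leq_eqVlt => /orP[/eqP ul|]; [right; exact: val_inj|by left].
  rewrite exec_if [tev _ _]/= C m3d; case: ltnP => Ck.
    split=> [u /Dk[ul|->]|D uD]; rewrite /= /upd /= C //.
    * by apply: leq_trans (J1 _ ul) _; exact: ltnW.
    * exact: uD.
  by rewrite /= m3d; split=> // u /Dk[|->] //; exact: J1.
- by rewrite m0d.
by split=> [k|]; [exact: I1|exact: I2].
Qed.

Lemma conflict_ok m v i : ready m -> wv m vV = v -> wv m vI = i ->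
  (wv (exec n conflict m) vOK == 0%N) =
  ~~ [forall u : 'I_n, (u < v)%N && (colf m u == i) ==> isSome (M u v)].
Proof.
move=> mr mv mi; rewrite /conflict exec_seq.
set m0 := exec n (WLet _ _) m.
have Em0 : m0 = wlet m vOK 1%N by [].
have m0r : ready m0 by rewrite Em0; exact: ready_wlet.
have m0v : wv m0 vV = v by [].
have m0i : wv m0 vI = i by [].
have m0c : wa m0 = wa m by [].
have m0ok : wv m0 vOK = 1%N by [].
clearbody m0; set c := If _ _ _.
have [||m1 [I1 _ ->]] := @for_ind R n (fun l m1 => (wv m1 vOK == 0%N) =
  ~~ [forall u : 'I_n, (u < l)%N ==>
        ((u < v)%N && (colf m u == i) ==> isSome (M u v))]) vU c m0.
- move=> l m1 ln F J; pose k := Ordinal ln.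
  have E : [forall u : 'I_n, (u < l.+1)%N ==>
        ((u < v)%N && (colf m u == i) ==> isSome (M u v))] =
      [forall u : 'I_n, (u < l)%N ==>
        ((u < v)%N && (colf m u == i) ==> isSome (M u v))] &&
      ((k < v)%N && (colf m k == i) ==> isSome (M k v)).
    apply/forallP/andP => [H|[/forallP H Hk] k'].
      split; last by have := H k; rewrite ltnSn.
      by apply/forallP => k'; apply/implyP => kl; have := H k'; rewrite ltnS (ltnW kl).
    apply/implyP; rewrite ltnS leq_eqVlt => /orP[/eqP kl|kl]; last by have := H k'; rewrite kl.
    by rewrite (_ : k' = k) //; exact: val_inj.
  have m1v : wv m1 vV = v by rewrite (fr_wv F).
  have m1i : wv m1 vI = i by rewrite (fr_wv F).
  have m1a : wa m1 = wa m by apply: functional_extensionality => a; rewrite (fr_wa F) // m0c.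
  have m1r : ready m1 := ready_frame F isT m0r.
  rewrite E /c !exec_if [tev _ _]/= [tev _ (TEq (WArr aCOL _) _)]/=
    [tev _ (TEq (WArr aFLAG _) _)]/= /upd /= m1v m1i.
  rewrite -[l]/(nat_of_ord k) (ready_row m1r (ltn_ord k)) (ready_flag m1r k v).
  rewrite m1a -/(colf m k).
  case: (ltnP k v) => lv /=; last by rewrite andbT /upd.
  case: (colf m k == i) => /=; last by rewrite andbT /upd.
  case: (isSome (M k v)) => /=; first by rewrite andbT /upd.
  by rewrite /upd /= andbF.
- by rewrite m0ok; apply/esym/negbTE; rewrite negbK; apply/forallP.
rewrite /= /upd /= I1; congr (~~ _).
by apply: eq_forallb => k; rewrite ltn_ord.
Qed.

Lemma colour_ok m : ready m -> unspecified_le M (wv m vDEG) -> (0 < n -> wv m vDEG < n)%N ->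
  let m' := exec n colour m in
  (forall u, colf m' u <= wv m vDEG)%N /\
  (forall u v, colf m' u = colf m' v -> isSome (M u v)).
Proof.
move=> mr uM Dn; rewrite /colour; set D := wv m vDEG in uM Dn *.
have [||m1 [I1 F E]] := @for_ind R n (fun l m1 => forall u, (u < l)%N ->
    (colf m1 u <= D)%N /\ forall v, (v < u)%N -> colf m1 v = colf m1 u -> isSome (M v u))
  vV (For vI (If (TLt (WVar vDEG) (WVar vI)) Skip
    (conflict ;; If (TEq (WVar vOK) (WNum 0)) Skip (WPut aCOL (WVar vV) (WVar vI))))) m.
- move=> l m1 ln F J; pose v := Ordinal ln.
  have m1r : ready (wlet m1 vV l) by apply: ready_wlet => //; exact: ready_frame F isT mr.
  have m1d : wv m1 vDEG = D by rewrite (fr_wv F).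
  (* Only the colours of smaller indices count, and these are final, so the provisional colours of
     [v] during the scan do no harm. *)
  pose good i := (i <= D)%N &&
    [forall u : 'I_n, (u < v)%N && (colf m1 u == i) ==> isSome (M u v)].
  set c := If _ _ _.
  have [||m2 [[I1 I2] F2 ->]] := @for_ind R n (fun i m2 =>
      (forall u, u != v -> colf m2 u = colf m1 u) /\
      (good (colf m2 v) \/ forall a, (a < i)%N -> ~~ good a)) vI c (wlet m1 vV l).
  + move=> i m2 iN F2 [J1 J2].
    have m2r : ready (wlet m2 vI i) by apply: ready_wlet => //; exact: ready_frame F2 isT m1r.
    have m2d : wv m2 vDEG = D by rewrite (fr_wv F2).
    have m2v : wv m2 vV = v by rewrite (fr_wv F2).
    have T : tev (wlet m2 vI i) (TLt (WVar vDEG) (WVar vI)) = (D < i)%N.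
      by rewrite /= /upd /= m2d.
    rewrite /c exec_if T.
    have m3r : ready (wlet m2 vI i) by [].
    have m3v : wv (wlet m2 vI i) vV = v by [].
    have C := conflict_ok m3r m3v (erefl : wv (wlet m2 vI i) vI = i).
    have goodE : good i = (i <= D)%N &&
      [forall u : 'I_n, (u < v)%N && (colf (wlet m2 vI i) u == i) ==> isSome (M u v)].
      congr (_ && _); apply: eq_forallb => u; rewrite -[colf (wlet _ _ _) u]/(colf m2 u).
      by have [->|uv] := eqVneq u v; rewrite ?ltnn // J1.
    have skip : ~~ good i -> (forall u, u != v -> colf m2 u = colf m1 u) /\
      (good (colf m2 v) \/ forall a, (a < i.+1)%N -> ~~ good a).
      move=> ng; split=> //; case: J2 => [|J2]; first by left.
      by right=> a; rewrite ltnS leq_eqVlt => /orP[/eqP ->|] //; exact: J2.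
    case: ltnP => Di; first by apply: skip; rewrite /good leqNgt Di.
    rewrite exec_seq; have F4 := exec_frame n conflict (wlet m2 vI i).
    move: (exec n conflict (wlet m2 vI i)) F4 C => m4 F4 C.
    have m4c u : colf m4 u = colf m2 u by rewrite /colf (fr_wa F4).
    rewrite exec_if [tev _ _]/= C; case: ifP => ok.
      have [A1 A2] : (forall u, u != v -> colf m2 u = colf m1 u) /\
        (good (colf m2 v) \/ forall a, (a < i.+1)%N -> ~~ good a).
        by apply: skip; rewrite goodE negb_and ok orbT.
      by split=> [u uv|] /=; rewrite m4c //; exact: A1.
    have gi : good i by rewrite goodE Di /= -[X in is_true X]negbK ok.
    have m4v : wv m4 vV = v by rewrite (fr_wv F4).
    have m4i : wv m4 vI = i by rewrite (fr_wv F4).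
    split=> [u uv|]; rewrite /colf /= /upd /= m4v m4i.
      by rewrite (inj_eq val_inj) (negbTE uv) -[wa m4 _ _]/(colf m4 u) m4c J1.
    by left; rewrite eqxx.
  + by split=> //; right.
  have Dn' : (D < n)%N by apply: Dn; exact: (leq_ltn_trans (leq0n l) ln).
  (* Each of the at most [D] gaps in row [v] blocks one colour, so some colour up to [D] is free; it
     was tried because [D < n]. *)
  have gv : good (colf m2 v).
    case: I2 => // I2.
    have [a aD Ha] := pigeonhole_label (colf m1) (uM v).
    case/negP: (I2 a (leq_ltn_trans aD Dn')).
    rewrite /good aD; apply/forallP => u; apply/implyP => /andP[_ ca].
    by have := Ha u; rewrite ca inE symM; case: (M u v) => //= /(_ isT).
  have vs u : u != v -> (u < l.+1)%N -> (u < l)%N.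
    by move=> uv; rewrite ltnS leq_eqVlt -[l]/(val v) (inj_eq val_inj) (negbTE uv).
  move=> u ul; rewrite -[colf (wlet _ _ _) u]/(colf m2 u).
  have [->|uv] := eqVneq u v.
    move/andP: gv => [cD /forallP g]; split=> // u' u'v.
    rewrite -[colf (wlet _ _ _) u']/(colf m2 u') => cu'.
    have := g u'; rewrite u'v -cu' I1 ?eqxx //.
    by apply: contraTneq u'v => ->; rewrite ltnn.
  rewrite I1 //; have [cD g] := J u (vs _ uv ul); split=> // u' u'u.
  rewrite -[colf (wlet _ _ _) u']/(colf m2 u') I1; first exact: g.
  apply/eqP => u'v; have := vs _ uv ul; rewrite -[l]/(val v) -u'v => uu'.
  by move: (ltn_trans u'u uu'); rewrite ltnn.
- by [].
rewrite E; split=> [u|u v cuv]; first by have [] := I1 u (ltn_ord u).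
rewrite -[colf (wlet _ _ _) u]/(colf m1 u) -[colf (wlet _ _ _) v]/(colf m1 v) in cuv.
have [uv|vu|uv] := ltngtP u v.
- by have [_ H] := I1 v (ltn_ord v); exact: H.
- by have [_ H] := I1 u (ltn_ord u); rewrite symM; exact: H.
- by rewrite (_ : u = v); [exact: diagM|exact: val_inj].
Qed.

Lemma distribute_ok m : ready m -> (0 < n -> wv m vDEG < n)%N ->
  (forall u v, colf m u = colf m v -> isSome (M u v)) ->
  placed d M (exec n distribute m) n 0.
Proof.
move=> mr Dn colM; rewrite /distribute exec_seq.
have [||m0 [I0 F0 ->]] := @for_ind R n (fun l m0 => forall u, (u < l)%N -> binf m0 u = 0%N)
  vV (WPut aBIN (WVar vV) (WNum 0)) m.
- move=> l m0 ln F J u; rewrite ltnS leq_eqVlt /binf /= /upd /=.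
  by case: eqVneq => // _ /= /J.
- by [].
have m0r : ready (wlet m0 vV n) by apply: ready_wlet => //; exact: ready_frame F0 isT mr.
have b0 u : binf (wlet m0 vV n) u = 0%N by exact: I0.
have m0d : wv (wlet m0 vV n) vDEG = wv m vDEG by rewrite /= /upd /= (fr_wv F0).
have m0c : colf (wlet m0 vV n) = colf m :> ('I_n -> nat) by rewrite /colf /= (fr_wa F0).
rewrite -m0d in Dn; rewrite -m0c in colM.
move: (wlet m0 vV n) m0r b0 Dn colM => {}m0 m0r b0 Dn colM {I0 F0 m0d m0c}.
have [||m1 [I1 F1 ->]] := @for_ind R n (fun l m1 => placed d M m1 l 0)
  vV (For vI try_bin) m0.
- move=> l m1 ln F J; pose v := Ordinal ln.
  have m1r : ready (wlet m1 vV l) by apply: ready_wlet => //; exact: ready_frame F isT m0r.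
  have m1d : wv m1 vDEG = wv m0 vDEG by rewrite (fr_wv F).
  have m1c : colf m1 = colf m0 :> ('I_n -> nat) by rewrite /colf (fr_wa F).
  have [||m2 [I2 F2 ->]] := @for_ind R n (fun i m2 => placed d M m2 v i)
    vI try_bin (wlet m1 vV l).
  + move=> i m2 iN F2 J2.
    have m2d : wv (wlet m2 vI i) vDEG = wv m0 vDEG by rewrite -m1d /= /upd /= (fr_wv F2).
    have m2c : colf (wlet m2 vI i) = colf m0 :> ('I_n -> nat).
      by rewrite -m1c /colf /= (fr_wa F2).
    apply: try_bin_ok => //; rewrite ?m2d ?m2c //.
    * by apply: ready_wlet => //; exact: ready_frame F2 isT m1r.
    * by rewrite /= /upd /= (fr_wv F2).
  + exact: J.
  have m2d : wv m2 vDEG = wv m0 vDEG by rewrite -m1d (fr_wv F2).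
  (* The pass from [(v, n)] to [(v.+1, 0)] uses [D < n]: the inner loop has tried every bin number
     up to [D] for [v]. *)
  case: I2 => H1 H2 H3 H4 H5 H6; split=> //.
  + by move=> u bu; apply: leqW; exact: H1.
  + move=> u i' bu iD [|[_ //]]; rewrite ltnS leq_eqVlt => /orP[/eqP ul|ul].
      apply: H4 => //; right; split=> //.
      by apply: (leq_ltn_trans iD); rewrite /= /upd /= m2d; apply: Dn; exact: (leq_ltn_trans (leq0n l) ln).
    by apply: H4 => //; left.
- split=> //.
  + by move=> u; rewrite b0.
  + by move=> u; rewrite b0.
  + by move=> k j; rewrite b0.
  + by move=> u i' _ _ [|[]].
  + by move=> _ k l; rewrite b0.
  + by move=> p rp k; rewrite b0.
exact: I1.
Qed.

End Kernelize.

(** * Counting and emitting the kept indices *)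

Section Output.
Variables (R : realType) (n d : nat) (M : 'M[option R]_n).
Implicit Types (m : store R) (u v k j : 'I_n).
Local Notation ready := (ready d M).

Definition kept m (l : nat) : seq nat := [seq i <- iota 0 l | wa m aBIN i != 0%N].

Lemma keptS m l : kept m l.+1 = kept m l ++ (if wa m aBIN l == 0%N then [::] else [:: l]).
Proof. by rewrite /kept -(addn1 l) iotaD filter_cat /= add0n; case: eqP. Qed.

Lemma size_kept m : size (kept m n) = #|[set k : 'I_n | binf m k != 0%N]|.
Proof.
rewrite /kept -val_enum_ord filter_map size_map cardE [in RHS]/enum_mem -enumT.
by congr size; apply: eq_filter => k; rewrite /= inE.
Qed.

Lemma count_kept_ok m : ready m ->
  let m' := exec n count_kept m in let D := minn n (wv m vDEG).+1 in
  (wv m' vREJ == 0%N) = (size (kept m n) <= D * (D * (d + 1)))%N /\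
  wv m' vKEPT = size (kept m n).
Proof.
move=> mr; cbv zeta; set D := minn _ _; rewrite /count_kept exec_seq.
set m0 := exec n (WLet _ _) m.
have m0r : ready m0 by exact: ready_wlet.
have m0t : wv m0 vT = 0%N by [].
have m0d : wv m0 vDEG = wv m vDEG by [].
have m0b : wa m0 = wa m by [].
clearbody m0; rewrite exec_seq.
set c := If (TLt (WVar vDEG) (WVar vI)) _ _.
have [||m1 [I1 F1 ->]] := @for_ind R n (fun l m1 =>
    wv m1 vT = (minn l (wv m vDEG).+1 * (D * (d + 1)))%N) vI c m0.
- move=> l m1 ln F J.
  have m1d : wv (wlet m1 vI l) vDEG = wv m vDEG by rewrite -m0d -(fr_wv F).
  have m1n : wv (wlet m1 vI l) vDIM = d by rewrite -(ready_dim m0r) -(fr_wv F).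
  have m1t : wv (wlet m1 vI l) vT = (minn l (wv m vDEG).+1 * (D * (d + 1)))%N by rewrite -J.
  have T : tev (wlet m1 vI l) (TLt (WVar vDEG) (WVar vI)) = (wv m vDEG < l)%N.
    by rewrite -m1d.
  rewrite /c exec_if T; case: (ltnP (wv m vDEG) l) => Dl.
    by rewrite [LHS]m1t; congr (_ * _)%N; lia.
  move: (wlet m1 vI l) m1d m1n m1t => m2 m2d m2n m2t.
  set c2 := If (TLt (WVar vDEG) (WVar vJ)) _ _.
  have [||m3 [I3 _ ->]] := @for_ind R n (fun b m3 =>
    wv m3 vT = (l * (D * (d + 1)) + minn b (wv m vDEG).+1 * (d + 1))%N) vJ c2 m2.
  + move=> b m3 bn F3 J3.
    have m3d : wv (wlet m3 vJ b) vDEG = wv m vDEG by rewrite -m2d -(fr_wv F3).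
    have m3n : wv (wlet m3 vJ b) vDIM = d by rewrite -m2n -(fr_wv F3).
    have T3 : tev (wlet m3 vJ b) (TLt (WVar vDEG) (WVar vJ)) = (wv m vDEG < b)%N.
      by rewrite -m3d.
    rewrite /c2 exec_if T3; case: (ltnP (wv m vDEG) b) => Db.
      by rewrite [LHS]J3; congr (_ + _ * _)%N; lia.
    rewrite [LHS]/(wv m3 vT + (wv (wlet m3 vJ b) vDIM + 1))%N m3n J3.
    have -> : minn b.+1 (wv m vDEG).+1 = (minn b (wv m vDEG).+1).+1 by lia.
    by rewrite mulSn; lia.
  + by rewrite m2t min0n addn0; congr (_ * _)%N; lia.
  rewrite [LHS]I3 -/D.
  have -> : minn l.+1 (wv m vDEG).+1 = l.+1 by lia.
  by rewrite mulSn addnC.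
- by rewrite m0t min0n.
have m1b : wa (wlet m1 vI n) = wa m.
  by apply: functional_extensionality => a; rewrite /= (fr_wa F1) // m0b.
have m1t : wv (wlet m1 vI n) vT = (D * (D * (d + 1)))%N by rewrite -I1.
move: (wlet m1 vI n) m1b m1t => {F1 I1}m2 m2b m2t.
rewrite exec_seq; set m3 := exec n (WLet _ _) m2.
have m3b : wa m3 = wa m by rewrite -m2b.
have m3t : wv m3 vT = (D * (D * (d + 1)))%N by rewrite -m2t.
have m3k : wv m3 vKEPT = 0%N by [].
clearbody m3; rewrite exec_seq; set c3 := If (TEq _ _) _ _.
have [||m4 [I4 F4 ->]] := @for_ind R n (fun l m4 =>
    wv m4 vKEPT = size (kept m l)) vV c3 m3.
- move=> l m4 ln F J; rewrite keptS size_cat.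
  have m4b : wa (wlet m4 vV l) = wa m.
    by apply: functional_extensionality => a; rewrite /= (fr_wa F) // m3b.
  have T : tev (wlet m4 vV l) (TEq (WArr aBIN (WVar vV)) (WNum 0)) = (wa m aBIN l == 0%N).
    by rewrite -m4b.
  by rewrite /c3 exec_if T -J; case: (_ == _); rewrite /= ?addn0 /upd.
- by rewrite m3k.
have m5k : wv (wlet m4 vV n) vKEPT = size (kept m n) by rewrite -I4.
have m5t : wv (wlet m4 vV n) vT = (D * (D * (d + 1)))%N by rewrite -m3t -(fr_wv F4).
move: (wlet m4 vV n) m5k m5t => m5 m5k m5t.
rewrite exec_seq; set m6 := exec n (WLet _ _) m5.
have m6k : wv m6 vKEPT = size (kept m n) by rewrite -m5k.
have m6t : wv m6 vT = (D * (D * (d + 1)))%N by rewrite -m5t.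
have m6r : wv m6 vREJ = 0%N by [].
clearbody m6; rewrite exec_if [tev _ _]/= m6k m6t ltnNge.
by case: leqP => _ /=; rewrite ?m6r ?m6k.
Qed.

Definition emitted m m' (L : seq (nat * nat)) : Prop :=
  wv m' vOUT = size L /\ forall a, (a < size L)%N ->
    let p := nth (0, 0)%N L a in
    wa m' aOFLAG a = wa m aFLAG (p.1 * n + p.2) /\
    za m' aOVAL a = za m aVAL (p.1 * n + p.2).

Lemma emit_ok m : ready m ->
  emitted m (exec n emit m) [seq (a, b) | a <- kept m n, b <- kept m n].
Proof.
move=> mr; rewrite /emit exec_seq.
set m0 := exec n (WLet _ _) m.
have m0r : ready m0 by exact: ready_wlet.
have m0o : wv m0 vOUT = 0%N by [].
have m0a : wa m0 = wa m by [].
have m0z : za m0 = za m by [].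
clearbody m0.
set c := If (TEq (WArr aBIN (WVar vI)) _) _ _.
have [||m1 [I1 _ ->]] := @for_ind R n (fun l m1 =>
    emitted m m1 [seq (a, b) | a <- kept m l, b <- kept m n]) vI c m0.
- move=> l m1 ln F J; rewrite keptS allpairs_cat.
  have m1r : ready (wlet m1 vI l) by apply: ready_wlet => //; exact: ready_frame F isT m0r.
  have m1b : wa (wlet m1 vI l) aBIN = wa m aBIN by rewrite -m0a -(fr_wa F).
  have m1f : wa (wlet m1 vI l) aFLAG = wa m aFLAG by rewrite -m0a -(fr_wa F).
  have m1v : za (wlet m1 vI l) aVAL = za m aVAL by rewrite -m0z -(fr_za F).
  have m1i : wv (wlet m1 vI l) vI = l by [].
  have {}J : emitted m (wlet m1 vI l) [seq (a, b) | a <- kept m l, b <- kept m n] by [].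
  have T : tev (wlet m1 vI l) (TEq (WArr aBIN (WVar vI)) (WNum 0)) = (wa m aBIN l == 0%N).
    by rewrite -m1b.
  rewrite /c exec_if T; case: (_ == _); first by rewrite cats0.
  move: (wlet m1 vI l) m1r m1b m1f m1v m1i J => m2 m2r m2b m2f m2v m2i J.
  rewrite allpairs1l; set c2 := If (TEq (WArr aBIN (WVar vJ)) _) _ _.
  have [||m3 [I3 _ E]] := @for_ind R n (fun b m3 =>
    emitted m m3 ([seq (a, b) | a <- kept m l, b <- kept m n] ++
                  [seq (l, a) | a <- kept m b])) vJ c2 m2.
  + move=> b m3 bn F3 [Jo Ja]; rewrite keptS map_cat catA.
    set L := _ ++ map _ _ in Jo Ja *.
    have m3i : wv m3 vI = l by rewrite (fr_wv F3).
    have m3b : wa m3 aBIN = wa m aBIN by rewrite (fr_wa F3) // m2b.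
    have m3f : wa m3 aFLAG = wa m aFLAG by rewrite (fr_wa F3) // m2f.
    have m3v : za m3 aVAL = za m aVAL by rewrite (fr_za F3) // m2v.
    have m3r : wa m3 aROW l = (l * n)%N by rewrite (fr_wa F3) // (ready_row m2r ln).
    have T3 : tev (wlet m3 vJ b) (TEq (WArr aBIN (WVar vJ)) (WNum 0)) = (wa m aBIN b == 0%N).
      by rewrite -m3b.
    rewrite /c2 exec_if T3; case: (_ == _); first by rewrite cats0.
    rewrite /emitted /= /upd /= size_cat /= Jo; split=> // a.
    rewrite addn1 ltnS leq_eqVlt m3i m3r m3f m3v nth_cat => /orP[/eqP ->|aL].
      by rewrite eqxx ltnn subnn.
    by rewrite (ltn_eqF aL) aL; exact: Ja.
  + by rewrite cats0.
  by rewrite E.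
- by [].
exact: I1.
Qed.

End Output.

Lemma kernelize_spec (R : realType) n d (M : 'M[option R]_n) (m : store R) :
  partial_matrix M -> wv m vN = n -> wv m vDIM = d ->
  (forall i j : 'I_n, wa m aFLAG (i * n + j) = isSome (M i j)) ->
  (forall i j : 'I_n, za m aVAL (i * n + j) = val0 M i j) ->
  let m' := exec n kernelize m in let K := kept m' n in
  [/\ wv m' vREJ != 0%N -> ~ EDMC M d,
      wv m' vREJ = 0%N -> forall Delta, unspecified_le M Delta ->
        (size K <= (d + 1) * (Delta + 1) ^ 2)%N,
      forall k (f : 'I_k -> 'I_n), (forall i : 'I_n, (i : nat) \in K -> exists a, f a = i) ->
        (EDMC (mxsub f f M) d <-> EDMC M d),
      wv m' vKEPT = size K &
      emitted n m m' [seq (a, b) | a <- K, b <- K]].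
Proof.
move=> pM mn md mf mv; cbv zeta; rewrite /kernelize exec_seq.
have F1 := exec_frame n rows m; have Row := rows_ok mn.
have m1r : ready d M (exec n rows m).
  split=> //; rewrite ?(fr_wv F1) //.
  - by move=> i j; rewrite (fr_wa F1).
  - by move=> i j; rewrite (fr_za F1).
have m1f : wa (exec n rows m) aFLAG = wa m aFLAG by rewrite (fr_wa F1).
have m1v : za (exec n rows m) aVAL = za m aVAL by rewrite (fr_za F1).
move: (exec n rows m) m1r m1f m1v => m1 m1r m1f m1v; rewrite exec_seq {F1 Row}.
have [uM minD] := degree_ok m1r.
have F2 := exec_frame n degree m1; have m2r := ready_frame F2 isT m1r.
move: (exec n degree m1) F2 m2r uM minD => m2 F2 m2r uM minD; rewrite exec_seq.
(* The diagonal entry of a row is specified, so [n - 1] is an admissible [Delta]. *)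
have Dn : (0 < n -> wv m2 vDEG < n)%N.
  move=> n0; rewrite -(prednK n0) ltnS; apply: minD => i.
  rewrite -ltnS (prednK n0) -[X in (_ < X)%N]card_ord -cardsT proper_card // properT.
  apply/eqP => /setP/(_ i); case: pM => _ dM _; by rewrite !inE dM.
have [colD colM] := colour_ok pM m2r uM Dn.
have F3 := exec_frame n colour m2; have m3r := ready_frame F3 isT m2r.
have m3d : wv (exec n colour m2) vDEG = wv m2 vDEG by rewrite (fr_wv F3).
rewrite -m3d in uM minD Dn colD.
move: (exec n colour m2) F3 m3r uM minD Dn colD colM {m3d} => m3 F3 m3r uM minD Dn colD colM.
rewrite exec_seq.
have pl := distribute_ok m3r Dn colM.
have F4 := exec_frame n distribute m3; have m4r := ready_frame F4 isT m3r.
have m4d : wv (exec n distribute m3) vDEG = wv m3 vDEG by rewrite (fr_wv F4).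
have m4c : colf (exec n distribute m3) = colf m3 :> ('I_n -> nat) by rewrite /colf (fr_wa F4).
rewrite -m4d in uM minD Dn colD; rewrite -m4c in colD colM.
move: (exec n distribute m3) F4 m4r uM minD Dn colD colM pl {m4d m4c} =>
  m4 F4 m4r uM minD Dn colD colM pl.
rewrite exec_seq.
have [C1 C2] := count_kept_ok m4r.
have F5 := exec_frame n count_kept m4; have m5r := ready_frame F5 isT m4r.
have K5 : kept (exec n count_kept m4) n = kept m4 n by rewrite /kept (fr_wa F5).
move: (exec n count_kept m4) F5 m5r C1 C2 K5 => m5 F5 m5r C1 C2 K5.
have Em := emit_ok m5r; rewrite K5 in Em.
have F6 := exec_frame n emit m5.
have K6 : kept (exec n emit m5) n = kept m4 n by rewrite -K5 /kept (fr_wa F6).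
rewrite K6 (fr_wv F6) // (fr_wv F6) //.
have minD' Delta : unspecified_le M Delta ->
    (minn n (wv m4 vDEG).+1 <= Delta + 1)%N.
  by move=> /minD; lia.
split.
- rewrite C1 -ltnNge size_kept => big eM.
  have := placing_full colD pl eM; rewrite leqNgt => /negP; apply.
  (* For [n = 0] nothing is kept, so the threshold cannot be exceeded; otherwise [Dn] removes the
     minimum with [n]. *)
  have [n0|n0] := posnP n.
    by have := leq_trans big (max_card _); rewrite card_ord; lia.
  apply: leq_trans big; rewrite (minn_idPr (Dn n0)) !addn1 ltnS -mulnn; nia.
- move=> r0 Delta uD; move: C1; rewrite r0 eqxx => /esym sz.
  apply: (leq_trans sz); have H := minD' _ uD.
  rewrite mulnA mulnC -mulnn; apply: leq_mul => //; exact: leq_mul.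
- move=> k f Hf; apply: (placing_sound pM uM colM pl) => i bi.
  by apply: Hf; rewrite mem_filter mem_iota add0n ltn_ord !andbT.
- exact: C2.
case: Em => Eo Ea; split=> // a aL; have [] := Ea a aL.
by rewrite (fr_wa F5) // (fr_wa F4) // (fr_wa F3) // (fr_wa F2) // m1f
  (fr_za F5) // (fr_za F4) // (fr_za F3) // (fr_za F2) // m1v.
Qed.

(** * Loading the instance and writing the kernel *)

Definition runs (R : realType) (P : program) (T : nat) (Q : state R -> Prop)
    (s : state R) : Prop :=
  exists t s', [/\ (t <= T)%N, reaches P t s s' & Q s'].

Lemma runs_trans (R : realType) P T1 T2 (Q1 Q2 : state R -> Prop) s :
  runs P T1 Q1 s -> (forall s1, Q1 s1 -> runs P T2 Q2 s1) -> runs P (T1 + T2) Q2 s.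
Proof.
move=> [t1 [s1 [T1' r1 /[swap] /[apply]]]] [t2 [s2 [T2' r2 Q]]].
exists (t1 + t2)%N, s2; split=> //; first by rewrite leq_add.
exact: reaches_trans r1 r2.
Qed.

Lemma runs_steps (R : realType) P c l (Q : state R -> Prop) s :
  code_at P l c -> pc s = l -> all basic c ->
  (pc (steps c s) = l + size c -> Q (steps c s))%N -> runs P (size c) Q s.
Proof.
move=> Pc ps bc HQ; exists (size c), (steps c s); split=> //.
  by apply: reaches_steps; rewrite ?ps.
by apply: HQ; rewrite pc_steps ?ps.
Qed.

Lemma runs_loop (R : realType) P l x b one body (I : nat -> state R -> Prop) N :
  code_at P l (loop_code l x b one body) -> all basic body ->
  x != one -> b != one -> x != b ->
  (forall k s s', (forall y, y != x -> y != one -> word s' y = word s y) ->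
     real s' =1 real s -> I k s -> I k s') ->
  (forall k s, (k < N)%N -> I k s -> word s x = k -> word s b = N ->
     let s' := steps body s in [/\ I k.+1 s', word s' x = k & word s' b = N]) ->
  forall k0 s, I k0 s -> pc s = l -> word s x = k0 -> word s b = N ->
  runs P (N * (size body + 4) + 2) (fun s' =>
    I (maxn k0 N) s' /\ pc s' = (l + size (loop_code l x b one body))%N) s.
Proof.
move=> Pl bb xo bo xb Iext body_ok k0 s Ik ps sx sb.
have body_reaches k s0 : (k < N)%N -> I k s0 -> word s0 x = k -> word s0 b = N ->
   pc s0 = (l + 2)%N ->
   exists t s', [/\ (t <= size body)%N, reaches P t s0 s', I k.+1 s' &
     [/\ pc s' = (l + 2 + size body)%N, word s' x = k & word s' b = N]].
  move=> kN I0 x0 b0 p0; exists (size body), (steps body s0).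
  have [I1 x1 b1] := body_ok k s0 kN I0 x0 b0.
  split=> //; last by split; rewrite ?pc_steps ?p0.
  apply: reaches_steps => //; rewrite p0.
  by move: Pl => /code_at_cat[_ /code_at_cat[]].
have [t [s' [tT r I' [p' _ _]]]] :=
  loop_reaches Pl xo bo xb Iext body_reaches Ik ps sx sb.
exists t, s'; split=> //.
  by apply: leq_trans tT _; rewrite leq_add2r leq_mul2r leq_subr orbT.
by split=> //; rewrite p' !size_cat /=; lia.
Qed.

(** Horner's scheme in base 2: the flags in words 2 to 8 become the seven binary digits of word 2,
    its own flag being the leading one. *)
Definition pack : seq instr :=
  flatten [seq [:: WAdd 2 2 2; WAdd 2 2 j] | j <- iota 3 6].

Fixpoint packed (bs : seq nat) : nat :=
  if bs is b :: bs' then b * 2 ^ size bs' + packed bs' else 0.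

(* The bit of weight [2 ^ k] of a number below [2 ^ (k + 1)], by truncated
   subtraction; it becomes cell [i] of array 0. *)
Definition top_bit (k i : nat) : seq instr :=
  [:: WConst 5 (2 ^ k - 1); WSub 5 2 5; WConst 6 1; WSub 5 6 5; WSub 5 6 5;
      WConst 6 (8 * i); WAdd 6 6 8; WStore 6 5].

Definition unpack1 (k i : nat) : seq instr :=
  top_bit k i ++ nseq k (WAdd 5 5 5) ++ [:: WSub 2 2 5].

Fixpoint unpack (k i : nat) : seq instr :=
  if k is k'.+1 then unpack1 k' i ++ unpack k' i.+1 else [::].

Lemma basic_unpack k i : all basic (unpack k i).
Proof.
elim: k i => //= k IH i; rewrite !all_cat all_nseq /= IH.
by rewrite orbT.
Qed.

Lemma steps_double (R : realType) k (s : state R) :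
  let s' := steps (nseq k (WAdd 5 5 5)) s in
  [/\ word s' 5 = (word s 5 * 2 ^ k)%N, real s' = real s &
      forall y, y != 5 -> word s' y = word s y].
Proof.
elim: k s => [|k IH] s; first by rewrite muln1.
have [H1 H2 H3] := IH (step (WAdd 5 5 5) s).
split=> [|//|y y5]; first by rewrite [LHS]H1 /= expnS; lia.
by rewrite [LHS]H3 //= (negbTE y5).
Qed.

Lemma unpack_ok (R : realType) B bs i (s : state R) :
  (9 <= B)%N -> all (fun b => b <= 1)%N bs -> word s 2 = packed bs -> word s 8 = B ->
  let s' := steps (unpack (size bs) i) s in
  [/\ real s' = real s, word s' 8 = B,
      forall y, (forall j, (j < size bs)%N -> y != (B + 8 * (i + j))%N) ->
        y \notin [:: 2; 5; 6]%N -> word s' y = word s y &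
      forall j, (j < size bs)%N -> word s' (B + 8 * (i + j)) = nth 0%N bs j].
Proof.
move=> B9; elim: bs i s => [|b bs IH] i s //; rewrite [all _ _]/= => /andP[b1 bs1] s2 s8.
have lt_packed : (packed bs < 2 ^ size bs)%N.
  elim: bs bs1 {IH s2} => //= c bs IH /andP[c1 /IH H]; rewrite expnS; nia.
have -> : unpack (size (b :: bs)) i = unpack1 (size bs) i ++ unpack (size bs) i.+1 by [].
cbv zeta.
rewrite steps_cat /unpack1 !steps_cat.
rewrite [packed _]/= in s2; set k := size bs in s2 lt_packed *.
set s1 := steps (top_bit k i) s.
have s15 : word s1 5 = b.
  rewrite /= s8 s2 (_ : (5 == _ + B)%N = false); last by lia.
  have : (b = 0 \/ b = 1)%N by lia.
  by case=> ->; lia.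
have s12 : word s1 2 = packed (b :: bs).
  by rewrite /= s8 s2 (_ : (2 == _ + B)%N = false) //; lia.
have s18 : word s1 8 = B.
  by rewrite /= s8 (_ : (8 == _ + B)%N = false) //; lia.
have s1c : word s1 (B + 8 * i) = b.
  rewrite -s15 /= s8 [(8 * i + B)%N]addnC eqxx (_ : (5 == B + _)%N = false) //; lia.
have s1y y : y != (B + 8 * i)%N -> y \notin [:: 2; 5; 6]%N -> word s1 y = word s y.
  rewrite !inE !negb_or => yB /and3P[y2 y5 y6].
  by rewrite /= s8 [(8 * i + B)%N]addnC (negbTE yB) (negbTE y5) (negbTE y6).
have s1r : real s1 = real s by [].
clearbody s1; have [D1 D2 D3] := steps_double k s1.
set s2' := steps (nseq _ _) s1 in D1 D2 D3 *; clearbody s2'.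
set s3 := steps [:: WSub 2 2 5] s2'.
have s32 : word s3 2 = packed bs.
  by rewrite /= D3 // D1 s12 s15 /= addKn.
have s38 : word s3 8 = B by rewrite /= D3.
have s3y y : y \notin [:: 2; 5; 6]%N -> word s3 y = word s1 y.
  rewrite !inE !negb_or => /and3P[y2 y5 _].
  by rewrite /= (negbTE y2) D3.
have s3r : real s3 = real s by rewrite /= D2.
clearbody s3; have [I1 I2 I3 I4] := IH i.+1 s3 bs1 s32 s38.
have big j : (B + 8 * j)%N \notin [:: 2; 5; 6]%N by rewrite !inE; lia.
split=> //.
- by rewrite I1.
- move=> y yB y256; rewrite I3 // => [|j jk]; last first.
    by have := yB j.+1 jk; rewrite addnS.
  by rewrite s3y // s1y //; have := yB 0%N isT; rewrite addn0.
- case=> [|j] jk /=; last by rewrite -addSnnS I4.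
  rewrite addn0 I3 ?big // ?s3y ?big // => j jk'.
  by lia.
Qed.

Definition load_prefix : seq instr := pack ++ [:: WConst 3 0; WConst 4 0].
Definition square_body (b : nat) : seq instr := [:: WAdd 3 3 b].
(** The base [64 + n * n] lies above the registers and above the raw input, so filling the arrays
    does not destroy input still to be read. *)
Definition load_middle : seq instr := [:: WConst 8 64; WAdd 8 8 3; WConst 4 0].
Definition load_body : seq instr :=
  [:: WAdd 5 4 4; WAdd 5 5 5; WAdd 5 5 5; WAdd 5 5 8; WConst 6 2; WAdd 6 6 4;
      WLoad 6 6; WStore 5 6; ZLoad 0 4; ZStore 5 0].
Definition load_suffix : seq instr := unpack 7 0 ++ [:: WCopy 2 8].

(* The low words hold flags of the input, so there are no free registers at the
   start: the bits in the words 2 to 8 are first packed into word 2. *)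
Definition load : seq instr :=
  let c1 := load_prefix in
  let c2 := c1 ++ loop_code (size c1) 4 0 7 (square_body 0) in
  let c3 := c2 ++ load_middle in
  let c4 := c3 ++ loop_code (size c3) 4 3 7 load_body in
  c4 ++ load_suffix.

Lemma square_ok (R : realType) P l b N (s : state R) :
  code_at P l (loop_code l 4 b 7 (square_body b)) ->
  b \notin [:: 3; 4; 7]%N -> pc s = l -> word s 3 = 0%N -> word s 4 = 0%N ->
  word s b = N ->
  runs P (N * 5 + 2) (fun s' => [/\ pc s' = (l + 6)%N, word s' 3 = (N * N)%N,
     real s' =1 real s &
     forall y, y \notin [:: 3; 4; 7]%N -> word s' y = word s y]) s.
Proof.
rewrite !inE !negb_or => Pl /and3P[b3 b4 b7] ps s3 s4 sb.
pose I k s' := [/\ word s' 3 = (k * N)%N, real s' =1 real s &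
  forall y, y \notin [:: 3; 4; 7]%N -> word s' y = word s y].
have Iext k s1 s2 : (forall y, y != 4%N -> y != 7%N -> word s2 y = word s1 y) ->
    real s2 =1 real s1 -> I k s1 -> I k s2.
  move=> Hw Hr [H1 H2 H3]; split.
  - by rewrite Hw.
  - by move=> y; rewrite Hr.
  - by move=> y y3; rewrite Hw ?H3 //; move: y3; rewrite !inE !negb_or => /and3P[].
have body k s1 : (k < N)%N -> I k s1 -> word s1 4 = k -> word s1 b = N ->
    let s' := steps (square_body b) s1 in [/\ I k.+1 s', word s' 4 = k & word s' b = N].
  move=> kN [H1 H2 H3] s14 s1b; split=> //=; last by rewrite (negbTE b3).
  split=> //=; first by rewrite H1 s1b mulSn addnC.
  move=> y y3; have := y3; rewrite !inE !negb_or => /and3P[/negbTE y3' _ _].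
  by rewrite y3' H3.
have [||t [s' [tT r [[H1 H2 H3] p']]]] := runs_loop Pl isT isT b7 _ Iext body _ ps s4 sb.
- by rewrite eq_sym.
- by split=> //; rewrite s3.
by rewrite max0n in H1; exists t, s'; split.
Qed.

Section Load.
Variables (R : realType) (n d : nat) (fl : seq nat) (vals : seq R).
Hypothesis size_fl : size fl = (n * n)%N.
Hypothesis bits_fl : all (fun b => b <= 1)%N fl.
Hypothesis vals0 : nth 0 vals 0 = 0.

Let B := (64 + n * n)%N.
Let W0 := nth 0%N (n :: d :: fl).
Let bits := [seq nth 0%N fl i | i <- iota 0 7].

Let bits_ok : all (fun b => b <= 1)%N bits.
Proof.
apply/allP => b /mapP[i _ ->]; have [lt|ge] := ltnP i (size fl).
  by move/allP: bits_fl; apply; exact: mem_nth.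
by rewrite nth_default.
Qed.

Let pack_ok (s : state R) : word s =1 W0 ->
  [/\ word (steps pack s) 2 = packed bits, real (steps pack s) = real s &
      forall y, y != 2 -> word (steps pack s) y = W0 y].
Proof.
move=> sW; split=> //.
  by rewrite /= !sW /W0 /=; lia.
by move=> y /negbTE y2; rewrite /= y2 sW.
Qed.

Lemma load_ok P : code_at P 0 load ->
  runs P (size load_prefix + (n * 5 + 2) + (3 + (n * n * 14 + 2)) + size load_suffix)
    (fun s => [/\ pc s = size load, [/\ word s 0 = n, word s 1 = d & word s 2 = B] &
       forall a, (a < n * n)%N -> word s (B + 8 * a) = nth 0%N fl a /\
                                  real s (B + 8 * a) = nth 0 vals a])
    (start (n :: d :: fl, vals)).
Proof.
rewrite /load; set c1 := load_prefix; set l2 := loop_code (size c1) _ _ _ _.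
set c3 := (c1 ++ l2) ++ load_middle; set l4 := loop_code (size c3) _ _ _ _.
move=> /code_at_cat[/code_at_cat[P3 P4] P5].
have [/code_at_cat[P1 P2] Pm] := code_at_cat P3.
rewrite !add0n in P2 P4 P5 Pm.
set s0 := start _.
have s0W : word s0 =1 W0 by [].
have [A1 A2 A3] := pack_ok s0W.
pose Q1 (s : state R) := [/\ pc s = size c1, [/\ word s 2 = packed bits, word s 3 = 0%N &
  word s 4 = 0%N], (forall y, y \notin [:: 2; 3; 4]%N -> word s y = W0 y) &
  real s =1 nth 0 vals].
have R1 : runs P (size load_prefix) Q1 s0.
  apply: (@runs_steps R P load_prefix 0 Q1 s0 P1 erefl isT) => ps.
  rewrite /Q1 ps /load_prefix steps_cat; move: (steps pack s0) A1 A2 A3 => s1 A1 A2 A3.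
  split=> //; last by move=> y; rewrite /= A2.
  move=> y; rewrite !inE !negb_or => /and3P[y2 /negbTE y3 /negbTE y4].
  by rewrite /= y3 y4 A3.
pose Q2 (s : state R) := [/\ pc s = size (c1 ++ l2), word s 2 = packed bits,
  word s 3 = (n * n)%N, (forall y, y \notin [:: 2; 3; 4; 7]%N -> word s y = W0 y) &
  real s =1 nth 0 vals].
have R2 s : Q1 s -> runs P (n * 5 + 2) Q2 s.
  case=> ps [s2 s3 s4] sy sr.
  have s0n : word s 0 = n by rewrite sy.
  have [t [s' [tT r [p' s'3 s'r s'y]]]] := square_ok P2 isT ps s3 s4 s0n.
  exists t, s'; split=> //; split=> //.
  - by rewrite s'y.
  - move=> y; rewrite !inE !negb_or => /and4P[y2 y3 y4 y7].
    by rewrite s'y ?sy // !inE !negb_or ?y2 y3 y4.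
  - by move=> y; rewrite s'r.
pose Q3 (s : state R) := [/\ pc s = size c3, word s 2 = packed bits,
  [/\ word s 3 = (n * n)%N, word s 4 = 0%N & word s 8 = B],
  (forall y, y \notin [:: 2; 3; 4; 7; 8]%N -> word s y = W0 y) & real s =1 nth 0 vals].
have R3 s : Q2 s -> runs P 3 Q3 s.
  case=> ps s2 s3 sy sr; apply: (@runs_steps R P load_middle _ Q3 s Pm ps isT) => p'.
  split.
  - by rewrite p' /c3 [RHS]size_cat.
  - exact: s2.
  - by split; rewrite /= ?s3.
  - move=> y; rewrite !inE !negb_or => /and5P[y2 y3 y4 y7 /negbTE y8].
    by rewrite /= y8 (negbTE y4) sy // !inE !negb_or y2 y3 y4.
  - exact: sr.
(* Words below 9 serve as registers by now, so only the flags from 7 on are claimed; the first seven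
   come from the packed word afterwards. Real 0 is the scratch cell, so its content is known only
   before the first round, where it is a diagonal entry or the default 0. *)
pose I a (s : state R) := [/\
  [/\ word s 0 = n, word s 1 = d, word s 2 = packed bits & word s 8 = B],
  (forall y, (9 <= y < B)%N -> word s y = W0 y),
  (forall i, (7 <= i < a)%N -> word s (B + 8 * i) = nth 0%N fl i) &
  [/\ forall y, (1 <= y < B)%N -> real s y = nth 0 vals y,
      forall i, (i < a)%N -> real s (B + 8 * i) = nth 0 vals i &
      a = 0%N -> real s 0 = 0]].
have R4 s : Q3 s -> runs P (n * n * 14 + 2)
    (fun s => I (n * n)%N s /\ pc s = size (c3 ++ l4)) s.
  case=> ps s2 [s3 s4 s8] sy sr.
  have I0 : I 0%N s.
    split.
    - by split=> //; rewrite sy.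
    - by move=> y y9; rewrite sy // !inE; lia.
    - by move=> i; rewrite ltn0 andbF.
    - by split=> [y _|//|_]; rewrite sr.
  have [t [s' [tT r [I' p']]]] : runs P (n * n * (size load_body + 4) + 2) (fun s' =>
     I (maxn 0 (n * n)) s' /\ pc s' = (size c3 + size l4)%N) s.
    apply: (runs_loop P4 _ _ _ _ _ _ I0 ps s4 s3) => // [k s1 s1' Hw Hr|k s1 kN].
      case=> [[H0 H1 H2 H8] Hy Hi [Zy Zi Z0]]; split.
      + by split; rewrite Hw.
      + by move=> y yB; rewrite Hw ?Hy //; lia.
      + by move=> i ik; rewrite Hw ?Hi //; lia.
      + by split=> [y yB|i ik|k0]; rewrite Hr; [exact: Zy|exact: Zi|exact: Z0].
    case=> [[H0 H1 H2 H8] Hy Hi [Zy Zi Z0]] s1k s13.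
    set s1' := steps load_body s1.
    have E : (k + k + (k + k) + (k + k + (k + k)) + B = B + 8 * k)%N by lia.
    have W' y : y != (B + 8 * k)%N -> y != 5 -> y != 6 -> word s1' y = word s1 y.
      by move=> /negbTE yB /negbTE y5 /negbTE y6; rewrite /= s1k H8 E yB y6 y5.
    have W7 : (7 <= k)%N -> word s1' (B + 8 * k) = word s1 (2 + k).
      move=> k7; have K6 : (2 + k == 6)%N = false by clear -k7; lia.
      have K5 : (2 + k == 5)%N = false by clear -k7; lia.
      by rewrite /= s1k H8 E eqxx K6 K5.
    have Z' y : y != (B + 8 * k)%N -> y != 0%N -> real s1' y = real s1 y.
      by move=> /negbTE yB /negbTE y0; rewrite /= s1k H8 E yB y0.
    have Z7 : real s1' (B + 8 * k) = real s1 k by rewrite /= s1k H8 E eqxx.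
    clearbody s1'; split; last 2 first.
    - by rewrite W' //; lia.
    - by rewrite W' //; lia.
    split.
    - by split; rewrite W' //; lia.
    - by move=> y yB; rewrite W' ?Hy //; lia.
    - move=> i /andP[i7]; rewrite ltnS leq_eqVlt => /orP[/eqP ik|ik].
        rewrite ik in i7 *; rewrite W7 // Hy //; lia.
      by rewrite W' ?Hi ?i7 //; lia.
    - split=> // [y yB|i].
        by rewrite Z' ?Zy //; lia.
      rewrite ltnS leq_eqVlt => /orP[/eqP ->|ik].
        rewrite Z7; have [k0|k0] := posnP k; last by rewrite Zy //; lia.
        by rewrite {1}k0 (Z0 k0) k0.
      by rewrite Z' ?Zi //; lia.
  exists t, s'; split=> //; rewrite max0n in I'; split; first by case: I'.
  by rewrite p' size_cat.
apply: (@runs_trans _ _ _ _ (fun s => I (n * n)%N s /\ pc s = size (c3 ++ l4))).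
  apply: (@runs_trans _ _ _ _ Q2); first exact: (runs_trans R1 R2).
  by move=> s /R3; move/runs_trans; apply.
move=> s [[[H0 H1 H2 H8] Hy Hi [Zy Zi _]] p].
apply: (runs_steps P5 p); first by rewrite all_cat basic_unpack.
rewrite -[X in X = _ -> _]/(pc (steps load_suffix s)) => p'.
have B9 : (9 <= B)%N by [].
have [U1 U2 U3 U4] := unpack_ok 0 B9 bits_ok H2 H8.
rewrite p' /load_suffix steps_cat [size bits]/= in U1 U2 U3 U4 *.
move: (steps (unpack 7 0) s) U1 U2 U3 U4 => s1 U1 U2 U3 U4.
have U0 y : (y < B)%N -> y \notin [:: 2; 5; 6]%N -> word s1 y = word s y.
  by move=> yB y256; apply: U3 => // j j7; lia.
split.
- by rewrite [RHS]size_cat.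
- by split; rewrite /= ?U0.
move=> a an; rewrite /= U1; split; last exact: Zi.
have [a7|a7] := ltnP a 7.
  by have := U4 a a7; rewrite add0n => ->; rewrite (nth_map 0%N) ?size_iota // nth_iota.
by rewrite U3 ?Hi ?a7 ?an // => j j7; lia.
Qed.

End Load.

(** Every round passes its value through real 0, so the entry that belongs there is written only
    after the loop, by [finish_reals]. *)
Definition copy_reals : seq instr :=
  [:: WAdd 5 4 4; WAdd 5 5 5; WAdd 5 5 5; WAdd 5 5 2; WConst 6 5; WAdd 5 5 6;
      ZLoad 0 5; ZStore 4 0].
Definition copy_words : seq instr :=
  [:: WAdd 5 4 4; WAdd 5 5 5; WAdd 5 5 5; WAdd 5 5 2; WConst 6 4; WAdd 5 5 6;
      WLoad 6 5; WConst 5 2; WAdd 5 5 4; WStore 5 6].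

(* Every low word is first set to the address of its final contents, relative to
   word 0, and then loads itself. *)
Definition low_addresses (js : seq nat) : seq instr :=
  flatten [seq [:: WConst j (8 * (j - 2) + 4); WAdd j j 0] | j <- js].
Definition low_loads (js : seq nat) : seq instr := [seq WLoad j j | j <- js].

Definition finish_middle : seq instr := [:: WConst 4 0].
(** The word counter then starts at 20: flags 0 to 19 belong in words 2 to 21, which contain all
    registers still in use, up to word 15 with the kernel size, and are written last. *)
Definition finish_reals : seq instr :=
  [:: WCopy 5 2; WConst 6 5; WAdd 5 5 6; ZLoad 0 5; WConst 4 20].
(** The kernel size is parked in the cell at the base address, which holds a flag that is no longer
    read. Word 0 keeps the base while the low words are overwritten, word 2 among them, and finally
    fetches the size from that cell. *)
Definition low_words (js : seq nat) : seq instr :=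
  [:: WStore 2 15; WCopy 0 2] ++ low_addresses js ++ low_loads js ++ [:: WLoad 0 0].
Definition finish_words : seq instr := low_words (iota 2 20).

Definition finish (l : nat) : seq instr :=
  let c1 := [:: WConst 3 0; WConst 4 0] in
  let c2 := c1 ++ loop_code (l + size c1) 4 15 7 (square_body 15) in
  let c3 := c2 ++ finish_middle in
  let c4 := c3 ++ loop_code (l + size c3) 4 3 7 copy_reals in
  let c5 := c4 ++ finish_reals in
  let c6 := c5 ++ loop_code (l + size c5) 4 3 7 copy_words in
  c6 ++ finish_words.

Lemma steps_low_addresses (R : realType) (js : seq nat) (s : state R) :
  0%N \notin js -> uniq js ->
  let s' := steps (low_addresses js) s in
  [/\ real s' = real s, forall y, y \notin js -> word s' y = word s y &
      forall j, j \in js -> word s' j = (word s 0 + 8 * (j - 2) + 4)%N].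
Proof.
elim: js s => [|j js IH] s; first by split.
rewrite inE negb_or => /andP[j0 js0] /andP[jjs ujs].
pose s1 := steps [:: WConst j (8 * (j - 2) + 4); WAdd j j 0] s.
have [I1 I2 I3] := IH s1 js0 ujs.
have s1y y : y != j -> word s1 y = word s y by move=> /negbTE yj; rewrite /= yj.
have s1j : word s1 j = (word s 0 + 8 * (j - 2) + 4)%N.
  by rewrite /= !eqxx (negbTE j0); lia.
have E : steps (low_addresses (j :: js)) s = steps (low_addresses js) s1 by [].
have s1r : real s1 = real s by [].
cbv zeta; rewrite E; clearbody s1; split.
- by rewrite I1.
- by move=> y; rewrite inE negb_or => /andP[yj yjs]; rewrite I2 ?s1y.
- move=> i; rewrite inE => /orP[/eqP ->|ijs]; first by rewrite I2.
  by rewrite I3 // s1y // eq_sym.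
Qed.

Lemma steps_low_loads (R : realType) (js : seq nat) (s : state R) :
  uniq js -> (forall j, j \in js -> word s j \notin js) ->
  let s' := steps (low_loads js) s in
  [/\ real s' = real s, forall y, y \notin js -> word s' y = word s y &
      forall j, j \in js -> word s' j = word s (word s j)].
Proof.
elim: js s => [|j js IH] s; first by split.
move=> /andP[jjs ujs] far.
pose s1 := step (WLoad j j) s.
have s1y y : y != j -> word s1 y = word s y by move=> /negbTE yj; rewrite /= yj.
have s1j : word s1 j = word s (word s j) by rewrite /= eqxx.
have s1r : real s1 = real s by [].
have neq i : i \in js -> i != j by move=> ijs; apply: contraNneq jjs => <-.
have far1 i : i \in js -> word s1 i \notin js.
  move=> ijs; rewrite s1y ?neq //.
  by have := far i; rewrite !inE ijs orbT negb_or => /(_ isT)/andP[].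
have [I1 I2 I3] := IH s1 ujs far1.
have E : steps (low_loads (j :: js)) s = steps (low_loads js) s1 by [].
cbv zeta; rewrite E; clearbody s1; split.
- by rewrite I1.
- by move=> y; rewrite inE negb_or => /andP[yj yjs]; rewrite I2 ?s1y.
- move=> i; rewrite inE => /orP[/eqP ->|ijs]; first by rewrite I2.
  rewrite I3 // (s1y i) ?neq // s1y //.
  by have := far i; rewrite !inE ijs orbT negb_or => /(_ isT)/andP[].
Qed.

Lemma steps_low_words (R : realType) (js : seq nat) B (s : state R) :
  word s 2 = B -> (64 <= B)%N -> uniq js -> (forall j, j \in js -> 2 <= j < 22)%N ->
  let s' := steps (low_words js) s in
  [/\ real s' = real s, word s' 0 = word s 15,
      forall y, y \notin js -> y != 0%N -> y != B -> word s' y = word s y &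
      forall j, j \in js -> word s' j = word s (B + 8 * (j - 2) + 4)].
Proof.
move=> s2B B64 ujs js22; cbv zeta; rewrite /low_words 3!steps_cat.
set s1 := steps [:: WStore 2 15; WCopy 0 2] s.
have s1B : word s1 B = word s 15 by rewrite /= s2B eqxx (_ : (B == 0)%N = false) //; lia.
have s10 : word s1 0 = B by rewrite /= s2B (_ : (2 == B)%N = false) //; lia.
have s1y y : y != 0%N -> y != B -> word s1 y = word s y.
  by move=> /negbTE y0 /negbTE yB; rewrite /= s2B y0 yB.
have s1r : real s1 = real s by [].
clearbody s1.
have out y : ~~ (2 <= y < 22)%N -> y \notin js by apply: contra => /js22.
have [A1 A2 A3] := steps_low_addresses s1 (out 0%N isT) ujs.
set s2 := steps (low_addresses js) s1 in A1 A2 A3 *; clearbody s2.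
(* The recorded addresses are at least [B], beyond all low words, so no load reads a word that
   another load has replaced. *)
have far j : j \in js -> word s2 j \notin js.
  by move=> jj; rewrite A3 // out // s10; lia.
have [L1 L2 L3] := steps_low_loads ujs far.
set s3 := steps (low_loads js) s2 in L1 L2 L3 *; clearbody s3.
have s30 : word s3 0 = B by rewrite L2 ?A2 ?out.
have E y : word (steps [:: WLoad 0 0] s3) y = if y == 0%N then word s3 (word s3 0) else word s3 y.
  by [].
split.
- by rewrite [LHS]L1 A1.
- by rewrite E s30 L2 ?A2 ?s1B ?out //; lia.
- by move=> y yjs y0 yB; rewrite E (negbTE y0) L2 // A2 // s1y.
- move=> j jjs; have j22 := js22 j jjs.
  rewrite E (_ : (j == 0)%N = false); last by lia.
  rewrite L3 // (A3 _ jjs) s10 A2 ?out ?s1y //; lia.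
Qed.

Section Finish.
Variables (R : realType) (d K B : nat) (fo : nat -> nat) (ov : nat -> R).
Hypothesis BK : (64 + K * K <= B)%N.

(** By [BK] the output stays below the base [B], hence never overwrites the arrays from which it is
    copied. *)
Lemma finish_ok P l (s0 : state R) : code_at P l (finish l) -> pc s0 = l ->
  word s0 1 = d -> word s0 2 = B -> word s0 15 = K ->
  (forall i, word s0 (B + 8 * i + 4) = fo i) ->
  (forall i, real s0 (B + 8 * i + 5) = ov i) ->
  runs P (2 + (K * 5 + 2) + 1 + (K * K * 12 + 2) + 5 + (K * K * 14 + 2) +
          size finish_words)
    (fun s => [/\ pc s = (l + size (finish l))%N, word s 0 = K, word s 1 = d &
       forall a, (a < K * K)%N -> word s (2 + a) = fo a /\ real s a = ov a]) s0.
Proof.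
rewrite /finish; set c1 := [:: WConst 3 0; WConst 4 0].
set l2 := loop_code (l + size c1) _ _ _ _.
set c3 := (c1 ++ l2) ++ finish_middle; set l4 := loop_code (l + size c3) _ _ _ _.
set c5 := (c3 ++ l4) ++ finish_reals; set l6 := loop_code (l + size c5) _ _ _ _.
move=> /code_at_cat[/code_at_cat[P5 P6] P7] ps0 s01 s02 s015 s0w s0r.
have [/code_at_cat[P3 P4] Pr] := code_at_cat P5.
have [/code_at_cat[P1 P2] Pm] := code_at_cat P3.
pose Q0 (s : state R) := [/\ [/\ word s 1 = d, word s 2 = B & word s 15 = K],
  (forall i, word s (B + 8 * i + 4) = fo i) &
  (forall i, real s (B + 8 * i + 5) = ov i)].
have Q0ext s s' : (forall y, y \notin [:: 3; 4; 5; 6; 7]%N -> word s' y = word s y) ->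
    real s' =1 real s -> Q0 s -> Q0 s'.
  move=> Hw Hr [[H1 H2 H3] H4 H5]; split.
  - by split; rewrite Hw.
  - by move=> i; rewrite Hw ?H4 // !inE; lia.
  - by move=> i; rewrite Hr H5.
pose Q1 s := [/\ Q0 s, pc s = (l + size c1)%N, word s 3 = 0%N & word s 4 = 0%N].
have R1 : runs P 2 Q1 s0.
  apply: (@runs_steps R P c1 l Q1 s0 P1 ps0 isT) => p1; split=> //.
  apply: (@Q0ext s0) => // y; rewrite !inE !negb_or => /and5P[/negbTE y3 /negbTE y4 _ _ _].
  by rewrite /= y3 y4.
pose Q2 s := [/\ Q0 s, pc s = (l + size (c1 ++ l2))%N & word s 3 = (K * K)%N].
have R2 s : Q1 s -> runs P (K * 5 + 2) Q2 s.
  case=> Qs ps s3 s4; have s15 : word s 15 = K by case: Qs => [[]].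
  have [t [s' [tT r [p' s'3 s'r s'y]]]] := square_ok P2 isT ps s3 s4 s15.
  exists t, s'; split=> //; split=> //; last by rewrite p' size_cat addnA.
  apply: Q0ext Qs => // y; rewrite !inE !negb_or => /and5P[y3 y4 y5 y6 y7].
  by rewrite s'y // !inE !negb_or y3 y4 y7.
pose Q3 s := [/\ Q0 s, pc s = (l + size c3)%N, word s 3 = (K * K)%N & word s 4 = 0%N].
have R3 s : Q2 s -> runs P 1 Q3 s.
  case=> Qs ps s3; apply: (@runs_steps R P finish_middle _ Q3 s Pm ps isT) => p'.
  split=> //; last by rewrite p' /c3 [in RHS]size_cat addnA.
  apply: Q0ext Qs => // y; rewrite !inE !negb_or => /and5P[y3 /negbTE y4 y5 y6 y7].
  by rewrite /= y4.
pose I a (s : state R) := Q0 s /\ forall i, (1 <= i < a)%N -> real s i = ov i.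
pose Q4 s := [/\ I (K * K)%N s, pc s = (l + size (c3 ++ l4))%N & word s 3 = (K * K)%N].
have R4 s : Q3 s -> runs P (K * K * 12 + 2) Q4 s.
  case=> Qs ps s3 s4.
  pose I' a (s : state R) := I a s /\ word s 3 = (K * K)%N.
  have I0 : I' 0%N s by split=> //; split=> // i; rewrite ltn0 andbF.
  have [t [s' [tT r [[I1 I13] p']]]] : runs P (K * K * (size copy_reals + 4) + 2) (fun s' =>
     I' (maxn 0 (K * K)) s' /\ pc s' = (l + size c3 + size l4)%N) s.
    apply: (runs_loop P4 _ _ _ _ _ _ I0 ps s4 s3) => // [k s1 s1' Hw Hr|k s1 kN].
      move=> [[J1 J2] J3]; split; last by rewrite Hw.
      split; last by move=> i ik; rewrite Hr J2.
      apply: Q0ext J1 => // y; rewrite !inE !negb_or => /and5P[y3 y4 y5 y6 y7].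
      by rewrite Hw.
    case=> [[[[H1 H2 H15] Hw Hr] Hi] H3] s1k s13.
    set s1' := steps copy_reals s1.
    have E : (k + k + (k + k) + (k + k + (k + k)) + B + 5 = B + 8 * k + 5)%N by lia.
    have W' y : y != 5 -> y != 6 -> word s1' y = word s1 y.
      by move=> /negbTE y5 /negbTE y6; rewrite /= y6 y5.
    have Zk : real s1' k = ov k by rewrite /= s1k H2 E eqxx Hr.
    have Z' y : y != k -> y != 0%N -> real s1' y = real s1 y.
      by move=> /negbTE yk /negbTE y0; rewrite /= s1k H2 yk y0.
    clearbody s1'; split; last 2 first.
    - by rewrite W'.
    - by rewrite W'.
    split; last by rewrite W'.
    split; last first.
      move=> i /andP[i1]; rewrite ltnS leq_eqVlt => /orP[/eqP -> //|ik].
      by rewrite Z' ?Hi ?i1 //; lia.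
    split; first by split; rewrite W'.
    - by move=> i; rewrite W' ?Hw //; lia.
    - by move=> i; rewrite Z' ?Hr //; lia.
  rewrite max0n in I1.
  by exists t, s'; split=> //; split=> //; rewrite p' size_cat addnA.
pose F (s : state R) := forall i, (i < K * K)%N -> real s i = ov i.
pose Q5 s := [/\ Q0 s, F s, pc s = (l + size c5)%N, word s 3 = (K * K)%N & word s 4 = 20%N].
have R5 s : Q4 s -> runs P 5 Q5 s.
  case=> [[Qs Zs] ps s3]; apply: (@runs_steps R P finish_reals _ Q5 s Pr ps isT) => p'.
  have [[H1 H2 H15] Hw Hr] := Qs.
  have W' y : y \notin [:: 3; 4; 5; 6; 7]%N -> word (steps finish_reals s) y = word s y.
    rewrite !inE !negb_or => /and5P[_ /negbTE y4 /negbTE y5 /negbTE y6 _].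
    by rewrite /= y4 y5 y6.
  have Z0 : real (steps finish_reals s) 0 = ov 0%N.
    by rewrite /= H2; have := Hr 0%N; rewrite muln0 addn0.
  have Z' y : y != 0%N -> real (steps finish_reals s) y = real s y.
    by move=> /negbTE y0; rewrite /= y0.
  have s34 : word (steps finish_reals s) 3 = word s 3 by [].
  have s44 : word (steps finish_reals s) 4 = 20%N by [].
  move: (steps finish_reals s) p' W' Z0 Z' s34 s44 => s1 p' W' Z0 Z' s34 s44.
  split=> //; last 3 first.
  - by move=> [|i] iK //; rewrite Z' // Zs.
  - by rewrite p' /c5 !size_cat !addnA.
  - by rewrite s34.
  split; first by split; rewrite W'.
  - by move=> i; rewrite W' ?Hw // !inE; lia.
  - by move=> i; rewrite Z' ?Hr //; lia.
pose J a (s : state R) := [/\ Q0 s, F s, word s 3 = (K * K)%N, (20 <= a)%N &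
  forall i, (20 <= i < a)%N -> word s (2 + i) = fo i].
pose Q6 s := J (maxn 20 (K * K)) s /\ pc s = (l + size (c5 ++ l6))%N.
have R6 s : Q5 s -> runs P (K * K * 14 + 2) Q6 s.
  case=> Qs Fs ps s3 s4.
  have J0 : J 20%N s by split=> // i; lia.
  have [t [s' [tT r [J1 p']]]] : runs P (K * K * (size copy_words + 4) + 2) (fun s' =>
     J (maxn 20 (K * K)) s' /\ pc s' = (l + size c5 + size l6)%N) s.
    apply: (runs_loop P6 _ _ _ _ _ _ J0 ps s4 s3) => // [k s1 s1' Hw Hr|k s1 kN].
      move=> [J1 J2 J3 k20 J4]; split=> //.
      + apply: Q0ext J1 => // y; rewrite !inE !negb_or => /and5P[y3 y4 y5 y6 y7].
        by rewrite Hw.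
      + by move=> i iK; rewrite Hr J2.
      + by rewrite Hw.
      + by move=> i ik; rewrite Hw ?J4 //; lia.
    case=> [[[H1 H2 H15] Hw Hr] Fs1 H3 k20 Hi] s1k s13.
    set s1' := steps copy_words s1.
    have E : (k + k + (k + k) + (k + k + (k + k)) + B + 4 = B + 8 * k + 4)%N by lia.
    have W' y : y != 5 -> y != 6 -> y != (2 + k)%N -> word s1' y = word s1 y.
      by move=> /negbTE y5 /negbTE y6 /negbTE yk; rewrite /= s1k yk y6 y5.
    have E6 : (B + 8 * k + 4 == 6)%N = false by lia.
    have E5 : (B + 8 * k + 4 == 5)%N = false by lia.
    have Wk : word s1' (2 + k) = fo k.
      by rewrite /= s1k H2 E eqxx E6 E5 Hw.
    have Z' : real s1' = real s1 by [].
    clearbody s1'; split; last 2 first.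
    - by rewrite W' //; lia.
    - by rewrite W' //; lia.
    split.
    - split; first by split; rewrite W' //; lia.
      + by move=> i; rewrite W' ?Hw //; lia.
      + by move=> i; rewrite Z'.
    - by move=> i iK; rewrite Z' Fs1.
    - by rewrite W' //; lia.
    - exact: leqW.
    - move=> i /andP[i20]; rewrite ltnS leq_eqVlt => /orP[/eqP -> //|ik].
      by rewrite W' ?Hi ?i20 //; lia.
  by exists t, s'; split=> //; split=> //; rewrite p' size_cat addnA.
have R7 s : Q6 s -> runs P (size finish_words)
    (fun s => [/\ pc s = (l + size (finish l))%N, word s 0 = K, word s 1 = d &
       forall a, (a < K * K)%N -> word s (2 + a) = fo a /\ real s a = ov a]) s.
  case=> [[[[H1 H2 H15] Hw Hr] Fs _ _ Hi] ps].
  have bw : all basic finish_words by [].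
  apply: (runs_steps P7 ps bw) => p'; rewrite p'.
  have js22 j : j \in iota 2 20 -> (2 <= j < 22)%N by rewrite mem_iota.
  have B64 : (64 <= B)%N by exact: leq_trans (leq_addr _ _) BK.
  have [L1 L2 L3 L4] := steps_low_words H2 B64 (iota_uniq 2 20) js22.
  rewrite -/finish_words in L1 L2 L3 L4.
  move: (steps finish_words s) L1 L2 L3 L4 => s1 L1 L2 L3 L4.
  split.
  - by rewrite /finish -/c1 -/l2 -/c3 -/l4 -/c5 -/l6 [in RHS]size_cat addnA.
  - by rewrite L2.
  - by rewrite L3 ?mem_iota //; lia.
  move=> a aK; split; last by rewrite L1 Fs.
  have [a20|a20] := ltnP a 20.
    by rewrite L4 ?addKn ?Hw // mem_iota; lia.
  rewrite L3 ?mem_iota; try lia.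
  by rewrite Hi // a20 leq_max aK orbT.
apply: runs_trans R7; apply: runs_trans R6; apply: runs_trans R5.
apply: runs_trans R4; apply: runs_trans R3; exact: runs_trans R1 R2.
Qed.

End Finish.

Lemma nth_allpairs (S T V : Type) (f : S -> T -> V) (s : seq S) (t : seq T) a0 b0 x0 i j :
  (i < size s)%N -> (j < size t)%N ->
  nth x0 [seq f a b | a <- s, b <- t] (i * size t + j) = f (nth a0 s i) (nth b0 t j).
Proof.
elim: s i => // a s IH [|i] /= iN jt; rewrite nth_cat size_map.
  by rewrite jt (nth_map b0).
by rewrite mulSn -addnA ltnNge leq_addr /= addKn IH.
Qed.

Lemma nth_entries (R : realType) n (M : 'M[option R]_n) x0 (i j : 'I_n) :
  nth x0 [seq M i j | i <- enum 'I_n, j <- enum 'I_n] (i * n + j) = M i j.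
Proof.
have := @nth_allpairs _ _ _ (fun a b => M a b) (enum 'I_n) (enum 'I_n) i j x0 i j.
by rewrite size_enum_ord !nth_ord_enum => ->.
Qed.

(** * Polynomial running time and the assembled program *)

Definition polynomial_bound (f : nat -> nat) : Prop :=
  exists c k, forall n, (f n <= c * n.+1 ^ k)%N.

Lemma bound_const a : polynomial_bound (fun=> a).
Proof. by exists a, 0%N => n; rewrite expn0 muln1. Qed.

Lemma bound_id : polynomial_bound id.
Proof. by exists 1%N, 1%N => n; rewrite expn1 mul1n. Qed.

Lemma bound_add f g : polynomial_bound f -> polynomial_bound g ->
  polynomial_bound (fun n => f n + g n)%N.
Proof.
move=> [c [k Hf]] [c' [k' Hg]]; exists (c + c')%N, (k + k')%N => n.
rewrite mulnDl; apply: leq_add.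
  by apply: leq_trans (Hf n) _; rewrite leq_mul // leq_pexp2l // leq_addr.
by apply: leq_trans (Hg n) _; rewrite leq_mul // leq_pexp2l // leq_addl.
Qed.

Lemma bound_mul f g : polynomial_bound f -> polynomial_bound g ->
  polynomial_bound (fun n => f n * g n)%N.
Proof.
move=> [c [k Hf]] [c' [k' Hg]]; exists (c * c')%N, (k + k')%N => n.
by rewrite expnD mulnACA leq_mul.
Qed.

Lemma bound_time c : polynomial_bound (fun n => time n c).
Proof.
elim: c => [|x e|x e|a i e|a i e|c1 IH1 c2 IH2|t c1 IH1 c2 IH2|x c IH] /=;
  try exact: bound_const.
- exact: bound_add.
- by apply: bound_add => //; apply: bound_add => //; exact: bound_const.
- apply: bound_add; last exact: bound_const.
  apply: bound_mul; first exact: bound_id.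
  by apply: bound_add => //; exact: bound_const.
Qed.

Definition kernel_code : seq instr := code (size load) kernelize.

Definition kernel_end : nat := size load + size kernel_code.

Definition kernel_program : program :=
  load ++ kernel_code ++ [:: WConst 32 0; JumpWEq 13 32 (kernel_end + 3); Halt Reject] ++
  finish (kernel_end + 3) ++ [:: Halt Output].

Definition kernel_time (n : nat) : nat :=
  (size load_prefix + (n * 5 + 2) + (3 + (n * n * 14 + 2)) + size load_suffix +
   time n kernelize + 2 +
   (2 + (n * 5 + 2) + 1 + (n * n * 12 + 2) + 5 + (n * n * 14 + 2) +
    size finish_words) + 1)%N.

Lemma bound_kernel_time : polynomial_bound kernel_time.
Proof.
have C a := bound_const a.
have L a : polynomial_bound (fun n => n * a)%N by apply: bound_mul (C a); exact: bound_id.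
have Q a : polynomial_bound (fun n => n * n * a)%N.
  by apply: bound_mul (C a); apply: bound_mul; exact: bound_id.
by rewrite /kernel_time; repeat (exact: bound_time || exact: C || exact: L || exact: Q ||
  apply: bound_add).
Qed.

Lemma runs_run (R : realType) P T v (Q : state R -> Prop) s :
  runs P T (fun s' => onth P (pc s') = Some (Halt v) /\ Q s') s ->
  exists s', run P (T + 1) s = Some (v, s') /\ Q s'.
Proof.
move=> [t [s' [tT r [h Qs]]]]; exists s'; split=> //.
by apply: (@run_more _ _ (t + 1)); [rewrite r; exact: run_halt|rewrite leq_add2r].
Qed.

Lemma program_parts P c1 c2 c3 c4 : P = c1 ++ c2 ++ c3 ++ c4 ->
  [/\ code_at P 0 c1, code_at P (size c1) c2, code_at P (size c1 + size c2) c3 &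
      code_at P (size c1 + size c2 + size c3) c4].
Proof.
move=> ->; split.
- exact: (@code_at_program [::] c1 (c2 ++ c3 ++ c4)).
- exact: (@code_at_program c1 c2 (c3 ++ c4)).
- by have := @code_at_program (c1 ++ c2) c3 c4; rewrite -catA size_cat.
- by have := @code_at_program (c1 ++ c2 ++ c3) c4 [::]; rewrite cats0 -!catA !size_cat addnA.
Qed.

Opaque load kernelize finish.

Lemma kernel_program_ok (R : realType) n d Delta (M : 'M[option R]_n) :
  partial_matrix M -> unspecified_le M Delta ->
  exists (v : verdict) (s : state R),
    run kernel_program (kernel_time n) (start (instance_data M d)) = Some (v, s) /\
    match v with
    | Accept => EDMC M d
    | Reject => ~ EDMC M d
    | Output =>
        exists (n' : nat) (M' : 'M[option R]_n'),
          [/\ stores s (instance_data M' d),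
              principal_submatrix M' M,
              (EDMC M' d <-> EDMC M d)
            & (n' <= (d + 1) * (Delta + 1) ^ 2)%N]
    end.
Proof.
move=> pM uM; set P := kernel_program.
set entries := [seq M i j | i <- enum 'I_n, j <- enum 'I_n].
have size_entries : size entries = (n * n)%N by rewrite size_allpairs size_enum_ord.
set fl := [seq nat_of_bool (isSome e) | e <- entries].
set vals := [seq odflt 0 e | e <- entries].
have size_fl : size fl = (n * n)%N by rewrite size_map.
have cell_lt (i j : 'I_n) : (i * n + j < n * n)%N.
  by have := ltn_ord i; have := ltn_ord j; nia.
have nth_fl (i j : 'I_n) : nth 0%N fl (i * n + j) = isSome (M i j).
  by rewrite (nth_map None) ?size_entries // nth_entries.
have nth_vals (i j : 'I_n) : nth 0 vals (i * n + j) = val0 M i j.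
  by rewrite (nth_map None) ?size_entries // nth_entries.
have bits_fl : all (fun b => b <= 1)%N fl.
  by apply/allP => b /mapP[e _ ->]; case: (isSome e).
have vals0 : nth 0 vals 0 = 0.
  have [n0|n0] := posnP n; first by rewrite nth_default // size_map size_entries n0.
  pose o : 'I_n := Ordinal n0.
  by have := nth_vals o o; rewrite /= /val0; case: pM => _ -> _.
have [P1 P2 P3 P4] := program_parts (erefl kernel_program).
rewrite -/P -/kernel_end in P1 P2 P3 P4; clearbody P.
rewrite [size [:: _; _; _]]/= in P4.
have [P5 P6] := code_at_cat P4.
pose B := (64 + n * n)%N.
have L := @load_ok R n d fl vals size_fl bits_fl vals0 P P1.
case: L => t1 [s1 [T1 r1 [p1 [s10 s11 s12] s1c]]].
(* The initial store is read off the memory itself, which makes [rep] immediate even for array cells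
   that the loader never wrote. *)
pose m := Store (word s1) (real s1) (fun a i => word s1 (B + 8 * i + a))
  (fun a i => real s1 (B + 8 * i + a)).
have B64 : (64 <= B)%N by exact: leq_addr.
have m1 : rep B m s1 by split.
have [t2 [s2 [T2 r2 p2 m2]]] := code_ok B64 kernelize_ok P2 p1 m1 s10.
rewrite -/kernel_code -/kernel_end in p2.
have [|i j|KR KB KE KK [_ KO]] := @kernelize_spec R n d M m pM s10 s11.
- by move=> i j; rewrite /= addn0 (s1c _ (cell_lt i j)).1.
- by rewrite /= addn0 (s1c _ (cell_lt i j)).2.
move: (exec n kernelize m) (exec_frame n kernelize m) m2 KR KB KE KK KO =>
  m' Fm m2 KR KB KE KK KO.
set K := kept m' n in KR KB KE KK KO.
pose s3 := branch (set_word s2 32 0) (word s2 13 == 0%N) (kernel_end + 3).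
have r3 : reaches P 2 s2 s3.
  move/code_at_head: P3 => [h0 /code_at_head[h1 _]].
  have E : s3 = step (JumpWEq 13 32 (kernel_end + 3)) (step (WConst 32 0) s2) by [].
  rewrite E; apply: (@reaches_trans _ _ 1 1).
    by apply: (reaches1 (i := WConst 32 0)) => //; rewrite p2.
  by apply: (reaches1 (i := JumpWEq 13 32 (kernel_end + 3))) => //=; rewrite p2.
have R3 Q T : runs P T Q s3 -> runs P
   (size load_prefix + (n * 5 + 2) + (3 + (n * n * 14 + 2)) + size load_suffix +
   time n kernelize + 2 + T) Q (start (instance_data M d)).
  move=> [t [s [tT r Qs]]]; exists (t1 + t2 + 2 + t)%N, s; split=> //.
    by rewrite !leq_add.
  exact: reaches_trans (reaches_trans (reaches_trans r1 r2) r3) r.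
have s2w x : (x < 32)%N -> word s2 x = wv m' x by exact: (rep_wv m2).
have [rej|acc] := boolP (word s2 13 == 0%N); last first.
  have [|s [rs _]] := @runs_run R P _ Reject (fun=> True) (start (instance_data M d))
    (R3 _ (2 + (n * 5 + 2) + 1 + (n * n * 12 + 2) + 5 + (n * n * 14 + 2) +
    size finish_words)%N _).
    exists 0%N, s3; split=> //; split=> //.
    rewrite /s3 (negbTE acc) /= p2.
    by have := P3 2%N isT; rewrite addn2.
  by exists Reject, s; split=> //; apply: KR; rewrite -s2w.
have K0 : wv m' 13 = 0%N by rewrite -s2w //; exact/eqP.
have Kn : (size K <= n)%N by rewrite size_filter (leq_trans (count_size _ _)) // size_iota.
have BK : (64 + size K * size K <= B)%N by rewrite leq_add2l leq_mul.
have ps3 : pc s3 = (kernel_end + 3)%N by rewrite /s3 rej.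
have s3w x : x != 32 -> word s3 x = word s2 x by move=> /negbTE x32; rewrite /= x32.
have s3r : real s3 = real s2 by [].
clearbody s3.
have far i : (B + 8 * i + 4)%N != 32 by rewrite /B; lia.
have [|||i|i|t4 [s4 [T4 r4 [p4 s40 s41 s4c]]]] := @finish_ok R d (size K) B
  (fun i => wa m' 4 i) (fun i => za m' 5 i) BK P (kernel_end + 3)%N s3 P5 ps3.
- by rewrite s3w // s2w // (fr_wv Fm) //= s11.
- by rewrite s3w // s2w // (fr_wv Fm) //= s12.
- by rewrite s3w // s2w.
- by rewrite s3w // (rep_wa m2).
- by rewrite s3r (rep_za m2).
have [|s [rs Es]] := @runs_run R P _ Output (fun s => s = s4) (start (instance_data M d))
    (R3 _ (2 + (n * 5 + 2) + 1 + (n * n * 12 + 2) + 5 + (n * n * 14 + 2) +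
    size finish_words)%N _).
  exists t4, s4; split=> //.
    apply: leq_trans T4 _; have : (size K * size K <= n * n)%N by rewrite leq_mul.
    by lia.
  split=> //; rewrite p4.
  by have := P6 0%N isT; rewrite addn0.
exists Output, s; split=> //; rewrite {}Es.
have K_lt a : (a < size K)%N -> (nth 0%N K a < n)%N.
  move=> aK; have : nth 0%N K a \in K by exact: mem_nth.
  by rewrite mem_filter mem_iota => /andP[_].
pose f (a : 'I_(size K)) : 'I_n := Ordinal (K_lt a (ltn_ord a)).
exists (size K), (mxsub f f M); split.
- have size_entries' : size [seq (mxsub f f M) i j | i <- enum 'I_(size K),
      j <- enum 'I_(size K)] = (size K * size K)%N by rewrite size_allpairs size_enum_ord.
  have entry b (x0 : option R) : (b < size K * size K)%N ->
     wa m' 4 b = isSome (nth x0 [seq (mxsub f f M) i j | i <- enum 'I_(size K),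
       j <- enum 'I_(size K)] b) /\
     za m' 5 b = odflt 0 (nth x0 [seq (mxsub f f M) i j | i <- enum 'I_(size K),
       j <- enum 'I_(size K)] b).
    move=> bK; have K1 : (0 < size K)%N by case: (size K) bK.
    have iK : (b %/ size K < size K)%N by rewrite ltn_divLR.
    have jK : (b %% size K < size K)%N by rewrite ltn_mod.
    pose i := Ordinal iK; pose j := Ordinal jK.
    have bE : b = (i * size K + j)%N by exact: divn_eq.
    have pE : nth (0, 0)%N [seq (a, b) | a <- K, b <- K] b = (nth 0%N K i, nth 0%N K j).
      by rewrite bE (nth_allpairs _ 0%N 0%N).
    have bL : (b < size [seq (a, b) | a <- K, b <- K])%N by rewrite size_allpairs.
    have [E1 E2] := KO b bL; rewrite pE /= addn0 in E1 E2.
    have nE : nth x0 [seq (mxsub f f M) i j | i <- enum 'I_(size K),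
        j <- enum 'I_(size K)] b = M (f i) (f j) by rewrite bE nth_entries mxE.
    have [C1 C2] := s1c _ (cell_lt (f i) (f j)).
    rewrite nE; split; first exact: (etrans E1 (etrans C1 (nth_fl _ _))).
    exact: (etrans E2 (etrans C2 (nth_vals _ _))).
  split=> [[|[|b]]|b] /=.
  + by rewrite s40.
  + by rewrite s41.
  + rewrite !ltnS size_map size_entries' => bK.
    by rewrite (nth_map None) ?size_entries' // -(entry b None bK).1; have [] := s4c b bK.
  + rewrite size_map size_entries' => bK.
    by rewrite (nth_map None) ?size_entries' // -(entry b None bK).2; have [] := s4c b bK.
- exists f; split=> // i j ij /=.
  have : sorted ltn K by apply: sorted_filter; [exact: ltn_trans|exact: iota_ltn_sorted].
  by move=> /(sorted_ltn_nth ltn_trans 0%N); apply; rewrite ?inE ?ltn_ord.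
- apply: KE => i iK; have iK' : (index (i : nat) K < size K)%N by rewrite index_mem.
  by exists (Ordinal iK'); apply: val_inj; rewrite /= nth_index.
- exact: KB.
Qed.

Theorem mainTheorem5 (R : realType) :
  exists (P : program) (c k : nat),
  forall (n d Delta : nat) (M : 'M[option R]_n),
    partial_matrix M ->
    unspecified_le M Delta ->
    exists (v : verdict) (s : state R),
      run P (c * data_size (instance_data M d) ^ k)%N
          (start (instance_data M d)) = Some (v, s) /\
      match v with
      | Accept => EDMC M d
      | Reject => ~ EDMC M d
      | Output =>
          exists (n' : nat) (M' : 'M[option R]_n'),
            [/\ stores s (instance_data M' d),
                principal_submatrix M' M,
                (EDMC M' d <-> EDMC M d)
              & (n' <= (d + 1) * (Delta + 1) ^ 2)%N]
      end.
Proof.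
have [c [k H]] := bound_kernel_time.
exists kernel_program, c, k => n d Delta M pM uM.
have [v [s [rs Hs]]] := kernel_program_ok d pM uM.
exists v, s; split=> //; apply: run_more rs _.
apply: leq_trans (H n) _; rewrite leq_mul2l; apply/orP; right.
(* The data consist of two header words and [2 * n * n] cells, so their number is at least [n + 1],
   the base of the polynomial bound. *)
have nS : (n < data_size (instance_data M d))%N.
  rewrite /data_size /= !size_map size_allpairs size_enum_ord; nia.
by case: k H => [|k] _; rewrite ?expn0 // leq_exp2r.
Qed.
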